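(* An $8$-dimensional (real dimension) nilmanifold endowed with an invariant complex structure $X=(M,J)$ admits an invariant astheno-Kähler metric if and only if there exists an invariant $(1,0)$-coframe $\{\omega^k\}_{k=1}^4$ on $X$ satisfying $$d\omega^1=d\omega^2=d\omega^3=0,\qquad d\omega^4=\sum_{1\leq j<k\leq3}A_{jk}\,\omega^{jk}+\sum_{1\leq j,k\leq3}B_{jk}\,\omega^{j\bar k},$$ for some $A_{jk},B_{jk}\in\mathbb C$ with $\mathcal T=0$, where $$\mathcal T=\sum_{1\leq j<k\leq3}|A_{jk}|^2+\sum_{1\leq j,k\leq3}|B_{jk}|^2-\Big|\sum_{1\leq j\leq3}B_{jj}\Big|^2.$$
   Context: A nilmanifold $M=\Gamma\backslash G$ is a compact quotient of a connected, simply connected real nilpotent Lie group $G$ by a lattice $\Gamma$. Invariant complex structures, forms, coframes and metrics on $M$ are those induced by left-invariant ones on $G$, i.e. defined on its Lie algebra. A Hermitian metric (identified with its fundamental form $F$) on a complex manifold of complex dimension $n$ is astheno-Kähler if $\partial\bar\partial F^{n-2}=0$. Notation: $\omega^{jk}=\omega^j\wedge\omega^k$, $\omega^{j\bar k}=\omega^j\wedge\overline{\omega^k}$. *)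

(* Defs.v *)
From HB Require Import structures.
From mathcomp Require Import all_boot all_order all_algebra all_fingroup.
From mathcomp Require Import all_classical all_reals all_analysis.
From mathcomp Require Import complex.

Set Implicit Arguments.
Unset Strict Implicit.
Unset Printing Implicit Defensive.

Import Order.TTheory GRing.Theory Num.Theory.
Import numFieldNormedType.Exports.

Local Open Scope classical_set_scope.
Local Open Scope ring_scope.
Local Open Scope complex_scope.

Record is_lie_bracket (R : realType) (m : nat)
    (br : 'rV[R]_m -> 'rV[R]_m -> 'rV[R]_m) : Prop := IsLieBracket {
  lie_linearl : forall (a : R) x y z, br (a *: x + y) z = a *: br x z + br y z;
  lie_linearr : forall (a : R) x y z, br z (a *: x + y) = a *: br z x + br z y;
  lie_alternating : forall x, br x x = 0;
  lie_jacobi : forall x y z, br x (br y z) + br y (br z x) + br z (br x y) = 0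
}.

(* [lower_central br k.+1] is the span of the brackets [br x y] with [x] in
   [lower_central br k], as the intersection of the subspaces containing
   them. *)
Fixpoint lower_central (R : realType) (m : nat)
    (br : 'rV[R]_m -> 'rV[R]_m -> 'rV[R]_m) (k : nat) : set 'rV[R]_m :=
  if k is k'.+1 then
    [set z | forall U : {vspace 'rV[R]_m},
       (forall x y, lower_central br k' x -> br x y \in U) -> z \in U]
  else setT.

Definition is_nilpotent (R : realType) (m : nat)
    (br : 'rV[R]_m -> 'rV[R]_m -> 'rV[R]_m) : Prop :=
  exists k : nat, lower_central br k `<=` [set 0].

(* For a nilpotent Lie algebra, exp identifies the connected, simply connected
   Lie group with the Lie algebra itself, with neutral element 0, inverse -x
   and the Baker-Campbell-Hausdorff product. *)

(* [nested_bracket br [:: x1; ...; xk] = [x1, [x2, ... [x(k-1), xk]]]] *)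
Fixpoint nested_bracket (R : realType) (m : nat)
    (br : 'rV[R]_m -> 'rV[R]_m -> 'rV[R]_m) (w : seq 'rV[R]_m) : 'rV[R]_m :=
  match w with
  | [::] => 0
  | [:: x] => x
  | x :: w' => br x (nested_bracket br w')
  end.

(* Dynkin's formula for log (exp x exp y):
     sum_n (-1)^(n-1)/n sum_(r_i + s_i > 0)
       [x^r_1 y^s_1 ... x^r_n y^s_n] / ((sum_i r_i + s_i) prod_i r_i! s_i!).
   A nilpotent Lie algebra of dimension m has no nonzero nested bracket of
   more than m elements, so letting n, r_i, s_i <= m loses no term. *)
Definition bch (R : realType) (m : nat)
    (br : 'rV[R]_m -> 'rV[R]_m -> 'rV[R]_m) (x y : 'rV[R]_m) : 'rV[R]_m :=
  \sum_(1 <= n < m.+1)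
   \sum_(r : {ffun 'I_n -> 'I_m.+1})
    \sum_(s : {ffun 'I_n -> 'I_m.+1} | [forall i, (0 < r i + s i)%N])
      ((-1) ^+ n.-1 / n%:R / (\sum_i (r i + s i))%N%:R
         / (\prod_i ((r i)`! * (s i)`!))%N%:R) *:
      nested_bracket br
        (flatten [seq nseq (r i) x ++ nseq (s i) y | i <- enum 'I_n]).

(* [lattice_cocompact] is compactness of Gamma\G for the quotient topology,
   whose open sets are the open sets of G stable by left translation by
   Gamma. *)
Record is_lattice (R : realType) (m : nat)
    (br : 'rV[R]_m -> 'rV[R]_m -> 'rV[R]_m) (Gamma : set 'rV[R]_m) : Prop :=
  IsLattice {
  lattice_one : Gamma 0;
  lattice_mul : forall x y, Gamma x -> Gamma y -> Gamma (bch br x y);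
  lattice_inv : forall x, Gamma x -> Gamma (- x);
  lattice_discrete : forall x, Gamma x -> \forall y \near x, Gamma y -> y = x;
  lattice_cocompact :
    forall (I : choiceType) (D : set I) (f : I -> set 'rV[R]_m),
      (forall i, D i -> open (f i)) ->
      (forall i, D i -> forall g x, Gamma g -> f i x -> f i (bch br g x)) ->
      setT `<=` cover D f -> finite_subset_cover D f setT
}.

(* [J] acts on row vectors by [x |-> x *m J]. *)
Definition nijenhuis (R : realType) (m : nat)
    (br : 'rV[R]_m -> 'rV[R]_m -> 'rV[R]_m) (J : 'M[R]_m) (x y : 'rV[R]_m) :=
  br x y + br (x *m J) y *m J + br x (y *m J) *m J - br (x *m J) (y *m J).

Definition is_complex_structure (R : realType) (m : nat)
    (br : 'rV[R]_m -> 'rV[R]_m -> 'rV[R]_m) (J : 'M[R]_m) : Prop :=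
  J *m J = - 1%:M /\ forall x y, nijenhuis br J x y = 0.

(* Invariant complex-valued k-forms are the alternating C-multilinear maps on k arguments in
   the complexified Lie algebra C^m. *)

Definition inv_form (R : realType) (m k : nat) : Type :=
  ('I_k -> 'rV[R[i]]_m) -> R[i].

Definition is_form (R : realType) (m k : nat) (f : inv_form R m k) : Prop :=
  (forall (X : 'I_k -> 'rV[R[i]]_m) (j : 'I_k) (a : R[i]) (u v : 'rV[R[i]]_m),
     f [eta X with j |-> a *: u + v] =
       a * f [eta X with j |-> u] + f [eta X with j |-> v]) /\
  (forall (X : 'I_k -> 'rV[R[i]]_m) (j l : 'I_k),
     j != l -> X j = X l -> f X = 0).

Definition cplx_mx (R : realType) (m n : nat) (A : 'M[R]_(m, n)) :
    'M[R[i]]_(m, n) := map_mx (fun x : R => x%:C) A.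

Definition cplx_bracket (R : realType) (m : nat)
    (br : 'rV[R]_m -> 'rV[R]_m -> 'rV[R]_m) (z w : 'rV[R[i]]_m) :
    'rV[R[i]]_m :=
  let re := map_mx (@complex.Re R) in let im := map_mx (@complex.Im R) in
  cplx_mx (br (re z) (re w) - br (im z) (im w)) +
  'i *: cplx_mx (br (re z) (im w) + br (im z) (re w)).

Definition conj_form (R : realType) (m k : nat) (f : inv_form R m k) :
    inv_form R m k :=
  fun X => conjc (f (fun j => map_mx conjc (X j))).

Definition wedge (R : realType) (m p q : nat)
    (f : inv_form R m p) (g : inv_form R m q) : inv_form R m (p + q) :=
  fun X => ((p`! * q`!)%N%:R)^-1 *
    \sum_(s : 'S_(p + q)) (-1) ^+ s *
      (f (fun j => X (s (lshift q j))) * g (fun j => X (s (rshift p j)))).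

Fixpoint form_pow (R : realType) (m : nat) (F : inv_form R m 2) (k : nat) :
    inv_form R m k.*2 :=
  if k is k'.+1 then wedge F (@form_pow R m F k') else fun _ => 1.
Arguments form_pow {R m} F k X : rename.

(* The differential of left-invariant forms,
     (df)(X_0, ..., X_k) =
       sum_(i < j) (-1)^(i+j) f([X_i, X_j], X_0, ..^i..^j.., X_k),
   with [X_i, X_j] moved to the place of X_i, which turns the sign into
   (-1)^j. *)
Definition ext_d (R : realType) (m k : nat)
    (br : 'rV[R]_m -> 'rV[R]_m -> 'rV[R]_m) (f : inv_form R m k) :
    inv_form R m k.+1 :=
  fun X => \sum_(j < k.+1) \sum_(i < k.+1 | (i < j)%N) (-1) ^+ j *
    f (fun l => [eta X with i |-> cplx_bracket br (X i) (X j)] (lift j l)).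

Definition proj10 (R : realType) (m : nat) (J : 'M[R]_m) (z : 'rV[R[i]]_m) :
    'rV[R[i]]_m := 2^-1 *: (z - 'i *: (z *m cplx_mx J)).

Definition proj01 (R : realType) (m : nat) (J : 'M[R]_m) (z : 'rV[R[i]]_m) :
    'rV[R[i]]_m := 2^-1 *: (z + 'i *: (z *m cplx_mx J)).

(* The component of bidegree (p, k - p) of a k-form (0 if p > k). *)
Definition bidegree_part (R : realType) (m k : nat) (J : 'M[R]_m) (p : nat)
    (f : inv_form R m k) : inv_form R m k :=
  fun X => \sum_(S : {set 'I_k} | #|S| == p)
    f (fun j => if j \in S then proj10 J (X j) else proj01 J (X j)).

Definition del (R : realType) (m k : nat)
    (br : 'rV[R]_m -> 'rV[R]_m -> 'rV[R]_m) (J : 'M[R]_m) (f : inv_form R m k) :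
    inv_form R m k.+1 :=
  fun X => \sum_(p < k.+1)
    bidegree_part J p.+1 (ext_d br (bidegree_part J p f)) X.

Definition delbar (R : realType) (m k : nat)
    (br : 'rV[R]_m -> 'rV[R]_m -> 'rV[R]_m) (J : 'M[R]_m) (f : inv_form R m k) :
    inv_form R m k.+1 :=
  fun X => \sum_(p < k.+1)
    bidegree_part J p (ext_d br (bidegree_part J p f)) X.

Definition is_form10 (R : realType) (m : nat) (J : 'M[R]_m)
    (f : inv_form R m 1) : Prop :=
  is_form f /\ forall X, bidegree_part J 1 f X = f X.

(* A coframe is a basis of the space of invariant (1,0)-forms. *)
Definition is_coframe10 (R : realType) (m n : nat) (J : 'M[R]_m)
    (w : 'I_n -> inv_form R m 1) : Prop :=
  (forall k, is_form10 J (w k)) /\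
  (forall f : inv_form R m 1, is_form10 J f ->
     exists! c : 'rV[R[i]]_n, forall X, f X = \sum_(k < n) c 0 k * w k X).

(* [h] is the Gram matrix of the metric. *)
Definition is_hermitian_metric (R : realType) (m : nat) (J h : 'M[R]_m) :
    Prop :=
  [/\ h^T = h,
      forall x : 'rV[R]_m, x != 0 -> 0 < (x *m h *m x^T) 0 0
    & forall x y : 'rV[R]_m,
        ((x *m J) *m h *m (y *m J)^T) 0 0 = (x *m h *m y^T) 0 0].

(* F(x, y) = h(Jx, y), extended C-bilinearly *)
Definition fundamental_form (R : realType) (m : nat) (J h : 'M[R]_m) :
    inv_form R m 2 :=
  fun X => (X 0 *m cplx_mx J *m cplx_mx h *m (X 1)^T) 0 0.

(* The complex dimension n is m./2. *)
Definition is_astheno_kahler (R : realType) (m : nat)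
    (br : 'rV[R]_m -> 'rV[R]_m -> 'rV[R]_m) (J h : 'M[R]_m) : Prop :=
  is_hermitian_metric J h /\
  forall X, del br J (delbar br J
    (form_pow (fundamental_form J h) (m./2 - 2))) X = 0.

(* Main.v *)
Require Import Defs.
From HB Require Import structures.
From mathcomp Require Import all_boot all_order all_algebra all_fingroup.
From mathcomp Require Import all_classical all_reals all_analysis.
From mathcomp Require Import complex sesquilinear spectral.
From mathcomp Require Import ring zify.

Set Implicit Arguments.
Unset Strict Implicit.
Unset Printing Implicit Defensive.

Import Order.TTheory GRing.Theory Num.Theory.
Import numFieldNormedType.Exports.

(* Let F be astheno-Kaehler.  Pairing [del delbar F^2] with two invariant
   (1,0)-forms and using that a nilpotent Lie algebra is unimodular gives a
   Hermitian identity [Q(alpha, beta) = 0] in a unitary coframe, where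
     Q(alpha, beta) = <d alpha, d beta> - tr(d alpha) conj(tr(d beta))
                      + <s alpha, beta> + conj <s beta, alpha>,
   [tr] contracts the (1,1)-part and [s] is a contraction of [delbar del].
   On the space L of forms with [delbar del alpha = 0] this reads
   |d alpha|^2 = |tr(d alpha)|^2, so the forms of L with zero trace are closed.
   Engel's theorem provides, for every proper subspace U, a form outside U all
   of whose [delbar]-coefficients lie in U; applied to the closed forms and to
   L, it shows together with the Cauchy-Schwarz inequality that L contains
   every (1,0)-form.  The closed forms are then the kernel of the linear form
   [tr], of codimension at most 1, and T = 0 is the identity above for the last
   form of an adapted unitary coframe.  Conversely, for the metric making the
   given coframe unitary, [Q] vanishes identically, hence so does
   [del delbar F^2], by the same identity. *)

Local Open Scope ring_scope.
Local Notation "A ^*m" := (map_mx Num.conj A) (at level 2, format "A ^*m").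

Section LinearFor.
Variables (K : pzRingType) (U : lmodType K) (W : zmodType).
Variables (s : GRing.Scale.law K W) (f : U -> W).
Hypothesis f_linear : GRing.linear_for s f.

Let F : {linear U -> W | s} := HB.pack f (GRing.isLinear.Build K U W s f f_linear).

Lemma linear_for0 : f 0 = 0. Proof. exact: (linear0 F). Qed.
Lemma linear_forD : {morph f : u v / u + v}. Proof. exact: (linearD F). Qed.
Lemma linear_forN : {morph f : u / - u}. Proof. exact: (linearN F). Qed.
Lemma linear_forB : {morph f : u v / u - v}. Proof. exact: (linearB F). Qed.
Lemma linear_forZ a : {morph f : u / a *: u >-> s a u}.
Proof. exact: (linearZ_LR F). Qed.
Lemma linear_for_sum I (r : seq I) (P : pred I) (u : I -> U) :
  f (\sum_(i <- r | P i) u i) = \sum_(i <- r | P i) f (u i).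
Proof. exact: (linear_sum F). Qed.

End LinearFor.

Lemma scalarZ_fun (K : pzRingType) (U : lmodType K) (f : U -> K) :
  scalar f -> forall a u, f (a *: u) = a * f u.
Proof. by move=> f_linear a u; rewrite (linear_forZ f_linear). Qed.

Section BilinearMaps.
Variables (K : pzRingType) (U V W : lmodType K).

Definition bilinear_map (B : U -> V -> W) :=
  (forall v, linear (B^~ v)) /\ (forall u, linear (B u)).

Variable B : U -> V -> W.
Hypothesis B_bilinear : bilinear_map B.

Lemma bilinear0l v : B 0 v = 0. Proof. exact: (linear_for0 (B_bilinear.1 v)). Qed.
Lemma bilinear0r u : B u 0 = 0. Proof. exact: (linear_for0 (B_bilinear.2 u)). Qed.
Lemma bilinearDl v u1 u2 : B (u1 + u2) v = B u1 v + B u2 v.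
Proof. exact: (linear_forD (B_bilinear.1 v) u1 u2). Qed.
Lemma bilinearDr u v1 v2 : B u (v1 + v2) = B u v1 + B u v2.
Proof. exact: (linear_forD (B_bilinear.2 u) v1 v2). Qed.
Lemma bilinearNl v u : B (- u) v = - B u v.
Proof. exact: (linear_forN (B_bilinear.1 v) u). Qed.
Lemma bilinearNr u v : B u (- v) = - B u v.
Proof. exact: (linear_forN (B_bilinear.2 u) v). Qed.
Lemma bilinearZl v a u : B (a *: u) v = a *: B u v.
Proof. exact: (linear_forZ (B_bilinear.1 v)). Qed.
Lemma bilinearZr u a v : B u (a *: v) = a *: B u v.
Proof. exact: (linear_forZ (B_bilinear.2 u)). Qed.
Lemma bilinear_suml I (r : seq I) (P : pred I) v (u : I -> U) :
  B (\sum_(i <- r | P i) u i) v = \sum_(i <- r | P i) B (u i) v.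
Proof. exact: (linear_for_sum (B_bilinear.1 v) r P u). Qed.
Lemma bilinear_sumr I (r : seq I) (P : pred I) u (v : I -> V) :
  B u (\sum_(i <- r | P i) v i) = \sum_(i <- r | P i) B u (v i).
Proof. exact: (linear_for_sum (B_bilinear.2 u) r P v). Qed.

End BilinearMaps.

Lemma alternating_bilinear_skew (K : pzRingType) (U W : lmodType K) (B : U -> U -> W) :
  bilinear_map B -> (forall u, B u u = 0) -> forall u v, B u v = - B v u.
Proof.
move=> Bb Balt u v; have := Balt (u + v).
rewrite (bilinearDl Bb) !(bilinearDr Bb) !Balt add0r addr0 => /eqP.
by rewrite addr_eq0 => /eqP.
Qed.

Lemma skew_diag_eq0 (K : numDomainType) (T : Type) (D : T -> T -> K) :
  (forall u v, D u v = - D v u) -> forall u, D u u = 0.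
Proof.
move=> D_skew u; have /eqP := D_skew u u.
by rewrite -addr_eq0 -mulr2n mulrn_eq0 => /eqP.
Qed.

(** * Multilinear forms and Chevalley-Eilenberg differentials *)

Definition upd (T : Type) k (X : 'I_k -> T) (i : 'I_k) (v : T) : 'I_k -> T :=
  [eta X with i |-> v].

Section Update.
Variables (T : Type) (k : nat).
Implicit Types (X : 'I_k -> T) (u v : T).

Lemma upd_id X i : upd X i (X i) = X.
Proof. by apply/funext => l; rewrite /upd /=; case: eqP => [->|]. Qed.

Lemma upd_upd X i u v : upd (upd X i u) i v = upd X i v.
Proof. by apply/funext => l; rewrite /upd /=; case: eqP. Qed.

Lemma updC X i j u v : i != j -> upd (upd X i u) j v = upd (upd X j v) i u.
Proof.
move=> /negbTE ij; apply/funext => l; rewrite /upd /=.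
by case: eqP => // ->; rewrite eq_sym ij.
Qed.

Lemma upd_eq X i v : upd X i v i = v.
Proof. by rewrite /upd /= eqxx. Qed.

Lemma upd_neq X i l v : l != i -> upd X i v l = X l.
Proof. by rewrite /upd /= => /negbTE ->. Qed.

End Update.

Section UpdateLift.
Variables (T : Type) (k : nat).
Implicit Types (X : 'I_k.+1 -> T) (v : T).

Lemma upd_lift_same X j i v :
  (fun l => upd X (lift j i) v (lift j l)) = upd (fun l => X (lift j l)) i v.
Proof. by apply/funext => l; rewrite /upd /= (inj_eq lift_inj). Qed.

Lemma upd_lift_drop X j v : (fun l => upd X j v (lift j l)) = (fun l => X (lift j l)).
Proof. by apply/funext => l; rewrite /upd /= eq_sym (negbTE (neq_lift _ _)). Qed.

End UpdateLift.

Lemma neq_lift_ex n (i j : 'I_n.+1) : i != j -> exists i', i = lift j i'.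
Proof. by case: (unliftP j i) => [i' ->|->]; [exists i'|rewrite eqxx]. Qed.

Lemma ltn_lift_ex n (i j : 'I_n.+1) : (i < j)%N -> exists i', i = lift j i'.
Proof. by move=> ij; apply: neq_lift_ex; apply: contraTneq ij => ->; rewrite ltnn. Qed.

Section MultilinearForms.
Variables (R : realType) (m : nat).
Local Notation C := R[i].
Local Notation V := 'rV[C]_m.
Implicit Types (u v w : V).

Definition multilinear k (f : inv_form R m k) :=
  forall X j, scalar (fun v => f (upd X j v)).

Definition vanishes_on_repeats k (f : inv_form R m k) :=
  forall (X : 'I_k -> V) j l, j != l -> X j = X l -> f X = 0.

Section OneForm.
Variables (k : nat) (f : inv_form R m k).
Hypothesis f_multilinear : multilinear f.

Lemma multilinear_upd0 X j : f (upd X j 0) = 0.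
Proof. exact: (linear_for0 (f_multilinear X j)). Qed.

Lemma multilinear_eq0 X j : X j = 0 -> f X = 0.
Proof. by move=> Xj0; rewrite -(upd_id X j) Xj0 multilinear_upd0. Qed.

Lemma multilinearD X j u v : f (upd X j (u + v)) = f (upd X j u) + f (upd X j v).
Proof. exact: (linear_forD (f_multilinear X j) u v). Qed.

Lemma multilinearZ X j a u : f (upd X j (a *: u)) = a * f (upd X j u).
Proof. exact: (scalarZ_fun (f_multilinear X j) a u). Qed.

Lemma multilinear_sum X j (I : finType) (u : I -> V) :
  f (upd X j (\sum_i u i)) = \sum_i f (upd X j (u i)).
Proof. exact: (linear_for_sum (f_multilinear X j) _ _ u). Qed.

Lemma multilinear_span_eq0 (I : finType) (g : 'I_k -> I -> V) X :
  (forall c : 'I_k -> I, f (fun j => g j (c j)) = 0) ->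
  (forall j, exists x : I -> C, X j = \sum_i x i *: g j i) -> f X = 0.
Proof.
move=> g0.
have vanish_from q : forall X, (forall j : 'I_k, (q <= j)%N -> exists i, X j = g j i) ->
    (forall j, exists x : I -> C, X j = \sum_i x i *: g j i) -> f X = 0.
  elim: q => [|q IHq] Y Yg Yspan.
    have /choice[c Yc] : forall j : 'I_k, exists i, Y j = g j i by move=> j; exact: Yg.
    by have -> : Y = fun j => g j (c j) by apply/funext.
  have [qk|qk] := ltnP q k; last first.
    by apply: IHq => // j; have := ltn_ord j; lia.
  pose jq := Ordinal qk; have [x Yx] := Yspan jq.
  rewrite -(upd_id Y jq) Yx multilinear_sum big1 // => i _.
  rewrite multilinearZ IHq ?mulr0 // => j.
    rewrite leq_eqVlt => /orP[/eqP qj|qj].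
      by exists i; rewrite (_ : j = jq) ?upd_eq //; exact/val_inj.
    rewrite upd_neq; last by apply/eqP => /(congr1 val) /=; lia.
    exact: Yg.
  have [->|j_neq] := eqVneq j jq; last by rewrite upd_neq.
  exists (fun i' => (i' == i)%:R); rewrite upd_eq (bigD1 i) //= eqxx scale1r.
  by rewrite big1 ?addr0 // => i' /negbTE ->; rewrite scale0r.
by move=> Xspan; apply: (vanish_from k) => // j; have := ltn_ord j; lia.
Qed.

Lemma multilinear_swap (P : 'I_k -> 'I_k -> Prop) :
  (forall X j l, P j l -> j != l -> X j = X l -> f X = 0) ->
  forall X j l, P j l -> j != l -> f (upd (upd X j (X l)) l (X j)) = - f X.
Proof.
move=> f_repeat X j l Pjl jl.
have lj : l != j by rewrite eq_sym.
have f0 u : f (upd (upd X j u) l u) = 0.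
  by apply: (f_repeat _ j l Pjl jl); rewrite upd_eq upd_neq // upd_eq.
have := f0 (X j + X l); rewrite updC // multilinearD ![upd (upd X l _) j _]updC //.
rewrite !multilinearD !f0 add0r addr0 => /eqP; rewrite addr_eq0 => /eqP swap.
rewrite -[in RHS](upd_id X j) -[in RHS](upd_id (upd X j (X j)) l) upd_neq //.
by rewrite swap opprK.
Qed.

Lemma vanishes_on_adjacent_repeats :
  (forall X (j l : 'I_k), l = j.+1 :> nat -> X j = X l -> f X = 0) ->
  vanishes_on_repeats f.
Proof.
move=> f_adj.
have vanish n : forall X (j l : 'I_k), l = (j + n.+1)%N :> nat -> X j = X l -> f X = 0.
  elim: n => [|n IHn] X j l jl Xjl; first by apply: (f_adj X j l) => //; lia.
  have l1k : (l.-1 < k)%N by have := ltn_ord l; lia.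
  pose l1 := Ordinal l1k.
  have l1l : l1 != l by apply/eqP => /(congr1 val) /=; lia.
  have swap : f (upd (upd X l1 (X l)) l (X l1)) = - f X.
    apply: (@multilinear_swap (fun a b => b = a.+1 :> nat)) => //=; last by lia.
    by move=> Y a b ab _; exact: f_adj.
  apply/eqP; rewrite -oppr_eq0 -swap; apply/eqP; apply: (IHn _ j l1); first by rewrite /=; lia.
  rewrite [RHS]upd_neq // upd_eq !upd_neq //; apply/eqP => /(congr1 val) /=; lia.
move=> X j l; rewrite -val_eqE neq_ltn /= => /orP[lt|lt] Xjl.
- by apply: (vanish (l - j.+1)%N X j l) => //; lia.
- by apply: (vanish (j - l.+1)%N X l j) => //; lia.
Qed.

Hypothesis f_repeat : vanishes_on_repeats f.

Lemma alternating_swap X j l : j != l -> f (upd (upd X j (X l)) l (X j)) = - f X.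
Proof.
move=> jl; apply: (@multilinear_swap (fun _ _ => True)) => // Y a b _.
exact: f_repeat.
Qed.

Lemma alternating_perm_eq0 X (s : 'S_k) : f (fun j => X (s j)) = 0 -> f X = 0.
Proof.
have [ts -> _] := prod_tpermP s.
elim: ts X => [|t ts IHts] X.
  by rewrite big_nil; under [X in f X]funext do rewrite perm1.
rewrite big_cons => fX0; apply: IHts; set Y := fun j => X _.
move: fX0; have -> : (fun j => X ((tperm t.1 t.2 * \prod_(t <- ts) tperm t.1 t.2)%g j)) =
         (fun j => Y (tperm t.1 t.2 j)).
  by apply/funext => j; rewrite permM.
have [->|t12] := eqVneq t.1 t.2.
  by rewrite tperm1; under [X in f X]funext do rewrite perm1.
have -> : (fun j => Y (tperm t.1 t.2 j)) = upd (upd Y t.1 (Y t.2)) t.2 (Y t.1).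
  apply/funext => j; case: tpermP => [->|->|/eqP j1 /eqP j2].
  - by rewrite upd_neq // upd_eq.
  - by rewrite upd_eq.
  - by rewrite !upd_neq.
by rewrite alternating_swap // => /eqP; rewrite oppr_eq0 => /eqP.
Qed.

Lemma alternating_image_eq0 (T : finType) (x : T -> V) (c d : 'I_k -> T) :
  injective d -> (forall j, exists l, c l = d j) ->
  f (fun j => x (d j)) = 0 -> f (fun j => x (c j)) = 0.
Proof.
move=> d_inj /choice[s cs] fd0.
have s_inj : injective s by move=> i j sij; apply: d_inj; rewrite -!cs sij.
apply: (alternating_perm_eq0 (s := perm s_inj)).
by rewrite -[RHS]fd0; congr f; apply/funext => j; rewrite permE cs.
Qed.

End OneForm.

Lemma multilinear_sum_form k (I : finType) (P : pred I) (F : I -> inv_form R m k) :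
  (forall i, P i -> multilinear (F i)) -> multilinear (fun X => \sum_(i | P i) F i X).
Proof.
move=> F_multilinear X j a u v; rewrite mulr_sumr -big_split; apply: eq_bigr => i Pi.
exact: F_multilinear.
Qed.

Lemma multilinear_scale k c (f : inv_form R m k) :
  multilinear f -> multilinear (fun X => c * f X).
Proof. by move=> f_multilinear X j a u v; rewrite f_multilinear mulrDr mulrCA. Qed.

Lemma scalar_upd_lift k (f : inv_form R m k) X (i j : 'I_k.+1) :
  multilinear f -> (i < j)%N -> scalar (fun w => f (fun l => upd X i w (lift j l))).
Proof. by move=> fm /ltn_lift_ex[i' ->] a u v; rewrite !upd_lift_same fm. Qed.

(* Chevalley-Eilenberg differential of the possibly non-Lie bracket [B]; it is
   [ext_d br] when [B] is the complexification of [br]. *)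
Definition ce_diff (B : V -> V -> V) k (f : inv_form R m k) : inv_form R m k.+1 :=
  fun X => \sum_(j < k.+1) \sum_(i < k.+1 | (i < j)%N) (-1) ^+ j *
    f (fun l => upd X i (B (X i) (X j)) (lift j l)).

Lemma ext_dE (br : 'rV[R]_m -> 'rV[R]_m -> 'rV[R]_m) k (f : inv_form R m k) :
  ext_d br f = ce_diff (cplx_bracket br) f.
Proof. by []. Qed.

Section Differential.
Variable B : V -> V -> V.
Hypothesis B_bilinear : bilinear_map B.

Lemma multilinear_ce_diff k (f : inv_form R m k) : multilinear f -> multilinear (ce_diff B f).
Proof.
move=> fm; apply: multilinear_sum_form => j _; apply: multilinear_sum_form => i ij.
apply: multilinear_scale => X s a u v.
have [i' def_i] := ltn_lift_ex ij.
have ji : j != i by apply: contraTneq ij => ->; rewrite ltnn.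
have insert_bracket w :
    (fun l => upd (upd X s w) i (B (upd X s w i) (upd X s w j)) (lift j l)) =
    upd (fun l => upd X s w (lift j l)) i' (B (upd X s w i) (upd X s w j)).
  by rewrite {1}def_i upd_lift_same.
rewrite !insert_bracket.
have [->|sj] := eqVneq s j.
  by rewrite !upd_lift_drop !upd_eq !(upd_neq _ _ (_ : i != j)) 1?eq_sym // B_bilinear.2 fm.
have [->|si] := eqVneq s i.
  have overwrite w w' :
      upd (fun l => upd X i w (lift j l)) i' w' = upd (fun l => X (lift j l)) i' w'.
    by rewrite {1}def_i upd_lift_same upd_upd.
  by rewrite !overwrite !upd_eq !(upd_neq _ _ ji) B_bilinear.1 fm.
have [s' def_s] := neq_lift_ex sj.
have s'i' : s' != i' by apply: contraNneq si; rewrite def_s def_i => ->.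
rewrite def_s in sj si *.
by rewrite !upd_lift_same !(updC _ _ _ s'i') !(upd_neq _ _ (_ : i != lift j s')) 1?eq_sym //
  !(upd_neq _ _ (_ : j != lift j s')) 1?eq_sym // fm.
Qed.

Section AdjacentRepeat.
Variables (k : nat) (f : inv_form R m k).
Hypotheses (B_alt : forall u, B u u = 0) (fm : multilinear f) (f_repeat : vanishes_on_repeats f).
Variables (X : 'I_k.+1 -> V) (p q : 'I_k.+1).
Hypotheses (q_succ : q = p.+1 :> nat) (Xpq : X p = X q).

Let term (i j : 'I_k.+1) := (-1) ^+ j * f (fun l => upd X i (B (X i) (X j)) (lift j l)).

Let pq : p != q. Proof. by apply/eqP => /(congr1 val); rewrite /= q_succ; lia. Qed.

Let term_disjoint (i j : 'I_k.+1) :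
  i != p -> i != q -> j != p -> j != q -> term i j = 0.
Proof.
move=> ip iq; rewrite eq_sym => /neq_lift_ex[p' def_p]; rewrite eq_sym => /neq_lift_ex[q' def_q].
rewrite /term (f_repeat (j := p') (l := q')) ?mulr0 //.
  by apply: contraNneq pq; rewrite def_p def_q => ->.
by rewrite -def_p -def_q !upd_neq // eq_sym.
Qed.

Let term_pq : term p q = 0.
Proof.
rewrite /term Xpq B_alt; have [|p' def_p] := @ltn_lift_ex _ p q; first by rewrite q_succ.
by rewrite def_p upd_lift_same multilinear_upd0 // mulr0.
Qed.

(* The two families [X p := [X p, X j]] and [X q := [X q, X j]] differ by a swap. *)
Let term_left (j : 'I_k.+1) : (q < j)%N -> term p j + term q j = 0.
Proof.
move=> qj; have pj : (p < j)%N by apply: leq_ltn_trans qj; rewrite q_succ.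
rewrite /term -mulrDr.
have [p' def_p] := ltn_lift_ex pj; have [q' def_q] := ltn_lift_ex qj.
have p'q' : p' != q' by apply: contraNneq pq; rewrite def_p def_q => ->.
set Y := fun l => upd X p (B (X p) (X j)) (lift j l).
have -> : (fun l => upd X q (B (X q) (X j)) (lift j l)) = upd (upd Y p' (Y q')) q' (Y p').
  rewrite /Y -Xpq def_p def_q !upd_lift_same -def_p -def_q.
  rewrite upd_eq upd_neq 1?eq_sym // upd_upd.
  by congr (upd _ _ _); rewrite -Xpq def_p; exact/esym/(upd_id (fun l => X (lift j l)) p').
by rewrite alternating_swap // addrN mulr0.
Qed.

Let term_right (i : 'I_k.+1) : (i < p)%N -> term i p + term i q = 0.
Proof.
move=> ip; rewrite /term q_succ exprS -Xpq.
have -> : (fun l => upd X i (B (X i) (X p)) (lift q l)) =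
          (fun l => upd X i (B (X i) (X p)) (lift p l)).
  apply/funext => l; have [lp|lp] := eqVneq (l : nat) (p : nat).
    have -> : lift q l = p by apply: val_inj; rewrite /= /bump q_succ lp; lia.
    have -> : lift p l = q by apply: val_inj; rewrite /= /bump q_succ lp; lia.
    by rewrite !upd_neq ?Xpq //; apply/eqP => /(congr1 val) /=; lia.
  congr (upd _ _ _ _); apply: val_inj; rewrite /= /bump q_succ.
  by rewrite ltn_neqAle eq_sym lp.
by ring.
Qed.

Let column (j : 'I_k.+1) := \sum_(i < k.+1 | (i < j)%N) term i j.

Let column_pq : column p + column q = 0.
Proof.
have -> : column q = \sum_(i < k.+1 | (i < p)%N) term i q.
  rewrite /column (bigD1 p) /= ?q_succ // term_pq add0r; apply: eq_bigl => i.
  by rewrite ltnS ltn_neqAle -val_eqE andbC.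
by rewrite -big_split big1 //= => i ip; exact: term_right.
Qed.

Let column_other j : j != p -> j != q -> column j = 0.
Proof.
move=> jp jq; have [pj|jp_le] := ltnP p j; last first.
  rewrite /column big1 // => i ij; apply: term_disjoint => //.
    by apply: contraTneq ij => ->; rewrite -leqNgt.
  by apply: contraTneq ij => ->; rewrite -leqNgt q_succ leqW.
have qj : (q < j)%N by rewrite ltn_neqAle q_succ pj andbT -q_succ val_eqE eq_sym.
rewrite /column (bigD1 p) //= (bigD1 q) ?qj 1?eq_sym //= addrA term_left // add0r big1 // => i.
by move=> /andP[/andP[_ ip] iq]; exact: term_disjoint.
Qed.

Lemma ce_diff_adjacent_repeat : ce_diff B f X = 0.
Proof.
change (\sum_j column j = 0); rewrite (bigD1 p) //= (bigD1 q) 1?eq_sym //= addrA column_pq.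
by rewrite add0r big1 // => j /andP[jp jq]; exact: column_other.
Qed.

End AdjacentRepeat.

Lemma vanishes_on_repeats_ce_diff k (f : inv_form R m k) : (forall u, B u u = 0) ->
  multilinear f -> vanishes_on_repeats f -> vanishes_on_repeats (ce_diff B f).
Proof.
move=> B_alt fm f_repeat; apply: vanishes_on_adjacent_repeats.
  exact: multilinear_ce_diff.
by move=> X p q pq Xpq; exact: (ce_diff_adjacent_repeat B_alt fm f_repeat pq Xpq).
Qed.

End Differential.

Lemma ce_diffD B1 B2 k (f : inv_form R m k) X : multilinear f ->
  ce_diff (fun u v => B1 u v + B2 u v) f X = ce_diff B1 f X + ce_diff B2 f X.
Proof.
move=> fm; rewrite /ce_diff -big_split; apply: eq_bigr => j _ /=.
rewrite -big_split; apply: eq_bigr => i ij /=.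
by rewrite (linear_forD (scalar_upd_lift X fm ij)) mulrDr.
Qed.

Lemma ce_diff_sum B k (I : finType) (F : I -> inv_form R m k) X :
  ce_diff B (fun Y => \sum_s F s Y) X = \sum_s ce_diff B (F s) X.
Proof.
rewrite /ce_diff exchange_big; apply: eq_bigr => j _ /=.
by rewrite exchange_big; apply: eq_bigr => i ij /=; rewrite mulr_sumr.
Qed.

Lemma ce_diff_eq B k (f g : inv_form R m k) X :
  (forall Y, f Y = g Y) -> ce_diff B f X = ce_diff B g X.
Proof. by move=> /funext ->. Qed.

End MultilinearForms.

(** * Bidegree *)

(* The projections [pr true] and [pr false] on the two summands of [V]; below,
   they are [proj10 J] and [proj01 J]. *)
Record is_splitting (K : pzRingType) (V : lmodType K) (pr : bool -> V -> V) : Prop := IsSplitting {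
  splitting_linear : forall t, linear (pr t);
  splitting_idem : forall t z, pr t (pr t z) = pr t z;
  splitting_neq : forall t s z, t != s -> pr t (pr s z) = 0;
  splitting_sum : forall z, pr true z + pr false z = z
}.

Section Splitting.
Variables (R : realType) (m : nat).
Local Notation C := R[i].
Local Notation V := 'rV[C]_m.
Implicit Types (u v z : V).

Variable pr : bool -> V -> V.
Hypothesis pr_splitting : is_splitting pr.

Let pr_linear := splitting_linear pr_splitting.
Let pr_idem := splitting_idem pr_splitting.
Let pr_neq := splitting_neq pr_splitting.
Let pr_sum := splitting_sum pr_splitting.
Let pr0 t : pr t 0 = 0. Proof. exact: linear_for0 (pr_linear t). Qed.

Definition pure k (tp : 'I_k -> bool) (X : 'I_k -> V) :=
  forall j, pr (tp j) (X j) = X j.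

Definition typed_part k p (f : inv_form R m k) : inv_form R m k := fun X =>
  \sum_(S : {set 'I_k} | #|S| == p) f (fun j => pr (j \in S) (X j)).

Lemma multilinear_typed_part k p (f : inv_form R m k) :
  multilinear f -> multilinear (typed_part p f).
Proof.
move=> fm X j a u v; rewrite /typed_part mulr_sumr -big_split; apply: eq_bigr => S _ /=.
have push_proj w : (fun l => pr (l \in S) (upd X j w l)) =
    upd (fun l => pr (l \in S) (X l)) j (pr (j \in S) w).
  by apply/funext => l; have [->|lj] := eqVneq l j; rewrite ?upd_eq // !upd_neq.
by rewrite !push_proj pr_linear fm.
Qed.

Lemma typed_part_pure k p (f : inv_form R m k) tp X : multilinear f -> pure tp X ->
  typed_part p f X = if (\sum_j tp j == p)%N then f X else 0.
Proof.
move=> fm X_pure; rewrite /typed_part; pose S0 := [set j | tp j]%SET.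
have <- : #|S0| = (\sum_j tp j)%N.
  by rewrite -sum1_card big_mkcond; apply: eq_bigr => j _; rewrite inE; case: (tp j).
have other S : S != S0 -> f (fun j => pr (j \in S) (X j)) = 0.
  move=> /eqP SS0; have [j tpj] : exists j, (j \in S) != tp j.
    apply/existsP; rewrite -negb_forall; apply/forallP => same; apply: SS0.
    by apply/setP => j; rewrite inE; apply/eqP; exact: same.
  by apply: (multilinear_eq0 fm (j := j)); rewrite -(X_pure j) pr_neq.
case: eqP => [cS0|cS0].
  rewrite (bigD1 S0) ?cS0 //= big1 ?addr0 => [|S /andP[_ ?]]; last exact: other.
  by congr f; apply/funext => j; rewrite inE X_pure.
rewrite big1 // => S /eqP cS; apply: other; apply: contra_notN cS0 => /eqP <-.
by rewrite cS.
Qed.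

Lemma multilinear_pure_eq k (f g : inv_form R m k) : multilinear f -> multilinear g ->
  (forall tp X, pure tp X -> f X = g X) -> forall X, f X = g X.
Proof.
move=> fm gm fg X; apply/eqP; rewrite -subr_eq0; apply/eqP.
pose h : inv_form R m k := fun Y => f Y - g Y.
have hm : multilinear h by move=> Y j a u v; rewrite /h fm gm; ring.
apply: (multilinear_span_eq0 hm (g := fun j t => pr t (X j))) => [c|j].
  apply/eqP; rewrite subr_eq0; apply/eqP/(fg c) => j.
  exact: pr_idem.
by exists (fun=> 1); rewrite big_bool /= !scale1r pr_sum.
Qed.

Definition of_bidegree p k (f : inv_form R m k) :=
  forall tp X, pure tp X -> (\sum_j tp j != p)%N -> f X = 0.

Lemma of_bidegree_part p k (f : inv_form R m k) :
  multilinear f -> of_bidegree p (typed_part p f).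
Proof. by move=> fm tp X X_pure /negbTE count; rewrite (typed_part_pure _ fm X_pure) count. Qed.

Lemma typed_part_id p q k (f : inv_form R m k) X : multilinear f -> of_bidegree q f ->
  typed_part p f X = if p == q then f X else 0.
Proof.
move=> fm fq; move: X; apply: multilinear_pure_eq => [||tp X X_pure].
- exact: multilinear_typed_part.
- by case: eqP => // _ X j a u v; rewrite mulr0 addr0.
rewrite (typed_part_pure _ fm X_pure); have [<-|count] := eqVneq (\sum_j tp j)%N p.
  by have [//|/(fq _ _ X_pure)] := eqVneq (\sum_j tp j)%N q.
by have [pq|//] := eqVneq p q; rewrite (fq _ _ X_pure) // -pq.
Qed.

Lemma sum_typed_part k (f : inv_form R m k) X : multilinear f ->
  \sum_(p < k.+1) typed_part p f X = f X.
Proof.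
move=> fm; move: X; apply: multilinear_pure_eq => // [|tp X X_pure].
  by apply: multilinear_sum_form => p _; exact: multilinear_typed_part.
have count_lt : (\sum_j tp j < k.+1)%N.
  by rewrite ltnS -[k in leqRHS]card_ord -sum1_card leq_sum // => j _; case: (tp j).
rewrite (bigD1 (Ordinal count_lt)) //= (typed_part_pure _ fm X_pure) eqxx.
rewrite big1 ?addr0 // => p /eqP p_neq; rewrite (typed_part_pure _ fm X_pure).
by case: eqP => // count; case: p_neq; apply: val_inj; rewrite /= count.
Qed.

Lemma typed_partD p k (f g : inv_form R m k) X :
  typed_part p (fun Y => f Y + g Y) X = typed_part p f X + typed_part p g X.
Proof. exact: big_split. Qed.

Variable B : V -> V -> V.
Hypotheses (B_bilinear : bilinear_map B) (B_alt : forall u, B u u = 0).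

(* The parts of [B] whose Chevalley-Eilenberg differentials are [del] (for
   [t = true]) and [delbar] (for [t = false]). *)
Definition type_bracket (t : bool) u v : V :=
  pr t (B (pr t u) (pr t v)) +
  pr (~~ t) (B (pr t u) (pr (~~ t) v) +
                    B (pr (~~ t) u) (pr t v)).

Lemma bilinear_type_bracket t : bilinear_map (type_bracket t).
Proof.
by split=> w a u v; rewrite /type_bracket !pr_linear !(B_bilinear.1, B_bilinear.2);
  rewrite addrACA -scalerDr !pr_linear addrACA -scalerDr.
Qed.

Lemma type_bracket_alt t u : type_bracket t u u = 0.
Proof.
rewrite /type_bracket B_alt (alternating_bilinear_skew B_bilinear B_alt) addNr.
by rewrite !pr0 addr0.
Qed.

Lemma type_bracket_pure t s s' u v : pr s u = u -> pr s' v = v ->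
  type_bracket t u v =
  if (s != t) && (s' != t) then 0 else pr (if s == s' then t else ~~ t) (B u v).
Proof.
have neqTF w : pr true (pr false w) = 0 by exact: pr_neq.
have neqFT w : pr false (pr true w) = 0 by exact: pr_neq.
move=> <- <-; rewrite /type_bracket; case: t; case: s; case: s';
  rewrite ?pr_idem ?neqTF ?neqFT ?(bilinear0l B_bilinear) ?(bilinear0r B_bilinear);
  by rewrite ?addr0 ?add0r ?pr0 ?addr0 ?add0r.
Qed.

Let count_lift k (tp : 'I_k.+1 -> bool) j i :
  (\sum_x tp x = tp j + tp (lift j i) + \sum_(l | l != i) tp (lift j l))%N.
Proof. by rewrite (bigD1_ord j) //= (bigD1 i) //= addnA. Qed.

Lemma of_bidegree_ce_diff (t : bool) p k (f : inv_form R m k) : multilinear f ->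
  of_bidegree p f -> of_bidegree (p + t)%N (ce_diff (type_bracket t) f).
Proof.
move=> fm fp tp X X_pure count; apply: big1 => j _; apply: big1 => i ij.
have [i' def_i] := ltn_lift_ex ij; rewrite {1}def_i upd_lift_same.
rewrite (type_bracket_pure t (X_pure i) (X_pure j)).
case: ifPn => [_|not_opposite]; first by rewrite multilinear_upd0 // mulr0.
set s := if _ then _ else _.
rewrite (fp (fun l => if l == i' then s else tp (lift j l))) ?mulr0 // => [l|].
  by have [->|li'] := eqVneq l i'; rewrite ?upd_eq ?pr_idem // upd_neq.
rewrite (bigD1 i') //= eqxx (eq_bigr (fun l => nat_of_bool (tp (lift j l)))); last first.
  by move=> l /negbTE ->.
apply: contraNneq count => <-; rewrite (count_lift tp j i') -def_i [eqbRHS]addnAC eqn_add2r.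
by rewrite {}/s; move: not_opposite; case: (t); case: (tp i); case: (tp j).
Qed.

Hypotheses (B10_proj01 : forall u v, pr false (B (pr true u) (pr true v)) = 0)
  (B01_proj10 : forall u v, pr true (B (pr false u) (pr false v)) = 0).

Lemma bracket_split u v : B u v = type_bracket true u v + type_bracket false u v.
Proof.
set M := B (pr true u) (pr false v) + B (pr false u) (pr true v).
rewrite /type_bracket /= [B (pr false u) (pr true v) + _]addrC -/M.
have -> : pr true (B (pr true u) (pr true v)) = B (pr true u) (pr true v).
  by rewrite -[RHS]pr_sum B10_proj01 addr0.
have -> : pr false (B (pr false u) (pr false v)) = B (pr false u) (pr false v).
  by rewrite -[RHS]pr_sum B01_proj10 add0r.
rewrite addrACA [pr false M + _]addrC pr_sum /M -{1}(pr_sum u) -{1}(pr_sum v).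
rewrite (bilinearDl B_bilinear) !(bilinearDr B_bilinear) -!addrA; congr (_ + _).
by rewrite [RHS]addrC -addrA.
Qed.

Lemma sum_typed_part_ce_diff (t : bool) k (f : inv_form R m k) X : multilinear f ->
  \sum_(p < k.+1) typed_part (p + t)%N (ce_diff B (typed_part p f)) X =
  ce_diff (type_bracket t) f X.
Proof.
move=> fm; have part_m p := multilinear_typed_part p fm.
have diff_m s p := multilinear_ce_diff (bilinear_type_bracket s) (part_m p).
have diff_bidegree s p := of_bidegree_ce_diff (t := s) (part_m p) (of_bidegree_part (p := p) fm).
have split_diff p : ce_diff B (typed_part p f) = fun Y =>
    ce_diff (type_bracket true) (typed_part p f) Y +
    ce_diff (type_bracket false) (typed_part p f) Y.
  rewrite (_ : B = fun u v => type_bracket true u v + type_bracket false u v).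
    by apply/funext => Y; exact: ce_diffD.
  by apply/funext => u; apply/funext => v; exact: bracket_split.
rewrite -(ce_diff_eq _ X (fun Y => sum_typed_part Y fm)) ce_diff_sum.
apply: eq_bigr => p _; rewrite split_diff typed_partD.
rewrite !(typed_part_id _ _ (diff_m _ p) (diff_bidegree _ p)) !eqn_add2l.
by case: t; rewrite /= ?addr0 ?add0r.
Qed.

End Splitting.

Lemma half_add (K : numFieldType) (U : lmodType K) (u : U) : 2^-1 *: (u + u) = u.
Proof. by rewrite -mulr2n -[u *+ 2]scaler_nat scalerA mulVf ?scale1r // pnatr_eq0. Qed.

Section ComplexStructure.
Local Open Scope complex_scope.
Variables (R : realType) (m : nat) (J : 'M[R]_m).
Hypothesis J_sqr : J *m J = - 1%:M.
Local Notation C := R[i].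
Local Notation V := 'rV[C]_m.
Implicit Types (u v z : V).

Lemma mulii : ('i : C) * 'i = -1. Proof. by rewrite -expr2 sqr_i. Qed.

Definition proj10_mx : 'M[C]_m := 2^-1 *: (1%:M - 'i *: cplx_mx J).

Lemma cplx_mx_sqr : cplx_mx J *m cplx_mx J = - 1%:M.
Proof. by rewrite -map_mxM J_sqr map_mxN map_mx1. Qed.

Lemma proj10E z : proj10 J z = z *m proj10_mx.
Proof. by rewrite -scalemxAr mulmxBr mulmx1 -scalemxAr. Qed.

Lemma proj01E z : proj01 J z = z - proj10 J z.
Proof.
apply: (canRL (addrK _)); rewrite -scalerDr addrACA addrN addr0.
by rewrite half_add.
Qed.

Lemma proj10_add01 z : proj10 J z + proj01 J z = z.
Proof. by rewrite proj01E addrC subrK. Qed.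

Lemma proj10_cplx_mx z : proj10 J z *m cplx_mx J = 'i *: proj10 J z.
Proof.
rewrite /proj10 -scalemxAl mulmxBl -scalemxAl -mulmxA cplx_mx_sqr mulmxN mulmx1.
rewrite scalerA mulrC -scalerA; congr (_ *: _).
by rewrite scalerBr scalerA mulii scaleN1r scalerN !opprK addrC.
Qed.

Lemma proj10_id z : z *m cplx_mx J = 'i *: z -> proj10 J z = z.
Proof.
move=> zJ; rewrite /proj10 zJ scalerA mulii scaleN1r opprK.
by rewrite half_add.
Qed.

Lemma linear_proj10 : linear (proj10 J).
Proof. by move=> a u v; rewrite !proj10E mulmxDl -scalemxAl. Qed.

Lemma linear_proj01 : linear (proj01 J).
Proof. by move=> a u v; rewrite !proj01E linear_proj10 opprD addrACA scalerBr. Qed.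

Definition type_proj (t : bool) := if t then proj10 J else proj01 J.

Lemma linear_type_proj t : linear (type_proj t).
Proof. by case: t; [exact: linear_proj10|exact: linear_proj01]. Qed.

Lemma type_proj_idem t z : type_proj t (type_proj t z) = type_proj t z.
Proof.
have proj10_idem w : proj10 J (proj10 J w) = proj10 J w by exact/proj10_id/proj10_cplx_mx.
case: t => /=; first exact: proj10_idem.
by rewrite !proj01E (linear_forB linear_proj10) proj10_idem subrr subr0.
Qed.

Lemma type_proj_neq t s z : t != s -> type_proj t (type_proj s z) = 0.
Proof.
move=> ts; have -> : t = ~~ s by case: t ts; case: s.
have idem := type_proj_idem true z; rewrite /= in idem.
by case: s {ts} => /=; rewrite !proj01E ?(linear_forB linear_proj10) idem subrr.
Qed.

Lemma type_proj_splitting : is_splitting type_proj.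
Proof.
split; [exact: linear_type_proj|exact: type_proj_idem|exact: type_proj_neq|].
exact: proj10_add01.
Qed.

Lemma bidegree_partE k p (f : inv_form R m k) X :
  bidegree_part J p f X = typed_part type_proj p f X.
Proof.
apply: eq_bigr => S _; congr f; apply/funext => j.
by case: (j \in S).
Qed.

End ComplexStructure.

(** * The square of a 2-form *)

Section Leibniz.
Variables (R : realType) (m : nat).
Local Notation C := R[i].
Local Notation V := 'rV[C]_m.

Definition vecs k (s : seq V) : 'I_k -> V := fun i => nth 0 s i.

Lemma vecs_mkseq k (X : 'I_k.+1 -> V) : X = vecs (mkseq (fun i => X (inord i)) k.+1).
Proof. by apply/funext => i; rewrite /vecs nth_mkseq ?inord_val. Qed.

Definition bracket_at (B : V -> V -> V) (s : seq V) i j :=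
  let s' := set_nth 0 s i (B s`_i s`_j) in take j s' ++ drop j.+1 s'.

Lemma ce_diff_vecs B k (f : inv_form R m k) s : size s = k.+1 ->
  ce_diff B f (vecs s) =
  \sum_(j < k.+1) \sum_(i < k.+1)
    if (i < j)%N then (-1) ^+ j * f (vecs (bracket_at B s i j)) else 0.
Proof.
move=> size_s; under [RHS]eq_bigr => j _ do rewrite -big_mkcond.
apply: eq_bigr => j _; apply: eq_bigr => i ij; congr (_ * f _).
apply/funext => l; rewrite /vecs /bracket_at /upd /= nth_cat size_take size_set_nth size_s.
rewrite (maxn_idPr (ltn_ord i)) ltn_ord -val_eqE /= /bump.
case: ltnP => lj.
  by rewrite nth_take // nth_set_nth.
by rewrite nth_drop (_ : j.+1 + (l - j) = l.+1)%N ?nth_set_nth //; lia.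
Qed.

Section SmallDegree.
Variable B : V -> V -> V.

Let bump0n n : bump 0 n = n.+1. Proof. by []. Qed.

Lemma ce_diff1 (f : inv_form R m 1) X : ce_diff B f X = - f (fun=> B (X 0) (X 1)).
Proof.
rewrite [X in ce_diff B f X]vecs_mkseq ce_diff_vecs // !(big_ord_recl, big_ord0) /=.
rewrite /bracket_at /= !(addr0, add0r) expr1 mulN1r; congr (- f _); apply/funext => i.
by rewrite ord1 /vecs /=; congr (B (X _) (X _)); apply: val_inj; rewrite /= inordK.
Qed.

Lemma ce_diff2 (f : inv_form R m 2) v0 v1 v2 :
  ce_diff B f (vecs [:: v0; v1; v2]) =
  - f (vecs [:: B v0 v1; v2]) + f (vecs [:: B v0 v2; v1]) + f (vecs [:: v0; B v1 v2]).
Proof. by rewrite ce_diff_vecs // !(big_ord_recl, big_ord0) /bracket_at /= !bump0n; ring. Qed.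

Lemma ce_diff3 (f : inv_form R m 3) v0 v1 v2 v3 :
  ce_diff B f (vecs [:: v0; v1; v2; v3]) =
  - f (vecs [:: B v0 v1; v2; v3]) + f (vecs [:: B v0 v2; v1; v3])
  + f (vecs [:: v0; B v1 v2; v3]) - f (vecs [:: B v0 v3; v1; v2])
  - f (vecs [:: v0; B v1 v3; v2]) - f (vecs [:: v0; v1; B v2 v3]).
Proof. by rewrite ce_diff_vecs // !(big_ord_recl, big_ord0) /bracket_at /= !bump0n; ring. Qed.

Lemma ce_diff4 (f : inv_form R m 4) v0 v1 v2 v3 v4 :
  ce_diff B f (vecs [:: v0; v1; v2; v3; v4]) =
  - f (vecs [:: B v0 v1; v2; v3; v4]) + f (vecs [:: B v0 v2; v1; v3; v4])
  + f (vecs [:: v0; B v1 v2; v3; v4]) - f (vecs [:: B v0 v3; v1; v2; v4])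
  - f (vecs [:: v0; B v1 v3; v2; v4]) - f (vecs [:: v0; v1; B v2 v3; v4])
  + f (vecs [:: B v0 v4; v1; v2; v3]) + f (vecs [:: v0; B v1 v4; v2; v3])
  + f (vecs [:: v0; v1; B v2 v4; v3]) + f (vecs [:: v0; v1; v2; B v3 v4]).
Proof. by rewrite ce_diff_vecs // !(big_ord_recl, big_ord0) /bracket_at /= !bump0n; ring. Qed.

Lemma ce_diff5 (f : inv_form R m 5) v0 v1 v2 v3 v4 v5 :
  ce_diff B f (vecs [:: v0; v1; v2; v3; v4; v5]) =
  - f (vecs [:: B v0 v1; v2; v3; v4; v5]) + f (vecs [:: B v0 v2; v1; v3; v4; v5])
  + f (vecs [:: v0; B v1 v2; v3; v4; v5]) - f (vecs [:: B v0 v3; v1; v2; v4; v5])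
  - f (vecs [:: v0; B v1 v3; v2; v4; v5]) - f (vecs [:: v0; v1; B v2 v3; v4; v5])
  + f (vecs [:: B v0 v4; v1; v2; v3; v5]) + f (vecs [:: v0; B v1 v4; v2; v3; v5])
  + f (vecs [:: v0; v1; B v2 v4; v3; v5]) + f (vecs [:: v0; v1; v2; B v3 v4; v5])
  - f (vecs [:: B v0 v5; v1; v2; v3; v4]) - f (vecs [:: v0; B v1 v5; v2; v3; v4])
  - f (vecs [:: v0; v1; B v2 v5; v3; v4]) - f (vecs [:: v0; v1; v2; B v3 v5; v4])
  - f (vecs [:: v0; v1; v2; v3; B v4 v5]).
Proof. by rewrite ce_diff_vecs // !(big_ord_recl, big_ord0) /bracket_at /= !bump0n; ring. Qed.

End SmallDegree.

Variable F : V -> V -> C.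

Definition form2 : inv_form R m 2 := fun X => F (X 0) (X 1).

(* [F ^ F] for a skew-symmetric [F] *)
Definition form2_sq : inv_form R m 4 := fun X =>
  let F' i j := F (X (inord i)) (X (inord j)) in
  2 * (F' 0%N 1%N * F' 2%N 3%N - F' 0%N 2%N * F' 1%N 3%N + F' 0%N 3%N * F' 1%N 2%N).

(* [f ^ F] for a 3-form [f] and a skew-symmetric [F], as a sum over shuffles *)
Definition wedge_form2 (f : inv_form R m 3) : inv_form R m 5 := fun X =>
  let f' i j k := f (vecs [:: X (inord i); X (inord j); X (inord k)]) in
  let F' i j := F (X (inord i)) (X (inord j)) in
    f' 0 1 2 * F' 3 4 - f' 0 1 3 * F' 2 4 + f' 0 1 4 * F' 2 3 + f' 0 2 3 * F' 1 4
  - f' 0 2 4 * F' 1 3 + f' 0 3 4 * F' 1 2 - f' 1 2 3 * F' 0 4 + f' 1 2 4 * F' 0 3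
  - f' 1 3 4 * F' 0 2 + f' 2 3 4 * F' 0 1.

Lemma form2E u v : form2 (vecs [:: u; v]) = F u v.
Proof. by []. Qed.

Lemma form2_sqE u v w x : form2_sq (vecs [:: u; v; w; x]) =
  2 * (F u v * F w x - F u w * F v x + F u x * F v w).
Proof. by rewrite /form2_sq /vecs !inordK. Qed.

Lemma wedge_form2E f v0 v1 v2 v3 v4 : wedge_form2 f (vecs [:: v0; v1; v2; v3; v4]) =
    f (vecs [:: v0; v1; v2]) * F v3 v4 - f (vecs [:: v0; v1; v3]) * F v2 v4
  + f (vecs [:: v0; v1; v4]) * F v2 v3 + f (vecs [:: v0; v2; v3]) * F v1 v4
  - f (vecs [:: v0; v2; v4]) * F v1 v3 + f (vecs [:: v0; v3; v4]) * F v1 v2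
  - f (vecs [:: v1; v2; v3]) * F v0 v4 + f (vecs [:: v1; v2; v4]) * F v0 v3
  - f (vecs [:: v1; v3; v4]) * F v0 v2 + f (vecs [:: v2; v3; v4]) * F v0 v1.
Proof. by rewrite /wedge_form2 /vecs !inordK. Qed.

Lemma ce_diff_form2_sq B X :
  ce_diff B form2_sq X = 2 * wedge_form2 (ce_diff B form2) X.
Proof.
rewrite [X in LHS]vecs_mkseq [X in RHS]vecs_mkseq /mkseq /=.
by rewrite ce_diff4 wedge_form2E !ce_diff2 !form2_sqE !form2E; ring.
Qed.

Lemma ce_diff_wedge_form2 B (f : inv_form R m 3) v0 v1 v2 v3 v4 v5 :
  let Bf a b c d := ce_diff B f (vecs [:: a; b; c; d]) in
  let f' a b c := f (vecs [:: a; b; c]) in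
  let BF a b c := ce_diff B form2 (vecs [:: a; b; c]) in
  ce_diff B (wedge_form2 f) (vecs [:: v0; v1; v2; v3; v4; v5]) =
    Bf v0 v1 v2 v3 * F v4 v5 - Bf v0 v1 v2 v4 * F v3 v5 + Bf v0 v1 v2 v5 * F v3 v4
  + Bf v0 v1 v3 v4 * F v2 v5 - Bf v0 v1 v3 v5 * F v2 v4 + Bf v0 v1 v4 v5 * F v2 v3
  - Bf v0 v2 v3 v4 * F v1 v5 + Bf v0 v2 v3 v5 * F v1 v4 - Bf v0 v2 v4 v5 * F v1 v3
  + Bf v0 v3 v4 v5 * F v1 v2 + Bf v1 v2 v3 v4 * F v0 v5 - Bf v1 v2 v3 v5 * F v0 v4
  + Bf v1 v2 v4 v5 * F v0 v3 - Bf v1 v3 v4 v5 * F v0 v2 + Bf v2 v3 v4 v5 * F v0 v1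
  - f' v0 v1 v2 * BF v3 v4 v5 + f' v0 v1 v3 * BF v2 v4 v5 - f' v0 v1 v4 * BF v2 v3 v5
  + f' v0 v1 v5 * BF v2 v3 v4 - f' v0 v2 v3 * BF v1 v4 v5 + f' v0 v2 v4 * BF v1 v3 v5
  - f' v0 v2 v5 * BF v1 v3 v4 - f' v0 v3 v4 * BF v1 v2 v5 + f' v0 v3 v5 * BF v1 v2 v4
  - f' v0 v4 v5 * BF v1 v2 v3 + f' v1 v2 v3 * BF v0 v4 v5 - f' v1 v2 v4 * BF v0 v3 v5
  + f' v1 v2 v5 * BF v0 v3 v4 + f' v1 v3 v4 * BF v0 v2 v5 - f' v1 v3 v5 * BF v0 v2 v4
  + f' v1 v4 v5 * BF v0 v2 v3 - f' v2 v3 v4 * BF v0 v1 v5 + f' v2 v3 v5 * BF v0 v1 v4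
  - f' v2 v4 v5 * BF v0 v1 v3 + f' v3 v4 v5 * BF v0 v1 v2.
Proof.
move=> Bf f' BF.
by rewrite /Bf /BF /f' ce_diff5 !ce_diff3 !ce_diff2 !wedge_form2E !form2E; ring.
Qed.

Lemma ce_diff_scale B k c (f : inv_form R m k) X :
  ce_diff B (fun Y => c * f Y) X = c * ce_diff B f X.
Proof.
rewrite mulr_sumr; apply: eq_bigr => j _; rewrite mulr_sumr; apply: eq_bigr => i _.
by rewrite mulrCA.
Qed.

Lemma ce_diff_sq_form2 B1 B2 X : ce_diff B1 (ce_diff B2 form2_sq) X =
  2 * ce_diff B1 (wedge_form2 (ce_diff B2 form2)) X.
Proof. by rewrite -ce_diff_scale; apply: ce_diff_eq => Y; exact: ce_diff_form2_sq. Qed.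

Hypotheses (F_scalar : forall v, scalar (F^~ v)) (F_skew : forall u v, F u v = - F v u).

Lemma form2_scalarr u : scalar (F u).
Proof. by move=> a v w; rewrite F_skew F_scalar (F_skew v) (F_skew w); ring. Qed.

Lemma multilinear_form2_sq : multilinear form2_sq.
Proof.
move=> X j a u v; rewrite /form2_sq.
have updE w i : (i < 4)%N -> upd X j w (inord i) = if i == j then w else X (inord i).
  by move=> i4; rewrite /upd /= -val_eqE /= inordK.
rewrite !updE //; case: j {updE} => [[|[|[|[|//]]]] j4] /=;
  by rewrite ?F_scalar ?form2_scalarr; ring.
Qed.

Lemma vanishes_on_repeats_form2_sq : vanishes_on_repeats form2_sq.
Proof.
apply: vanishes_on_adjacent_repeats; first exact: multilinear_form2_sq.
move=> X j l jl; rewrite -[j]inord_val -[l]inord_val jl /form2_sq.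
have := ltn_ord l; rewrite jl.
by case: (j : nat) => [|[|[|//]]] _ ->; rewrite (skew_diag_eq0 F_skew); ring.
Qed.

Lemma of_bidegree_form2_sq (pr : bool -> V -> V) :
  (forall t u v, F (pr t u) (pr t v) = 0) -> of_bidegree pr 2 form2_sq.
Proof.
move=> F_type tp X X_pure; pose t i := tp (inord i); pose x i := X (inord i).
have F0 i j : t i = t j -> F (x i) (x j) = 0.
  by rewrite /t /x => tij; rewrite -(X_pure (inord i)) -(X_pure (inord j)) tij F_type.
have -> : (\sum_j tp j = t 0 + t 1 + t 2 + t 3)%N.
  rewrite !big_ord_recl big_ord0 /= addn0 !addnA /t.
  by congr (nat_of_bool (tp _) + nat_of_bool (tp _) + nat_of_bool (tp _) + nat_of_bool (tp _))%N;
    apply: val_inj; rewrite /= inordK.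
rewrite /form2_sq -/(x 0) -/(x 1%N) -/(x 2) -/(x 3).
move: (F0 0 1%N) (F0 0 2) (F0 0 3) (F0 1%N 2) (F0 1%N 3) (F0 2 3).
case: (t 0); case: (t 1%N); case: (t 2); case: (t 3) => //= h01 h02 h03 h12 h13 h23 _;
  by rewrite ?(h01 erefl) ?(h02 erefl) ?(h03 erefl) ?(h12 erefl) ?(h13 erefl) ?(h23 erefl); ring.
Qed.

End Leibniz.

(** * Wedge products of small degree *)

Section PermutationSums.

Lemma sum_perm_lift (W : nmodType) n (phi : 'S_n.+1 -> W) :
  \sum_s phi s = \sum_i \sum_(t : 'S_n) phi (lift_perm ord0 i t).
Proof.
rewrite pair_big /= (reindex (fun p : 'I_n.+1 * 'S_n => lift_perm ord0 p.1 p.2)) //=.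
apply: onW_bij; apply: inj_card_bij => [[i s] [j t] /= st|].
  have ij : i = j by rewrite -(lift_perm_id ord0 i s) st lift_perm_id.
  rewrite -ij in st *; congr pair; apply/permP=> k; apply: (@lift_inj _ i).
  by rewrite -!(lift_perm_lift ord0) st.
by rewrite card_prod card_ord !card_Sn factS.
Qed.

Lemma sum_perm0 (W : nmodType) (phi : 'S_0 -> W) : \sum_s phi s = phi 1%g.
Proof. by rewrite (bigD1 1%g) //= big1 ?addr0 // => s /eqP []; apply/permP=> -[]. Qed.

Variable K : comNzRingType.

Lemma signr_lift_perm n i (t : 'S_n) :
  (-1) ^+ (lift_perm ord0 i t) = (-1) ^+ i * (-1) ^+ t :> K.
Proof. by rewrite odd_lift_perm /= signr_addb signr_odd. Qed.

Lemma alternating_sum2 (phi : 'I_2 -> 'I_2 -> K) :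
  \sum_(s : 'S_2) (-1) ^+ s * phi (s 0) (s 1) = phi 0 1 - phi 1 0.
Proof.
have -> : (0 : 'I_2) = ord0 by apply: val_inj.
have -> : (1 : 'I_2) = lift ord0 ord0 by apply: val_inj.
rewrite sum_perm_lift; under eq_bigr => i _.
  rewrite sum_perm_lift; under eq_bigr => j _.
    rewrite sum_perm0 !signr_lift_perm odd_perm1 mulr1 lift_perm_lift !lift_perm_id.
    over.
  over.
rewrite !big_ord_recl !big_ord0 /= !addr0 expr0 !mul1r expr1 !mulN1r.
by congr (phi _ _ - phi _ _); apply: val_inj.
Qed.

Lemma alternating_sum4 (phi : 'I_4 -> 'I_4 -> 'I_4 -> 'I_4 -> K) :
  \sum_(s : 'S_4) (-1) ^+ s *
    phi (s ord0) (s (lift ord0 ord0)) (s (lift ord0 (lift ord0 ord0)))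
      (s (lift ord0 (lift ord0 (lift ord0 ord0)))) =
  \sum_(i < 4) \sum_(j < 3) \sum_(k < 2) (-1) ^+ (i + j + k) *
    phi i (lift i j) (lift i (lift j k)) (lift i (lift j (lift k ord0))).
Proof.
rewrite sum_perm_lift; apply: eq_bigr => i _.
rewrite sum_perm_lift; apply: eq_bigr => j _.
rewrite sum_perm_lift; apply: eq_bigr => k _.
rewrite sum_perm_lift big_ord1 sum_perm0 !signr_lift_perm odd_perm1.
by rewrite !lift_perm_lift !lift_perm_id !expr0 !mulr1 mulrA -!exprD.
Qed.

End PermutationSums.

Section SmallWedges.
Variables (R : realType) (m : nat).
Local Notation C := R[i].
Local Notation V := 'rV[C]_m.

Lemma wedge11 (f g : inv_form R m 1) X :
  wedge f g X = f (fun=> X 0) * g (fun=> X 1) - f (fun=> X 1) * g (fun=> X 0).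
Proof.
rewrite /wedge invr1 mul1r -(alternating_sum2 (fun i j => f (fun=> X i) * g (fun=> X j))).
apply: eq_bigr => s _; congr (_ * (f _ * g _)); apply/funext => j;
  by rewrite ord1; congr (X (s _)); apply: val_inj.
Qed.

Variable F : V -> V -> C.
Hypothesis F_skew : forall u v, F u v = - F v u.

Lemma wedge_form2_1 X : wedge (form2 F) (fun _ : 'I_0 -> V => 1) X = form2 F X.
Proof.
rewrite /wedge /form2; under eq_bigr => s _ do rewrite mulr1.
have -> : lshift 0 (0 : 'I_2) = 0 by apply: val_inj.
have -> : lshift 0 (1 : 'I_2) = 1 by apply: val_inj.
rewrite (alternating_sum2 (fun i j => F (X i) (X j))) (F_skew (X 1)) opprK.
by rewrite (_ : (2`! * 0`!)%:R = 2) //; field.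
Qed.

Lemma wedge_form2_form2 X : wedge (form2 F) (form2 F) X = form2_sq F X.
Proof.
rewrite /wedge /form2.
pose F' (i j : nat) := F (X (inord i)) (X (inord j)).
have F'E (i j : 'I_4) : F (X i) (X j) = F' i j by rewrite /F' !inord_val.
have -> : lshift 2 (0 : 'I_2) = ord0 by apply: val_inj.
have -> : lshift 2 (1 : 'I_2) = lift ord0 ord0 by apply: val_inj.
have -> : rshift 2 (0 : 'I_2) = lift ord0 (lift ord0 ord0) by apply: val_inj.
have -> : rshift 2 (1 : 'I_2) = lift ord0 (lift ord0 (lift ord0 ord0)) by apply: val_inj.
rewrite (alternating_sum4 (fun i j k l => F (X i) (X j) * F (X k) (X l))).
under eq_bigr => i _ do under eq_bigr => j _ do under eq_bigr => k _ do rewrite !F'E.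
rewrite /form2_sq -!/(F' _ _).
have F'_skew i j : F' i j = - F' j i by apply: F_skew.
rewrite !big_ord_recl !big_ord0 /= /bump /=.
rewrite (_ : (2`! * 2`!)%:R = 4) // !(add0n, addn0, add1n, addSn).
rewrite (F'_skew 1 0)%N (F'_skew 2 0)%N (F'_skew 3 0)%N.
rewrite (F'_skew 2 1)%N (F'_skew 3 1)%N (F'_skew 3 2)%N.
by field.
Qed.

Lemma form_pow2 : form_pow (form2 F) 2 = form2_sq F.
Proof.
have pow1 : form_pow (form2 F) 1 = form2 F by apply/funext => X; exact: wedge_form2_1.
change (wedge (form2 F) (form_pow (form2 F) 1) = form2_sq F).
by rewrite pow1; apply/funext => X; exact: wedge_form2_form2.
Qed.

End SmallWedges.

(** * Integration by parts in a unitary frame *)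

Definition ord4_0 : 'I_4 := @Ordinal 4 0 isT.
Definition ord4_1 : 'I_4 := @Ordinal 4 1 isT.
Definition ord4_2 : 'I_4 := @Ordinal 4 2 isT.
Definition ord4_3 : 'I_4 := @Ordinal 4 3 isT.
Definition ord3_0 : 'I_3 := @Ordinal 3 0 isT.
Definition ord3_1 : 'I_3 := @Ordinal 3 1 isT.
Definition ord3_2 : 'I_3 := @Ordinal 3 2 isT.

Lemma ord4P (P : 'I_4 -> Prop) :
  P ord4_0 -> P ord4_1 -> P ord4_2 -> P ord4_3 -> forall i, P i.
Proof.
move=> P0 P1 P2 P3 [[|[|[|[|//]]]] i_lt].
- by rewrite (_ : Ordinal i_lt = ord4_0) //; exact: val_inj.
- by rewrite (_ : Ordinal i_lt = ord4_1) //; exact: val_inj.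
- by rewrite (_ : Ordinal i_lt = ord4_2) //; exact: val_inj.
- by rewrite (_ : Ordinal i_lt = ord4_3) //; exact: val_inj.
Qed.

Lemma sum_ord4 (W : nmodType) (x : 'I_4 -> W) :
  \sum_i x i = x ord4_0 + x ord4_1 + x ord4_2 + x ord4_3.
Proof.
rewrite !big_ord_recl big_ord0 addr0 !addrA.
by congr (x _ + x _ + x _ + x _); apply: val_inj.
Qed.

Lemma lift_ord4E :
  ((lift ord4_0 ord3_0 = ord4_1) * (lift ord4_0 ord3_1 = ord4_2) *
   (lift ord4_0 ord3_2 = ord4_3) * (lift ord4_1 ord3_0 = ord4_0) *
   (lift ord4_1 ord3_1 = ord4_2) * (lift ord4_1 ord3_2 = ord4_3) *
   (lift ord4_2 ord3_0 = ord4_0) * (lift ord4_2 ord3_1 = ord4_1) *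
   (lift ord4_2 ord3_2 = ord4_3) * (lift ord4_3 ord3_0 = ord4_0) *
   (lift ord4_3 ord3_1 = ord4_1) * (lift ord4_3 ord3_2 = ord4_2))%type.
Proof. by do !split; apply: val_inj. Qed.

Section StructureConstants.
Variable K : comNzRingType.
Implicit Types c : 'I_4 -> 'I_4 -> 'I_4 -> K.

Lemma skew_ord4E c : (forall k i j, c k i j = - c k j i) -> forall k,
  ((c k ord4_1 ord4_0 = - c k ord4_0 ord4_1) *
   (c k ord4_2 ord4_0 = - c k ord4_0 ord4_2) *
   (c k ord4_3 ord4_0 = - c k ord4_0 ord4_3) *
   (c k ord4_2 ord4_1 = - c k ord4_1 ord4_2) *
   (c k ord4_3 ord4_1 = - c k ord4_1 ord4_3) *
   (c k ord4_3 ord4_2 = - c k ord4_2 ord4_3))%type.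
Proof. by move=> c_skew k; rewrite -!c_skew. Qed.

Lemma skew_trace_ord4E c : (forall k i j, c k i j = - c k j i) ->
  (forall k i, c k i i = 0) -> (forall i, \sum_k c k i k = 0) ->
  ((c ord4_1 ord4_0 ord4_1 =
      (- c ord4_2 ord4_0 ord4_2 - c ord4_3 ord4_0 ord4_3)%R) *
   (c ord4_2 ord4_1 ord4_2 =
      (c ord4_0 ord4_0 ord4_1 - c ord4_3 ord4_1 ord4_3)%R) *
   (c ord4_3 ord4_2 ord4_3 =
      (c ord4_0 ord4_0 ord4_2 + c ord4_1 ord4_1 ord4_2)%R) *
   (c ord4_0 ord4_0 ord4_3 =
      (- c ord4_1 ord4_1 ord4_3 - c ord4_2 ord4_2 ord4_3)%R))%type.
Proof.
move=> c_skew c_diag c_tr.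
have tr0 := c_tr ord4_0; have tr1 := c_tr ord4_1.
have tr2 := c_tr ord4_2; have tr3 := c_tr ord4_3.
move: tr0 tr1 tr2 tr3; rewrite !sum_ord4 !c_diag !(skew_ord4E c_skew) => tr0 tr1 tr2 tr3.
split; first split; first split; apply/eqP; rewrite -subr_eq0.
- by rewrite -tr0; apply/eqP; ring.
- by rewrite -tr1; apply/eqP; ring.
- by rewrite -tr2; apply/eqP; ring.
- by rewrite -oppr_eq0 -tr3; apply/eqP; ring.
Qed.

Lemma trace_ord4E c : (forall j, \sum_k c k k j = 0) -> forall j,
  c ord4_0 ord4_0 j =
  - c ord4_1 ord4_1 j - c ord4_2 ord4_2 j - c ord4_3 ord4_3 j.
Proof.
move=> c_tr j; have := c_tr j; rewrite sum_ord4 => trj; apply/eqP.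
by rewrite -subr_eq0 -[eqbRHS]trj; apply/eqP; ring.
Qed.

(* [dw^k = 1/2 sum_ij (a k i j) w^i w^j + sum_ij (b k i j) w^i conj(w^j)] in a
   unitary coframe [w]; [ac] and [bc] play the role of the conjugates of [a] and
   [b], and the components below are those of the forms named, up to the constants
   of [ddbar_form2_sq_frame]. *)
Variables a ac b bc : 'I_4 -> 'I_4 -> 'I_4 -> K.

Definition delbar_form2_coef i l m := b m i l - b l i m - ac i l m.

Definition del_form2_coef j k n := a n j k - bc k n j + bc j n k.

Definition ddbar_form2_coef j k l m := \sum_p
  (a p j k * delbar_form2_coef p l m - bc p l j * delbar_form2_coef k p m
   + bc p l k * delbar_form2_coef j p m + bc p m j * delbar_form2_coef k p l
   - bc p m k * delbar_form2_coef j p l).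

(* [del delbar (F ^ F) = 2 (del delbar F ^ F - delbar F ^ del F)] *)
Definition ddbar_sq_coef x0 x1 x2 y0 y1 y2 :=
  let d i j : K := (i == j)%:R in
  let K' := ddbar_form2_coef in let f := delbar_form2_coef in let g := del_form2_coef in
    K' x1 x2 y1 y2 * d x0 y0 - K' x1 x2 y0 y2 * d x0 y1 + K' x1 x2 y0 y1 * d x0 y2
  - K' x0 x2 y1 y2 * d x1 y0 + K' x0 x2 y0 y2 * d x1 y1 - K' x0 x2 y0 y1 * d x1 y2
  + K' x0 x1 y1 y2 * d x2 y0 - K' x0 x1 y0 y2 * d x2 y1 + K' x0 x1 y0 y1 * d x2 y2
  - f x0 y1 y2 * g x1 x2 y0 + f x0 y0 y2 * g x1 x2 y1 - f x0 y0 y1 * g x1 x2 y2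
  + f x1 y1 y2 * g x0 x2 y0 - f x1 y0 y2 * g x0 x2 y1 + f x1 y0 y1 * g x0 x2 y2
  - f x2 y1 y2 * g x0 x1 y0 + f x2 y0 y2 * g x0 x1 y1 - f x2 y0 y1 * g x0 x1 y2.

Definition ddbar_sq_compl (d e : 'I_4) := ddbar_sq_coef
  (lift d ord3_0) (lift d ord3_1) (lift d ord3_2)
  (lift e ord3_0) (lift e ord3_1) (lift e ord3_2).

(* Twice the pairing of [w^d] and [w^e] below, written with [a] and [b] only. *)
Definition pairing_coef d e :=
  \sum_i \sum_j a d i j * ac e i j + 2 * \sum_i \sum_j b d i j * bc e i j
  - 2 * ((\sum_i b d i i) * (\sum_i bc e i i))
  + 2 * (\sum_l \sum_j (a d e j * b j l l - a d l j * b j e l))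
  - 2 * (\sum_l \sum_j (bc e j l * ac j l d + bc e l j * b j l d - bc e d j * b j l l)).

Hypotheses (a_skew : forall k i j, a k i j = - a k j i) (a_diag : forall k i, a k i i = 0).
Hypotheses (ac_skew : forall k i j, ac k i j = - ac k j i) (ac_diag : forall k i, ac k i i = 0).
(* The trace conditions express that the Lie algebra is unimodular. *)
Hypotheses (a_tr : forall i, \sum_k a k i k = 0) (ac_tr : forall i, \sum_k ac k i k = 0).
Hypotheses (b_tr : forall j, \sum_k b k k j = 0) (bc_tr : forall j, \sum_k bc k k j = 0).

(* Coefficient by coefficient, [del delbar F^2 ^ w^d ^ conj(w^e)] is the pairing of
   [w^d] and [w^e] up to the differential of a 7-form, which unimodularity kills.
   All traces being eliminated, this is a polynomial identity. *)
Lemma ddbar_sq_complE (d e : 'I_4) :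
  2 * ((-1) ^+ (d + e) * ddbar_sq_compl d e) = - pairing_coef d e.
Proof.
have a_skewE := skew_ord4E a_skew; have ac_skewE := skew_ord4E ac_skew.
have a_trE := skew_trace_ord4E a_skew a_diag a_tr.
have ac_trE := skew_trace_ord4E ac_skew ac_diag ac_tr.
have b_trE := trace_ord4E b_tr; have bc_trE := trace_ord4E bc_tr.
move: d e; apply: ord4P; apply: ord4P;
  rewrite /ddbar_sq_compl !lift_ord4E /ddbar_sq_coef /=;
  rewrite exprD ?mulr1 ?mulr0 ?addr0 ?subr0 ?sub0r ?add0r;
  rewrite /pairing_coef /ddbar_form2_coef !sum_ord4 /delbar_form2_coef /del_form2_coef;
  rewrite !(a_diag, ac_diag) !(a_skewE, ac_skewE, a_trE, ac_trE, b_trE, bc_trE);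
  ring.
Qed.

End StructureConstants.

(** * Hermitian linear algebra *)

Lemma conj_mxK (C : numClosedFieldType) m n (A : 'M[C]_(m, n)) : A^*m^*m = A.
Proof. by apply/matrixP=> i j; rewrite !mxE conjCK. Qed.

Lemma conj_mxM (C : numClosedFieldType) m n p (A : 'M[C]_(m, n)) (B : 'M[C]_(n, p)) :
  (A *m B)^*m = A^*m *m B^*m.
Proof. exact: map_mxM. Qed.

Section MatrixDot.
Variable C : numClosedFieldType.

Definition mxdot p q (A B : 'M[C]_(p, q)) : C := dotmx (mxvec A) (mxvec B).
Local Notation "''[' A , B ]" := (mxdot A B) : ring_scope.

Lemma mxdotE p q (A B : 'M[C]_(p, q)) : '[A, B] = \sum_i \sum_j A i j * (B i j)^*.
Proof.
rewrite /mxdot dotmxE mxE (reindex _ (curry_mxvec_bij _ _)) pair_bigA /=.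
by apply: eq_bigr => -[i j] _; rewrite !mxE !mxvecE.
Qed.

Lemma mxdot_rowE q (u v : 'rV[C]_q) : '[u, v] = \sum_j u 0 j * (v 0 j)^*.
Proof. by rewrite mxdotE big_ord1. Qed.

Lemma mxdot_scalar p q (B : 'M[C]_(p, q)) : scalar (fun A : 'M[C]_(p, q) => '[A, B]).
Proof.
move=> x A A'; rewrite /mxdot linearD linearZ /= !dotmxE.
by rewrite mulmxDl -scalemxAl !mxE.
Qed.

Lemma mxdotC p q (A B : 'M[C]_(p, q)) : '[A, B] = '[B, A]^*.
Proof.
rewrite !mxdotE rmorph_sum; apply: eq_bigr => i _; rewrite rmorph_sum.
by apply: eq_bigr => j _; rewrite rmorphM /= conjCK mulrC.
Qed.

Lemma mxdot0r p q (A : 'M[C]_(p, q)) : '[A, 0] = 0.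
Proof. by rewrite mxdotC (linear_for0 (mxdot_scalar A)) rmorph0. Qed.

Lemma mxdotZr p q x (A B : 'M[C]_(p, q)) : '[A, x *: B] = x^* * '[A, B].
Proof. by rewrite mxdotC (scalarZ_fun (mxdot_scalar A)) rmorphM /= -mxdotC. Qed.

Lemma mxdotBr p q (A B D : 'M[C]_(p, q)) : '[A, B - D] = '[A, B] - '[A, D].
Proof. by rewrite mxdotC (linear_forB (mxdot_scalar A)) rmorphB /= -!mxdotC. Qed.

Lemma mxdot_ge0 p q (A : 'M[C]_(p, q)) : 0 <= '[A, A].
Proof. exact: (dnorm_ge0 (@dotmx C _)). Qed.

Lemma mxdot_eq0 p q (A : 'M[C]_(p, q)) : ('[A, A] == 0) = (A == 0).
Proof.
rewrite (dnorm_eq0 (@dotmx C _)) -{1}[0](linear0 (@mxvec _ _ _)).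
by rewrite (inj_eq (can_inj mxvecK)).
Qed.

Lemma mxdot_Cauchy p q (A B : 'M[C]_(p, q)) : '[A, B] * '[A, B]^* <= '[A, A] * '[B, B].
Proof. by rewrite -normCK; case: (CauchySchwarz (@dotmx C _) (mxvec A) (mxvec B)). Qed.

Lemma mxdot_Cauchy_eq p q (A B : 'M[C]_(p, q)) :
  '[B, B] = 1 -> '[A, A] = '[A, B] * '[A, B]^* -> A = '[A, B] *: B.
Proof.
move=> BB AA; apply/eqP; rewrite -subr_eq0 -mxdot_eq0 mxdotBr mxdotZr.
have D := linear_forB (mxdot_scalar _); have Z := scalarZ_fun (mxdot_scalar _).
rewrite !D !Z BB AA (mxdotC B A); apply/eqP; ring.
Qed.

Lemma mul_tr_rowE p q (u : 'rV[C]_p) (v : 'rV[C]_q) i j : (u^T *m v) i j = u 0 i * v 0 j.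
Proof. by rewrite mxE big_ord1 mxE. Qed.

Lemma mxdot_rank1 p q (u : 'rV[C]_p) (v : 'rV[C]_q) :
  '[u^T *m v, u^T *m v] = '[u, u] * '[v, v].
Proof.
rewrite !mxdotE !big_ord1 mulr_suml; apply: eq_bigr => i _; rewrite mulr_sumr.
by apply: eq_bigr => j _; rewrite !mul_tr_rowE rmorphM /=; ring.
Qed.

(* Cauchy-Schwarz for [u] and the conjugate of [v]. *)
Lemma trace_rank1_le p (u v : 'rV[C]_p) :
  \tr (u^T *m v) * (\tr (u^T *m v))^* <= '[u^T *m v, u^T *m v].
Proof.
have -> : \tr (u^T *m v) = '[u, v^*m].
  by rewrite mxdot_rowE; apply: eq_bigr => i _; rewrite mul_tr_rowE mxE conjCK.
rewrite mxdot_rank1; have -> : '[v, v] = '[v^*m, v^*m]; last exact: mxdot_Cauchy.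
by rewrite !mxdot_rowE; apply: eq_bigr => i _; rewrite !mxE conjCK mulrC.
Qed.

Section Wedge.
Variable n : nat.
Implicit Types (u v w : 'rV[C]_n) (U : {vspace 'rV[C]_n}).

Definition row_wedge u v : 'M[C]_n := u^T *m v - v^T *m u.

Lemma row_wedgeE u v i k : row_wedge u v i k = u 0 i * v 0 k - u 0 k * v 0 i.
Proof. by rewrite mxE [X in _ + X]mxE !mul_tr_rowE [v 0 i * _]mulrC. Qed.

Lemma row_wedgeC u v : row_wedge v u = - row_wedge u v.
Proof. by rewrite opprB. Qed.

Lemma bilinear_row_wedge : bilinear_map row_wedge.
Proof.
have linear_l v : linear (row_wedge^~ v).
  move=> x u u'; rewrite /row_wedge linearP /= mulmxDl mulmxDr -scalemxAl -scalemxAr.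
  by rewrite opprD addrACA scalerBr.
split=> // u x v v'; rewrite row_wedgeC linear_l opprD -scalerN.
by rewrite -(row_wedgeC v u) -(row_wedgeC v' u).
Qed.

Lemma row_wedgeZ x y u v : row_wedge (x *: u) (y *: v) = (x * y) *: row_wedge u v.
Proof. by rewrite (bilinearZl bilinear_row_wedge) (bilinearZr bilinear_row_wedge) scalerA. Qed.

Lemma row_wedge_comb x y x' y' u v :
  row_wedge (x *: u + y *: v) (x' *: u + y' *: v) = (x * y' - y * x') *: row_wedge u v.
Proof. by apply/matrixP => i k; rewrite [RHS]mxE !row_wedgeE !mxE; ring. Qed.

Lemma row_wedge_eq0_mem U u v : row_wedge u v = 0 -> u \in U -> v \notin U -> u = 0.
Proof.
move=> uv0 Uu; apply: contraNeq => /rV0Pn[i ui]; rewrite (_ : v = (v 0 i / u 0 i) *: u) ?memvZ //.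
apply/rowP=> k; rewrite mxE; apply: (mulfI ui).
have /matrixP/(_ i k) := uv0; rewrite row_wedgeE mxE => /eqP; rewrite subr_eq0 => /eqP ->.
by field.
Qed.

Lemma row_wedge_neq0_free x y u v : row_wedge u v != 0 -> x *: v = y *: u -> x = 0 /\ y = 0.
Proof.
have wedgeB := bilinear_row_wedge; have wedge_diag w : row_wedge w w = 0 by exact: subrr.
move=> /negbTE uv_neq0 xv_yu.
have x0 : x = 0.
  have /eqP : x *: row_wedge u v = 0.
    by rewrite -(bilinearZr wedgeB) xv_yu (bilinearZr wedgeB) wedge_diag scaler0.
  by rewrite scaler_eq0 uv_neq0 orbF => /eqP.
split=> //; have /eqP : y *: row_wedge u v = 0.
  by rewrite -(bilinearZl wedgeB) -xv_yu x0 scale0r (bilinear0l wedgeB).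
by rewrite scaler_eq0 uv_neq0 orbF => /eqP.
Qed.

Lemma dimv2_span U : (\dim U <= 2)%N ->
  exists u v, [/\ u \in U, v \in U & forall w, w \in U -> exists x y, w = x *: u + y *: v].
Proof.
move=> dimU; exists (vbasis U)`_0, (vbasis U)`_1.
have vbasis_mem i : (vbasis U)`_i \in U.
  have [iU|Ui] := ltnP i (\dim U); first by rewrite vbasis_mem // mem_nth // size_tuple.
  by rewrite nth_default ?mem0v // size_tuple.
split=> // w Uw; have [x ->] : exists x : nat -> C, w = \sum_(i < \dim U) x i *: (vbasis U)`_i.
  exists (fun i => if insub i is Some i' then coord (vbasis U) i' w else 0).
  by rewrite [LHS](coord_vbasis Uw); apply: eq_bigr => i _; rewrite valK.
exists (x 0%N), (x 1%N); move: (vbasis U : seq _) (size_tuple (vbasis U)) => s size_s.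
move: dimU size_s; case: (\dim U) => [|[|[|//]]] _ size_s;
  rewrite ?big_ord_recl big_ord0 /= ?addr0 //.
  by rewrite (size0nil size_s) !nth_nil !scaler0 addr0.
by case: s size_s => [|? []] //= _; rewrite scaler0 addr0.
Qed.

Definition exterior_square U : {vspace 'M[C]_n} :=
  <<[seq row_wedge u v | u <- vbasis U, v <- vbasis U]>>%VS.

Lemma mem_exterior_square U u v : u \in U -> v \in U -> row_wedge u v \in exterior_square U.
Proof.
move=> Uu Uv; rewrite (coord_vbasis Uu) (coord_vbasis Uv).
rewrite (bilinear_suml bilinear_row_wedge) memv_suml // => i _.
rewrite (bilinear_sumr bilinear_row_wedge) memv_suml // => j _; rewrite row_wedgeZ memvZ //.
by rewrite memv_span // allpairs_f // mem_nth // size_tuple.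
Qed.

Lemma exterior_square_dim2 U : (\dim U <= 2)%N -> exists u v, [/\ u \in U, v \in U,
  forall w, w \in U -> exists x y, w = x *: u + y *: v
  & (exterior_square U <= <[row_wedge u v]>)%VS].
Proof.
move=> /dimv2_span[u [v [Uu Uv spanU]]]; exists u, v; split=> //.
apply/span_subvP => _ /allpairsP[[p q] /= [/vbasis_mem/spanU[x [y ->]] + ->]].
move=> /vbasis_mem/spanU[x' [y' ->]].
by rewrite row_wedge_comb memvZ // memv_line.
Qed.

(* For [\dim U <= 2] the wedges of elements of [U] are proportional, so that [om] is
   the product of a form [conj kappa] with a fixed wedge [u ^ v]; its contraction is
   the interior product of [kappa] with [u ^ v]. *)
Lemma contraction_orthogonal_eq0 U (om : 'I_n -> 'M[C]_n) : (\dim U <= 2)%N ->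
  (forall l, om l \in exterior_square U) ->
  (forall i k, \row_l (om l i k)^* \in U) ->
  (forall w, w \in U -> '[\row_m \sum_l om l l m, w] = 0) ->
  forall l, om l = 0.
Proof.
move=> /exterior_square_dim2[u [v [Uu Uv spanU wedgeU]]] om_wedge om_conj om_orth l.
have /choice[c omE] j : exists c, om j = c *: row_wedge u v.
  exact/vlineP/(subvP wedgeU).
have [uv0|uv_neq0] := eqVneq (row_wedge u v) 0; first by rewrite omE uv0 scaler0.
pose kappa : 'rV[C]_n := \row_j (c j)^*.
have /matrix0Pn[i0 [k0 uv_ik]] := uv_neq0.
have om_ik j i k : om j i k = c j * row_wedge u v i k by rewrite omE mxE.
have Ukappa : kappa \in U.
  move: uv_ik (fun j => om_ik j i0 k0); set W := row_wedge u v i0 k0 => W_neq0 {}om_ik.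
  rewrite (_ : kappa = (W^-1)^* *: \row_j (om j i0 k0)^*) ?memvZ //.
  by apply/rowP=> j; rewrite !mxE om_ik -rmorphM mulrCA mulVf ?mulr1.
pose su := '[u, kappa]; pose sv := '[v, kappa].
have contractionE : \row_m \sum_j om j j m = su *: v - sv *: u.
  apply/rowP=> k; rewrite !mxE /su /sv !mxdot_rowE !mulr_suml -sumrB; apply: eq_bigr => j _.
  by rewrite om_ik row_wedgeE !mxE conjCK; ring.
have contraction0 : su *: v = sv *: u.
  apply/eqP; rewrite -subr_eq0 -mxdot_eq0 -contractionE; apply/eqP/om_orth.
  by rewrite contractionE memvB ?memvZ.
have [su0 sv0] := row_wedge_neq0_free uv_neq0 contraction0.
have [x [y kappaE]] := spanU _ Ukappa.
have : '[kappa, kappa] = 0.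
  rewrite {1}kappaE mxdot_scalar (scalarZ_fun (mxdot_scalar kappa)).
  by rewrite -/su -/sv su0 sv0 !mulr0 addr0.
move/eqP; rewrite mxdot_eq0 => /eqP/rowP/(_ l); rewrite !mxE => /eqP.
by rewrite conjC_eq0 omE => /eqP ->; rewrite scale0r.
Qed.

End Wedge.
End MatrixDot.

Local Notation "''[' A , B ]" := (mxdot A B) : ring_scope.

(** * Structure tables of an astheno-Kaehler metric *)

Section Tables.
Variables (C : numClosedFieldType) (n : nat).
(* [dw^k = 1/2 sum_ij (a k i j) w^i w^j + sum_ij (b k i j) w^i conj(w^j)] in a
   unitary coframe [w]; the row [z] stands for the (1,0)-form [sum_k z_k w^k]. *)
Variables a b : 'I_n -> 'M[C]_n.
Implicit Types z y : 'rV[C]_n.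

Definition del_mx z : 'M[C]_n := \sum_k z 0 k *: a k.
Definition delbar_mx z : 'M[C]_n := \sum_k z 0 k *: b k.

Let linear_table (c : 'I_n -> 'M[C]_n) : linear (fun z => \sum_k z 0 k *: c k).
Proof.
move=> x z y; rewrite scaler_sumr -big_split; apply: eq_bigr => k _ /=.
by rewrite !mxE scalerDl scalerA.
Qed.

HB.instance Definition _ := GRing.isLinear.Build C _ _ _ del_mx (linear_table a).
HB.instance Definition _ := GRing.isLinear.Build C _ _ _ delbar_mx (linear_table b).

Lemma del_mxZ x z : del_mx (x *: z) = x *: del_mx z. Proof. exact: linearZ. Qed.
Lemma delbar_mxZ x z : delbar_mx (x *: z) = x *: delbar_mx z. Proof. exact: linearZ. Qed.

Lemma del_mxE z i j : del_mx z i j = \sum_k z 0 k * a k i j.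
Proof. by rewrite summxE; apply: eq_bigr => k _; rewrite mxE. Qed.

Lemma delbar_mxE z i j : delbar_mx z i j = \sum_k z 0 k * b k i j.
Proof. by rewrite summxE; apply: eq_bigr => k _; rewrite mxE. Qed.

(* [delbar z = sum_l (left_factor l z) ^ conj(w^l)
             = sum_i w^i ^ conj(right_factor z i)] *)
Definition left_factor l z : 'rV[C]_n := \row_i delbar_mx z i l.
Definition right_factor z i : 'rV[C]_n := \row_j (delbar_mx z i j)^*.

Lemma left_factor_linear l : linear (left_factor l).
Proof. by move=> x z y; apply/rowP=> i; rewrite !mxE linearP !mxE. Qed.
HB.instance Definition _ l := GRing.isLinear.Build C _ _ _ (left_factor l) (left_factor_linear l).

(* The component on [conj(w^l) ^ w^i ^ w^k] of [delbar del z], resp. [del delbar z] *)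
Definition delbar_del l z : 'M[C]_n :=
  \matrix_(i, k) (delbar_mx (row k (del_mx z)) i l - delbar_mx (row i (del_mx z)) k l).
Definition del_delbar l z : 'M[C]_n := \matrix_(i, k)
  (del_mx (left_factor l z) i k + (delbar_mx (right_factor z i) l k)^*
   - (delbar_mx (right_factor z k) l i)^*).

Lemma delbar_delE l z i k : delbar_del l z i k =
  delbar_mx (row k (del_mx z)) i l - delbar_mx (row i (del_mx z)) k l.
Proof. by rewrite mxE. Qed.

Lemma del_delbarE l z i k : del_delbar l z i k = del_mx (left_factor l z) i k +
  (delbar_mx (right_factor z i) l k)^* - (delbar_mx (right_factor z k) l i)^*.
Proof. by rewrite mxE. Qed.

Lemma delbar_del_linear l : linear (delbar_del l).
Proof.
by move=> x z y; apply/matrixP=> i k; rewrite !mxE !linearP !mxE; ring.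
Qed.
HB.instance Definition _ l := GRing.isLinear.Build C _ _ _ (delbar_del l) (delbar_del_linear l).

Definition contraction z : 'rV[C]_n := \row_m \sum_l delbar_del l z l m.

(* [del delbar F^(n-2) ^ z ^ conj y], up to a factor, when the Lie algebra is unimodular *)
Definition pairing z y : C :=
  2^-1 * '[del_mx z, del_mx y] + '[delbar_mx z, delbar_mx y]
  - \tr (delbar_mx z) * (\tr (delbar_mx y))^* + '[contraction z, y] + '[contraction y, z]^*.

Definition closed_forms : {vspace 'rV[C]_n} :=
  (lker (linfun del_mx) :&: lker (linfun delbar_mx))%VS.

Definition delbar_del_closed_forms : {vspace 'rV[C]_n} :=
  (\bigcap_l lker (linfun (delbar_del l)))%VS.

(* The consequences used below of the structure equations of a nilpotent Lie algebra
   with integrable complex structure and astheno-Kaehler metric. *)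
Record astheno_kahler_tables : Prop := AsthenoKahlerTables {
  delbar_delbar : forall z i l j, (del_mx (right_factor z i) l j)^* =
    delbar_mx (left_factor j z) i l - delbar_mx (left_factor l z) i j;
  delbar_delN : forall l z, delbar_del l z = - del_delbar l z;
  engel : forall U : {vspace 'rV[C]_n}, U != fullv ->
    exists2 z, z \notin U & forall l, left_factor l z \in U;
  pairing_eq0 : forall z y, pairing z y = 0 }.

Local Notation K := closed_forms.
Local Notation L := delbar_del_closed_forms.

Lemma closed_formsP z : reflect (del_mx z = 0 /\ delbar_mx z = 0) (z \in K).
Proof.
rewrite memv_cap !memv_ker !lfunE /=.
by apply: (iffP andP) => [[/eqP-> /eqP->]|[-> ->]]; rewrite ?eqxx.
Qed.

Lemma delbar_del_closedP z : reflect (forall l, delbar_del l z = 0) (z \in L).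
Proof.
rewrite memvE; apply: (iffP subv_bigcapP) => [zL l|zL l _].
  by have := zL l isT; rewrite -memvE memv_ker lfunE => /eqP.
by rewrite -memvE memv_ker lfunE /= zL.
Qed.

Lemma delbar_del_eq0 z : del_mx z = 0 -> z \in L.
Proof.
move=> z0; apply/delbar_del_closedP => l; apply/matrixP=> i k.
by rewrite !mxE z0 !row0 linear0 !mxE subrr.
Qed.

Lemma closed_delbar_del : (K <= L)%VS.
Proof. by apply/subvP => z /closed_formsP[z0 _]; exact: delbar_del_eq0. Qed.

Lemma contraction_eq0 z : z \in L -> contraction z = 0.
Proof.
by move=> /delbar_del_closedP zL; apply/rowP=> m; rewrite !mxE big1 // => l _; rewrite zL mxE.
Qed.

Lemma trace_delbar_mx z : \tr (delbar_mx z) = \sum_k z 0 k * \tr (b k).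
Proof. by rewrite /delbar_mx raddf_sum; apply: eq_bigr => k _; rewrite /= mxtraceZ. Qed.

Lemma row_trace_right_factor z :
  \row_i (\tr (delbar_mx (right_factor z i)))^* = \sum_l (\tr (b l))^* *: left_factor l z.
Proof.
apply/rowP=> i; rewrite mxE trace_delbar_mx rmorph_sum summxE.
by apply: eq_bigr => l _; rewrite !mxE rmorphM /= conjCK mulrC.
Qed.

Lemma row_trace_left_factor z :
  \row_l (\tr (delbar_mx (left_factor l z)))^* = \sum_i (\tr (b i))^* *: right_factor z i.
Proof.
apply/rowP=> l; rewrite mxE trace_delbar_mx rmorph_sum summxE.
by apply: eq_bigr => i _; rewrite !mxE rmorphM /= mulrC.
Qed.

Hypothesis tables : astheno_kahler_tables.

Lemma delbar_del_closed_norm z : z \in L ->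
  2^-1 * '[del_mx z, del_mx z] + '[delbar_mx z, delbar_mx z] =
  \tr (delbar_mx z) * (\tr (delbar_mx z))^*.
Proof.
move=> zL; have /eqP := pairing_eq0 tables z z.
rewrite /pairing contraction_eq0 // (linear_for0 (mxdot_scalar z)) rmorph0 !addr0.
by rewrite subr_eq0 => /eqP.
Qed.

Lemma trace0_closed z : z \in L -> \tr (delbar_mx z) = 0 -> z \in K.
Proof.
move=> zL tr0; have /eqP := delbar_del_closed_norm zL; rewrite tr0 mul0r.
rewrite paddr_eq0 ?mulr_ge0 ?invr_ge0 ?ler0n ?mxdot_ge0 //.
rewrite mulf_eq0 invr_eq0 pnatr_eq0 /= !mxdot_eq0 => /andP[/eqP ? /eqP ?].
exact/closed_formsP.
Qed.

Lemma rank1_del_eq0 z (u v : 'rV[C]_n) : z \in L -> delbar_mx z = u^T *m v -> del_mx z = 0.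
Proof.
move=> zL zE; apply/eqP; rewrite -mxdot_eq0 eq_le mxdot_ge0 andbT.
rewrite -(pmulr_rle0 _ (_ : 0 < 2^-1)) ?invr_gt0 ?ltr0n //.
rewrite (canRL (addrK _) (delbar_del_closed_norm zL)) subr_le0 zE.
exact: trace_rank1_le.
Qed.

Lemma closed_combination z y : z \in L -> y \in L -> \tr (delbar_mx z) != 0 ->
  y - (\tr (delbar_mx y) / \tr (delbar_mx z)) *: z \in K.
Proof.
move=> zL yL tr_neq0; apply: trace0_closed; first by rewrite memvB ?memvZ.
by rewrite linearB /= delbar_mxZ linearB /= mxtraceZ divfK ?subrr.
Qed.

Lemma proportional_del z y : z \in L -> y \in L -> \tr (delbar_mx z) != 0 ->
  del_mx y = (\tr (delbar_mx y) / \tr (delbar_mx z)) *: del_mx z /\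
  delbar_mx y = (\tr (delbar_mx y) / \tr (delbar_mx z)) *: delbar_mx z.
Proof.
move=> zL yL tr_neq0; have /closed_formsP[] := closed_combination zL yL tr_neq0.
rewrite !linearB /= del_mxZ delbar_mxZ => /eqP; rewrite subr_eq0 => /eqP del_y /eqP.
by rewrite subr_eq0 => /eqP.
Qed.

Lemma closed_trace z : z \in K -> \tr (delbar_mx z) = 0.
Proof. by move=> /closed_formsP[_ ->]; rewrite linear0. Qed.

Lemma contraction_closed z y : y \in K -> '[contraction z, y] = 0.
Proof.
move=> yK; have := pairing_eq0 tables z y; rewrite /pairing (closed_trace yK).
rewrite [contraction y]contraction_eq0 ?(subvP closed_delbar_del) //.
have /closed_formsP[-> ->] := yK; rewrite !mxdot0r (linear_for0 (mxdot_scalar z)).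
by rewrite conjC0 !mulr0 subr0 !addr0 add0r.
Qed.

Section ClosedLeftFactors.
Variable z : 'rV[C]_n.
Hypothesis left_closed : forall l, left_factor l z \in K.

Let alpha : 'rV[C]_n := \row_i (\tr (delbar_mx (right_factor z i)))^*.

Lemma del_right_factor i : del_mx (right_factor z i) = 0.
Proof.
apply/matrixP=> l j; apply: (can_inj (@conjCK C)); rewrite (delbar_delbar tables).
have /closed_formsP[_ ->] := left_closed j; have /closed_formsP[_ ->] := left_closed l.
by rewrite !mxE rmorph0 subrr.
Qed.

Lemma del_delbar_left_closed l i k : del_delbar l z i k =
  (delbar_mx (right_factor z i) l k)^* - (delbar_mx (right_factor z k) l i)^*.
Proof. by have /closed_formsP[h _] := left_closed l; rewrite mxE h mxE add0r. Qed.

Lemma trace0_right_closed :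
  (forall i, \tr (delbar_mx (right_factor z i)) = 0) ->
  (forall i, right_factor z i \in K) /\ z \in L.
Proof.
move=> tr0; have right_closed i : right_factor z i \in K.
  by apply: trace0_closed (tr0 i); apply: delbar_del_eq0; exact: del_right_factor.
split=> //; apply/delbar_del_closedP => l; rewrite (delbar_delN tables); apply/eqP.
rewrite oppr_eq0; apply/eqP/matrixP=> i k; rewrite del_delbar_left_closed.
have /closed_formsP[_ ->] := right_closed i; have /closed_formsP[_ ->] := right_closed k.
by rewrite !mxE subrr.
Qed.

Let alpha_closed : alpha \in K.
Proof.
by rewrite /alpha row_trace_right_factor; apply: memv_suml => l _; rewrite memvZ.
Qed.

Section NonzeroTrace.
Variable i0 : 'I_n.
Local Notation g := (right_factor z i0).
Hypothesis tr_g : \tr (delbar_mx g) != 0.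

Let B : 'M[C]_n := (\tr (delbar_mx g))^-1 *: delbar_mx g.

Let right_L i : right_factor z i \in L.
Proof. by apply: delbar_del_eq0; exact: del_right_factor. Qed.

Let delbar_right_factor i : delbar_mx (right_factor z i) = (alpha 0 i)^* *: B.
Proof.
by rewrite (proportional_del (right_L i0) (right_L i) tr_g).2 mxE conjCK scalerA.
Qed.

Let del_delbarE l i k : del_delbar l z i k = alpha 0 i * (B l k)^* - alpha 0 k * (B l i)^*.
Proof.
rewrite del_delbar_left_closed !delbar_right_factor ![(_ *: B) _ _]mxE !rmorphM /=.
by rewrite !conjCK.
Qed.

Let tr_B : \tr B = 1.
Proof. by rewrite mxtraceZ mulVf. Qed.

Let norm_B : '[B, B] = 1.
Proof.
have := delbar_del_closed_norm (right_L i0).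
rewrite del_right_factor mxdot0r mulr0 add0r => gg.
rewrite mxdotZr (scalarZ_fun (mxdot_scalar _)) gg fmorphV; field.
by rewrite conjC_eq0 tr_g.
Qed.

Let P : 'M[C]_n := alpha^T *m alpha^*m.

Let P_dot_B : '[P, B] = '[alpha, alpha].
Proof.
have /eqP := contraction_closed z alpha_closed; rewrite mxdot_rowE.
under eq_bigr => m _ do rewrite mxE.
under eq_bigr => m _ do under eq_bigr => l _ do rewrite (delbar_delN tables) mxE del_delbarE.
under eq_bigr => m _ do rewrite sumrN sumrB -mulr_sumr -rmorph_sum -/(\tr B) tr_B rmorph1 mulr1.
rewrite mxdotE exchange_big mxdot_rowE => /eqP sum0; apply/eqP.
rewrite -subr_eq0 -oppr_eq0 -[eqbRHS]sum0 -sumrB -sumrN; apply/eqP; apply: eq_bigr => m _ /=.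
rewrite !mulNr mulrBl; congr (- (_ - _)); rewrite mulr_suml; apply: eq_bigr => l _.
by rewrite mxE big_ord1 !mxE; ring.
Qed.

Let norm_P : '[P, P] = '[P, B] * '[P, B]^*.
Proof.
rewrite P_dot_B -mxdotC mxdot_rank1; congr (_ * _).
by rewrite !mxdot_rowE; apply: eq_bigr => i _; rewrite !mxE conjCK mulrC.
Qed.

Let norm_alpha := '[alpha, alpha].

Let norm_alpha_neq0 : norm_alpha != 0.
Proof.
rewrite mxdot_eq0; apply/eqP => /rowP/(_ i0); rewrite !mxE => /eqP.
by rewrite conjC_eq0 (negbTE tr_g).
Qed.

(* Equality holds in Cauchy-Schwarz for [P] and [B]. *)
Let BE l k : norm_alpha * B l k = alpha 0 l * (alpha 0 k)^*.
Proof.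
have /matrixP/(_ l k) := mxdot_Cauchy_eq norm_B norm_P.
by rewrite P_dot_B mxE big_ord1 !mxE.
Qed.

Let z_delbar_del_closed : z \in L.
Proof.
apply/delbar_del_closedP => l; rewrite (delbar_delN tables); apply/eqP; rewrite oppr_eq0.
apply/eqP/matrixP=> i k; apply: (mulfI norm_alpha_neq0).
have norm_real : norm_alpha^* = norm_alpha by rewrite -mxdotC.
transitivity (alpha 0 i * (norm_alpha * B l k)^* - alpha 0 k * (norm_alpha * B l i)^*).
  by rewrite del_delbarE !rmorphM /= norm_real; ring.
by rewrite !BE !rmorphM /= !conjCK [X in _ = _ * X]mxE; ring.
Qed.

Lemma trace_right_factor_contra : False.
Proof.
have delbar_zE j : delbar_mx z i0 j =
    \tr (delbar_mx z) / norm_alpha * (alpha 0 i0 * (alpha 0 j)^*).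
  rewrite -BE mulrA divfK // [X in _ = _ * X]mxE mulrA.
  by rewrite {1}(proportional_del (right_L i0) z_delbar_del_closed tr_g).2 mxE.
suff gK : g \in K by move/eqP: tr_g; apply; exact: closed_trace.
have -> : g = ((\tr (delbar_mx z) / norm_alpha)^* * (alpha 0 i0)^*) *: alpha;
  last by rewrite memvZ.
by apply/rowP=> j; rewrite [LHS]mxE [RHS]mxE delbar_zE !rmorphM /= conjCK mulrA.
Qed.

End NonzeroTrace.

Lemma left_closed_right_closed : (forall i, right_factor z i \in K) /\ z \in L.
Proof.
apply: trace0_right_closed => i; apply/eqP/negPn/negP.
exact: trace_right_factor_contra.
Qed.

End ClosedLeftFactors.

Section TwoEngelSteps.
Hypothesis dim_closed : (\dim K <= 2)%N.
Variables zeta xi : 'rV[C]_n.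
Hypotheses (zeta_not_closed : zeta \notin K) (xi_notin : xi \notin L).
Hypotheses (left_zeta : forall l, left_factor l zeta \in K).
Hypotheses (left_xi : forall l, left_factor l xi \in L).

Local Notation t := (\tr (delbar_mx zeta)).
Let right_zeta i : right_factor zeta i \in K := (left_closed_right_closed left_zeta).1 i.
Let zeta_L : zeta \in L := (left_closed_right_closed left_zeta).2.
Let t_neq0 : t != 0. Proof. by apply: contraNneq zeta_not_closed; exact: trace0_closed. Qed.

(* The left factors of [xi] are congruent to [(gamma l)^* *: zeta] modulo [K]. *)
Let gamma : 'rV[C]_n := \row_l (\tr (delbar_mx (left_factor l xi)) / t)^*.

Let delbar_left_xi l : delbar_mx (left_factor l xi) = (gamma 0 l)^* *: delbar_mx zeta.
Proof. by rewrite (proportional_del zeta_L (left_xi l) t_neq0).2 mxE conjCK. Qed.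

Let del_left_xi l : del_mx (left_factor l xi) = (gamma 0 l)^* *: del_mx zeta.
Proof. by rewrite (proportional_del zeta_L (left_xi l) t_neq0).1 mxE conjCK. Qed.

Let gammaE : gamma = (t^-1)^* *: \sum_i (\tr (b i))^* *: right_factor xi i.
Proof.
by rewrite -row_trace_left_factor; apply/rowP=> l; rewrite !mxE rmorphM mulrC.
Qed.

Let del_right_xi i : del_mx (right_factor xi i) = row_wedge (right_factor zeta i) gamma.
Proof.
apply/matrixP=> l j; apply: (can_inj (@conjCK C)); rewrite (delbar_delbar tables).
rewrite !delbar_left_xi row_wedgeE !mxE !rmorphB !rmorphM /= !conjCK.
by ring.
Qed.

Let del_gamma : del_mx gamma = 0.
Proof.
rewrite gammaE del_mxZ [del_mx _]linear_sum /=.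
have wedgeB := bilinear_row_wedge C n.
transitivity ((t^-1)^* *: row_wedge (\sum_i (\tr (b i))^* *: right_factor zeta i) gamma).
  congr (_ *: _); rewrite (bilinear_suml wedgeB); apply: eq_bigr => i _.
  by rewrite del_mxZ del_right_xi (bilinearZl wedgeB).
rewrite -row_trace_left_factor (_ : \row__ _ = 0) ?(bilinear0l wedgeB) ?scaler0 //.
by apply/rowP=> l; rewrite !mxE closed_trace // rmorph0.
Qed.

Let gamma_L : gamma \in L. Proof. exact: delbar_del_eq0 del_gamma. Qed.

Let gamma_neq0 : gamma != 0.
Proof.
apply: contraNneq xi_notin => gamma0; apply: (left_closed_right_closed _).2 => l.
by apply/closed_formsP; rewrite del_left_xi delbar_left_xi gamma0 mxE rmorph0 !scale0r.
Qed.

Let delbar_del_right_xi i l :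
  delbar_del l (right_factor xi i) = row_wedge (left_factor l gamma) (right_factor zeta i).
Proof.
have delbar_row k : delbar_mx (row k (del_mx (right_factor xi i))) =
    right_factor zeta i 0 k *: delbar_mx gamma.
  have -> : row k (del_mx (right_factor xi i)) =
      right_factor zeta i 0 k *: gamma - gamma 0 k *: right_factor zeta i.
    by apply/rowP=> j; rewrite mxE del_right_xi row_wedgeE !mxE; ring.
  rewrite linearB /= !delbar_mxZ; have /closed_formsP[_ ->] := right_zeta i.
  by rewrite scaler0 subr0.
apply/matrixP=> m k; rewrite [LHS]mxE !delbar_row row_wedgeE !mxE.
by ring.
Qed.

Lemma gamma_not_closed_contra : gamma \notin K -> False.
Proof.
move=> gamma_notin.
have tr_gamma : \tr (delbar_mx gamma) != 0.
  by apply: contraNneq gamma_notin; exact: trace0_closed.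
have delbar_gamma := (proportional_del zeta_L gamma_L t_neq0).2.
set c := _ / _ in delbar_gamma.
have left_gamma l : left_factor l gamma = c *: left_factor l zeta.
  by apply/rowP=> i; rewrite !mxE delbar_gamma mxE.
have right_gamma i : right_factor gamma i = c^* *: right_factor zeta i.
  by apply/rowP=> l; rewrite !mxE delbar_gamma mxE rmorphM.
have right_xi_L i : right_factor xi i \in L.
  apply/delbar_del_closedP; apply: (contraction_orthogonal_eq0 dim_closed).
  - by move=> l; rewrite delbar_del_right_xi left_gamma mem_exterior_square // memvZ.
  - move=> m k; rewrite (_ : \row__ _ = (right_factor zeta i 0 k)^* *: right_factor gamma m -
      (right_factor zeta i 0 m)^* *: right_factor gamma k).
      by rewrite !right_gamma memvB ?memvZ.
    apply/rowP=> l; rewrite mxE delbar_del_right_xi row_wedgeE rmorphB !rmorphM /=.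
    by rewrite !mxE; ring.
  - by move=> y; exact: contraction_closed.
have right_zeta0 i : right_factor zeta i = 0.
  apply: (row_wedge_eq0_mem _ (right_zeta i) gamma_notin).
  rewrite -del_right_xi (proportional_del gamma_L (right_xi_L i) tr_gamma).1.
  by rewrite del_gamma scaler0.
move/eqP: t_neq0; apply; apply: big1 => i _; apply: (can_inj (@conjCK C)).
by have /rowP/(_ i) := right_zeta0 i; rewrite !mxE conjC0.
Qed.

Section GammaClosed.
Hypothesis gamma_closed : gamma \in K.

Let delbar_gamma : delbar_mx gamma = 0.
Proof. by have /closed_formsP[_] := gamma_closed. Qed.

Let right_xi_L i : right_factor xi i \in L.
Proof.
apply/delbar_del_closedP => l; rewrite delbar_del_right_xi.
rewrite (_ : left_factor l gamma = 0) ?(bilinear0l (bilinear_row_wedge C n)) //.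
by apply/rowP=> k; rewrite !mxE delbar_gamma mxE.
Qed.

Let rho : 'rV[C]_n := \row_i (\tr (delbar_mx (right_factor xi i)) / t)^*.

Let del_right_xi_rho i : del_mx (right_factor xi i) = (rho 0 i)^* *: del_mx zeta.
Proof. by rewrite (proportional_del zeta_L (right_xi_L i) t_neq0).1 mxE conjCK. Qed.

Let delbar_right_xi_rho i : delbar_mx (right_factor xi i) = (rho 0 i)^* *: delbar_mx zeta.
Proof. by rewrite (proportional_del zeta_L (right_xi_L i) t_neq0).2 mxE conjCK. Qed.

Let rho_closed : rho \in K.
Proof.
have -> : rho = (t^-1)^* *: \sum_l (\tr (b l))^* *: left_factor l xi.
  by rewrite -row_trace_right_factor; apply/rowP=> i; rewrite !mxE rmorphM mulrC.
rewrite memvZ //; apply: trace0_closed; first by apply: memv_suml => l _; rewrite memvZ.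
rewrite [delbar_mx _]linear_sum raddf_sum /=; transitivity (t * (\tr (delbar_mx gamma))^*).
  rewrite (trace_delbar_mx gamma) rmorph_sum mulr_sumr; apply: eq_bigr => l _.
  by rewrite delbar_mxZ mxtraceZ delbar_left_xi mxtraceZ rmorphM /=; ring.
by rewrite (closed_trace gamma_closed) conjC0 mulr0.
Qed.

Let del_zeta : exists2 beta, beta \in K & del_mx zeta = row_wedge beta gamma.
Proof.
have [rho0|/rV0Pn[i rho_i]] := eqVneq rho 0.
  exists 0; first exact: mem0v.
  rewrite (bilinear0l (bilinear_row_wedge C n)).
  have /rV0Pn[j gamma_j] := gamma_neq0.
  have right_zetaE i k : right_factor zeta i 0 k = right_factor zeta i 0 j / gamma 0 j * gamma 0 k.
    apply: (mulIf gamma_j); have := del_right_xi_rho i.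
    rewrite del_right_xi rho0 mxE conjC0 scale0r => /matrixP/(_ j k).
    rewrite row_wedgeE [RHS]mxE => /eqP.
    by rewrite subr_eq0 mulrAC divfK // => /eqP.
  apply: (rank1_del_eq0 (u := \row_i (right_factor zeta i 0 j / gamma 0 j)^*)
    (v := gamma^*m)) => //; apply/matrixP=> i k.
  rewrite mul_tr_rowE [(\row__ _) _ _]mxE [_^*m _ _]mxE -rmorphM /= -right_zetaE.
  by rewrite [in RHS]mxE conjCK.
exists ((rho 0 i)^*^-1 *: right_factor zeta i); first by rewrite memvZ.
apply: (scalerI (a := (rho 0 i)^*)); first by rewrite conjC_eq0.
rewrite -del_right_xi_rho del_right_xi (bilinearZl (bilinear_row_wedge C n)) scalerA.
by rewrite mulfV ?scale1r // conjC_eq0.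
Qed.

Lemma gamma_closed_contra : False.
Proof.
have [beta beta_closed del_zetaE] := del_zeta.
have del_delbarE l : del_delbar l xi =
    (gamma 0 l)^* *: row_wedge beta gamma + row_wedge rho (right_factor zeta l).
  rewrite -del_zetaE -del_left_xi; apply/matrixP=> i k.
  rewrite [LHS]mxE [RHS]mxE row_wedgeE !delbar_right_xi_rho -addrA.
  by congr (_ + (_ - _)); rewrite [in LHS]mxE rmorphM /= conjCK [right_factor _ _ _ _]mxE.
have xi0 : forall l, del_delbar l xi = 0.
  apply: (contraction_orthogonal_eq0 dim_closed).
  - by move=> l; rewrite del_delbarE memvD ?memvZ ?mem_exterior_square.
  - move=> i k; rewrite (_ : \row__ _ = (row_wedge beta gamma i k)^* *: gamma +
      ((rho 0 i)^* *: left_factor k zeta - (rho 0 k)^* *: left_factor i zeta)).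
      by rewrite memvD ?memvB ?memvZ.
    apply/rowP=> l; rewrite mxE.
    have -> : del_delbar l xi i k =
        (gamma 0 l)^* * row_wedge beta gamma i k + row_wedge rho (right_factor zeta l) i k.
      by rewrite del_delbarE mxE [X in X + _]mxE.
    rewrite (row_wedgeE rho) rmorphD rmorphB !rmorphM /= conjCK.
    rewrite [right_factor _ _ _ k]mxE [right_factor _ _ _ i]mxE !conjCK.
    by move: (row_wedge _ _ i k) => w; rewrite !mxE; ring.
  - move=> y yK; rewrite (_ : \row__ _ = - contraction xi).
      by rewrite (linear_forN (mxdot_scalar y)) contraction_closed ?oppr0.
    apply/rowP=> k; rewrite !mxE -sumrN; apply: eq_bigr => l _.
    by rewrite (delbar_delN tables) [X in - X]mxE opprK.
move/negP: xi_notin; apply; apply/delbar_del_closedP => l.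
by rewrite (delbar_delN tables) xi0 oppr0.
Qed.

End GammaClosed.

Lemma two_engel_steps_contra : False.
Proof.
have [|] := boolP (gamma \in K); [exact: gamma_closed_contra|exact: gamma_not_closed_contra].
Qed.

End TwoEngelSteps.

Theorem all_delbar_del_closed : (n <= 4)%N -> forall z, z \in L.
Proof.
move=> n4; suff -> : L = fullv by move=> z; exact: memvf.
have [K_full|K_neq] := eqVneq K fullv.
  by apply/eqP; rewrite eqEsubv subvf -K_full closed_delbar_del.
have [zeta zeta_notin left_zeta] := engel tables K_neq.
have [_ zeta_L] := left_closed_right_closed left_zeta.
apply/eqP/negPn/negP => L_neq; have [xi xi_notin left_xi] := engel tables L_neq.
apply: (two_engel_steps_contra _ zeta_notin xi_notin left_zeta left_xi).
have dimKL : (\dim K < \dim L)%N.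
  rewrite ltn_neqAle dimvS ?closed_delbar_del // andbT.
  apply: contraNneq zeta_notin => dimKL; suff -> : K = L by [].
  by apply/eqP; rewrite eqEdim closed_delbar_del -dimKL leqnn.
have dimLn : (\dim L < n)%N.
  have dimV : \dim {: 'rV[C]_n} = n by rewrite dimvf /dim /= mul1n.
  rewrite -[ltnRHS]dimV ltn_neqAle dimvS ?subvf // andbT; apply: contra_neq L_neq => dimL.
  by apply/eqP; rewrite eqEdim subvf dimL leqnn.
by rewrite -ltnS -ltnS (leq_trans _ n4) // (leq_ltn_trans dimKL).
Qed.
End Tables.

Section Pairing.
Variables (C : numClosedFieldType) (n : nat) (a b : 'I_n -> 'M[C]_n).
Implicit Types z y : 'rV[C]_n.

Lemma contraction_linear : linear (contraction a b).
Proof.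
move=> x z y; apply/rowP=> k; rewrite !mxE mulr_sumr -big_split; apply: eq_bigr => l _ /=.
by rewrite linearP !mxE.
Qed.

Lemma pairing_scalar y : scalar (fun z => pairing a b z y).
Proof.
move=> x z z'; rewrite /pairing !linearP /= contraction_linear !(mxdotC (contraction a b y)).
by rewrite !conjCK !mxdot_scalar; ring.
Qed.

Lemma pairingC z y : pairing a b z y = (pairing a b y z)^*.
Proof.
rewrite /pairing !rmorphD rmorphN /= !rmorphM /= fmorphV rmorph_nat !conjCK -!mxdotC.
by rewrite [(\tr (delbar_mx b y))^* * _]mulrC addrAC.
Qed.

Lemma pairing_delta_eq0 :
  (forall d e, pairing a b (delta_mx 0 d) (delta_mx 0 e) = 0) -> forall z y, pairing a b z y = 0.
Proof.
move=> delta0; have lin_eq0 y : (forall d, pairing a b (delta_mx 0 d) y = 0) ->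
    forall z, pairing a b z y = 0.
  move=> y0 z; rewrite (row_sum_delta z) (linear_for_sum (pairing_scalar y)) big1 // => d _.
  by rewrite (scalarZ_fun (pairing_scalar y)) y0 mulr0.
by move=> z y; apply: (lin_eq0 y) => d; rewrite pairingC lin_eq0 ?rmorph0.
Qed.

Lemma del_mx_delta k : del_mx a (delta_mx 0 k) = a k.
Proof.
rewrite /del_mx (bigD1 k) //= mxE !eqxx scale1r big1 ?addr0 // => i /negbTE ik.
by rewrite mxE ik scale0r.
Qed.

Lemma delbar_mx_delta k : delbar_mx b (delta_mx 0 k) = b k.
Proof.
rewrite /delbar_mx (bigD1 k) //= mxE !eqxx scale1r big1 ?addr0 // => i /negbTE ik.
by rewrite mxE ik scale0r.
Qed.

End Pairing.

Section PairingCoefficients.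
Variables (C : numClosedFieldType) (a b : 'I_4 -> 'M[C]_4).
Hypothesis delbar_delN : forall l z, delbar_del a b l z = - del_delbar a b l z.

Lemma pairing_coefE d e :
  2 * pairing a b (delta_mx 0 d) (delta_mx 0 e) =
  pairing_coef a (fun k i j => (a k i j)^*) b (fun k i j => (b k i j)^*) d e.
Proof.
have dot_delta (x : 'rV[C]_4) k : mxdot x (delta_mx 0 k) = x 0 k.
  rewrite mxdot_rowE (bigD1 k) //= big1 => [|m mk]; rewrite mxE ?eqxx ?rmorph1 ?mulr1 ?addr0 //=.
  by rewrite (negbTE mk) rmorph0 mulr0.
have contraction_d : contraction a b (delta_mx 0 d) 0 e =
    \sum_l \sum_j (a d e j * b j l l - a d l j * b j e l).
  rewrite mxE; apply: eq_bigr => l _; rewrite mxE !delbar_mxE -sumrB; apply: eq_bigr => j _.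
  by rewrite !mxE !del_mx_delta.
have contraction_e : (contraction a b (delta_mx 0 e) 0 d)^* = - \sum_l \sum_j
    ((b e j l)^* * (a j l d)^* + (b e l j)^* * b j l d - (b e d j)^* * b j l l).
  rewrite mxE rmorph_sum -sumrN; apply: eq_bigr => l _; rewrite delbar_delN mxE rmorphN /=.
  congr (- _); rewrite mxE rmorphB rmorphD /= !conjCK del_mxE !delbar_mxE rmorph_sum.
  rewrite -big_split -sumrB; apply: eq_bigr => j _ /=.
  by rewrite !mxE !delbar_mx_delta rmorphM.
rewrite /pairing !dot_delta contraction_d contraction_e !(del_mx_delta, delbar_mx_delta).
by rewrite /pairing_coef !mxdotE rmorph_sum /mxtrace; field.
Qed.

End PairingCoefficients.

(* The structure tables of a coframe whose forms are closed, except possibly the last. *)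
Section AdaptedTables.
Variables (C : numClosedFieldType) (n : nat) (a b : 'I_n.+1 -> 'M[C]_n.+1).
Hypothesis closed_a : forall k, k != ord_max -> a k = 0.
Hypothesis closed_b : forall k, k != ord_max -> b k = 0.
Local Notation max := (ord_max : 'I_n.+1).
Local Notation K := (closed_forms a b).

Let table_adapted (c : 'I_n.+1 -> 'M[C]_n.+1) (z : 'rV[C]_n.+1) :
  (forall k, k != max -> c k = 0) -> \sum_k z 0 k *: c k = z 0 max *: c max.
Proof.
by move=> c0; rewrite (bigD1 max) //= big1 ?addr0 // => k k_max; rewrite c0 // scaler0.
Qed.

Lemma del_mx_adapted z : del_mx a z = z 0 max *: a max.
Proof. exact: table_adapted. Qed.

Lemma delbar_mx_adapted z : delbar_mx b z = z 0 max *: b max.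
Proof. exact: table_adapted. Qed.

Definition structure_norm : C :=
  2^-1 * mxdot (a max) (a max) + mxdot (b max) (b max) - \tr (b max) * (\tr (b max))^*.

Definition last_free (c : 'M[C]_n.+1) := (forall i, c i max = 0) /\ (forall j, c max j = 0).

Lemma pairing_adapted_eq0 : (forall i, a max i max = 0) -> structure_norm = 0 ->
  forall z y, pairing a b z y = 0.
Proof.
move=> a_last norm0 z y.
have closed x : x \in delbar_del_closed_forms a b.
  apply/delbar_del_closedP => l; apply/matrixP=> i k; rewrite !mxE !delbar_mx_adapted.
  by rewrite !mxE !del_mx_adapted !mxE !a_last !mulr0 !mul0r subrr.
rewrite /pairing !contraction_eq0 // !(linear_for0 (mxdot_scalar _)) rmorph0 !addr0.
rewrite !(del_mx_adapted, delbar_mx_adapted) !mxtraceZ !mxdotZr.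
rewrite !(scalarZ_fun (mxdot_scalar _)) rmorphM /=.
transitivity (z 0 max * (y 0 max)^* * structure_norm); last by rewrite norm0 mulr0.
by rewrite /structure_norm; ring.
Qed.

Hypotheses (n4 : (n < 4)%N) (tables : astheno_kahler_tables a b).

Let closed_last y : y \in K -> (a max = 0 /\ b max = 0) \/ y 0 max = 0.
Proof.
move/closed_formsP; rewrite del_mx_adapted delbar_mx_adapted => -[/eqP + /eqP].
by rewrite !scaler_eq0; have [->|_] := eqVneq (y 0 max) 0; [right|left; split; apply/eqP].
Qed.

Lemma adapted_delbar_last_free : last_free (b max).
Proof.
have [KV|K_neq] := eqVneq K fullv.
  have : delta_mx 0 max \in K by rewrite KV memvf.
  move=> /closed_last[[_ ->]|]; first by split=> ?; rewrite mxE.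
  by rewrite mxE !eqxx => /eqP; rewrite oner_eq0.
have [zeta zeta_notin left_zeta] := engel tables K_neq.
have [right_zeta _] := left_closed_right_closed tables left_zeta.
have not_closed : ~ (a max = 0 /\ b max = 0).
  move=> [a0 b0]; move/negP: zeta_notin; apply; apply/closed_formsP.
  by rewrite del_mx_adapted delbar_mx_adapted a0 b0 !scaler0.
have zeta_max : zeta 0 max != 0.
  apply: contraNneq zeta_notin => zeta0; apply/closed_formsP.
  by rewrite del_mx_adapted delbar_mx_adapted zeta0 !scale0r.
split=> [i|j].
  have [//|/eqP] := closed_last (right_zeta i); rewrite mxE conjC_eq0 delbar_mx_adapted mxE.
  by rewrite mulf_eq0 (negbTE zeta_max) => /eqP.
have [//|/eqP] := closed_last (left_zeta j); rewrite mxE delbar_mx_adapted mxE.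
by rewrite mulf_eq0 (negbTE zeta_max) => /eqP.
Qed.

Let last_delbar_del_closed : delta_mx 0 max \in delbar_del_closed_forms a b.
Proof. exact: all_delbar_del_closed. Qed.

Lemma adapted_del_last i : a max i max = 0.
Proof.
apply/eqP/negPn/negP => ai.
have ab k l : a max i max * b max k l = a max k max * b max i l.
  have /delbar_del_closedP/(_ l)/matrixP/(_ k i) := last_delbar_del_closed.
  rewrite !mxE !delbar_mx_adapted !mxE del_mx_delta => /eqP.
  by rewrite subr_eq0 => /eqP.
suff a0 : a max = 0 by move: ai; rewrite a0 mxE eqxx.
rewrite -del_mx_delta; apply: (rank1_del_eq0 tables (u := \row_k a max k max)
  (v := \row_l (b max i l / a max i max)) last_delbar_del_closed).
apply/matrixP=> k l; rewrite mul_tr_rowE delbar_mx_delta !mxE.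
by apply: (mulfI ai); rewrite ab; field.
Qed.

Lemma structure_norm_adapted : structure_norm = 0.
Proof.
have := delbar_del_closed_norm tables last_delbar_del_closed.
by rewrite !(del_mx_delta, delbar_mx_delta) /structure_norm => ->; rewrite subrr.
Qed.

End AdaptedTables.

(** * Complexification of a Lie algebra *)

Lemma conj_i (R : realType) : Num.conj ('i%C : R[i]) = - 'i%C.
Proof. by apply/eqP; rewrite eq_complex /= oppr0 !eqxx. Qed.

Section RealImaginaryParts.
Local Open Scope complex_scope.
Variables (R : realType) (p q : nat).
Implicit Types (x y : 'M[R]_(p, q)) (z w : 'M[R[i]]_(p, q)).

Definition re_mx z := map_mx (@complex.Re R) z.
Definition im_mx z := map_mx (@complex.Im R) z.

Lemma re_im_mxP z w : re_mx z = re_mx w -> im_mx z = im_mx w -> z = w.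
Proof.
move=> /matrixP re_zw /matrixP im_zw; apply/matrixP => i j.
have := im_zw i j; have := re_zw i j; rewrite !mxE.
by case: (z i j) (w i j) => ? ? [? ?] /= -> ->.
Qed.

Lemma re_mx_rect x y : re_mx (cplx_mx x + 'i *: cplx_mx y) = x.
Proof. by apply/matrixP => i j; rewrite !mxE /=; ring. Qed.

Lemma im_mx_rect x y : im_mx (cplx_mx x + 'i *: cplx_mx y) = y.
Proof. by apply/matrixP => i j; rewrite !mxE /=; ring. Qed.

Lemma cplx_mx_rect z : z = cplx_mx (re_mx z) + 'i *: cplx_mx (im_mx z).
Proof. by apply: re_im_mxP; rewrite ?re_mx_rect ?im_mx_rect. Qed.

Lemma re_mx_cplx x : re_mx (cplx_mx x) = x.
Proof. by apply/matrixP => i j; rewrite !mxE. Qed.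

Lemma im_mx_cplx x : im_mx (cplx_mx x) = 0.
Proof. by apply/matrixP => i j; rewrite !mxE. Qed.

Lemma cplx_mx_inj : injective (@cplx_mx R p q).
Proof. by move=> x y /(congr1 re_mx); rewrite !re_mx_cplx. Qed.

Lemma re_mx_lin a z w :
  re_mx (a *: z + w) = complex.Re a *: re_mx z - complex.Im a *: im_mx z + re_mx w.
Proof.
apply/matrixP => i j; rewrite !mxE.
by case: a => ? ?; case: (z i j) => ? ?; case: (w i j).
Qed.

Lemma im_mx_lin a z w :
  im_mx (a *: z + w) = complex.Re a *: im_mx z + complex.Im a *: re_mx z + im_mx w.
Proof.
apply/matrixP => i j; rewrite !mxE.
by case: a => ? ?; case: (z i j) => ? ?; case: (w i j) => ? ? /=; ring.
Qed.

Lemma re_mxN z : re_mx (- z) = - re_mx z. Proof. exact: map_mxN. Qed.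
Lemma im_mxN z : im_mx (- z) = - im_mx z. Proof. exact: map_mxN. Qed.

Lemma re_mx_conj z : re_mx (z^*m) = re_mx z.
Proof. by apply/matrixP => i j; rewrite !mxE; case: (z i j). Qed.

Lemma im_mx_conj z : im_mx (z^*m) = - im_mx z.
Proof. by apply/matrixP => i j; rewrite !mxE; case: (z i j). Qed.

Lemma conj_mx_cplx x : (cplx_mx x)^*m = cplx_mx x.
Proof.
by apply: re_im_mxP; rewrite ?re_mx_conj // im_mx_conj im_mx_cplx oppr0.
Qed.

Lemma linear_real_eq0 (W : lmodType R[i]) (g : 'M[R[i]]_(p, q) -> W) :
  linear g -> (forall x, g (cplx_mx x) = 0) -> forall z, g z = 0.
Proof.
move=> g_linear g_real z.
by rewrite (cplx_mx_rect z) addrC g_linear !g_real scaler0 addr0.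
Qed.

End RealImaginaryParts.

Section Nijenhuis.
Variables (K : comNzRingType) (n : nat) (B : 'rV[K]_n -> 'rV[K]_n -> 'rV[K]_n).
Hypothesis B_bilinear : bilinear_map B.
Variable M : 'M[K]_n.

Definition nijenhuis_mx x y :=
  B x y + B (x *m M) y *m M + B x (y *m M) *m M - B (x *m M) (y *m M).

Lemma nijenhuis_mx_linear y : linear (nijenhuis_mx^~ y).
Proof.
have collect a (p q r s p' q' r' s' : 'rV[K]_n) :
    (a *: p + p') + (a *: q + q') + (a *: r + r') - (a *: s + s') =
    a *: (p + q + r - s) + (p' + q' + r' - s').
  by apply/rowP=> k; rewrite !mxE; ring.
move=> a x x'; rewrite /nijenhuis_mx mulmxDl -scalemxAl !B_bilinear.1 !mulmxDl -!scalemxAl.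
exact: collect.
Qed.

Lemma nijenhuis_mxC x y : (forall u v, B u v = - B v u) ->
  nijenhuis_mx x y = - nijenhuis_mx y x.
Proof.
move=> skew; rewrite /nijenhuis_mx (skew x y) (skew (x *m M) y) (skew x (y *m M)).
by rewrite (skew (x *m M)) !mulNmx !opprD !opprK -!addrA; congr (_ + _); rewrite addrCA.
Qed.

Lemma nijenhuis_mx_eigen i x y : i * i = -1 -> x *m M = i *: x -> y *m M = i *: y ->
  nijenhuis_mx x y = 2 *: (B x y + i *: (B x y *m M)).
Proof.
move=> ii xM yM; rewrite /nijenhuis_mx xM yM !(bilinearZl B_bilinear) !(bilinearZr B_bilinear).
rewrite -!scalemxAl scalerA ii scaleN1r opprK.
by rewrite -addrA [_ *: _ + B x y]addrC scaler_nat mulr2n.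
Qed.

End Nijenhuis.

Section Complexification.
Variables (R : realType) (m : nat) (br : 'rV[R]_m -> 'rV[R]_m -> 'rV[R]_m).
Hypothesis br_lie : is_lie_bracket br.
Local Notation V := 'rV[R[i]]_m.
Implicit Types (u v w z : V).

Let br_bilinear : bilinear_map br.
Proof.
by split=> ? ? ? ?; [exact: (lie_linearl br_lie)|exact: (lie_linearr br_lie)].
Qed.

Let br_skew := alternating_bilinear_skew br_bilinear (lie_alternating br_lie).

(* [B] is [cplx_bracket br]; it is abstract because unfolding it is costly. *)
Variable B : V -> V -> V.
Hypothesis re_bracket : forall u v,
  re_mx (B u v) = br (re_mx u) (re_mx v) - br (im_mx u) (im_mx v).
Hypothesis im_bracket : forall u v,
  im_mx (B u v) = br (re_mx u) (im_mx v) + br (im_mx u) (re_mx v).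

Lemma bracket_real x y : B (cplx_mx x) (cplx_mx y) = cplx_mx (br x y).
Proof.
by apply: re_im_mxP; rewrite ?re_bracket ?im_bracket !re_mx_cplx !im_mx_cplx
  ?(bilinear0l br_bilinear) ?(bilinear0r br_bilinear) ?subr0 ?addr0.
Qed.

Lemma bracket_skew u v : B u v = - B v u.
Proof.
apply: re_im_mxP.
  rewrite re_mxN !re_bracket (br_skew (re_mx u)) (br_skew (im_mx u)).
  by rewrite opprB opprK addrC.
rewrite im_mxN !im_bracket (br_skew (re_mx u)) (br_skew (im_mx u)).
by rewrite opprD addrC.
Qed.

Lemma bracket_alt u : B u u = 0.
Proof.
apply: re_im_mxP; rewrite ?re_bracket ?im_bracket.
  by rewrite !(lie_alternating br_lie) subr0; apply/rowP=> j; rewrite !mxE.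
by rewrite (br_skew (im_mx u)) subrr; apply/rowP=> j; rewrite !mxE.
Qed.

Lemma bilinear_bracket : bilinear_map B.
Proof.
have linear_l w : linear (B^~ w).
  move=> a u v; apply: re_im_mxP.
    rewrite re_mx_lin !(re_bracket, im_bracket) re_mx_lin im_mx_lin.
    rewrite !(bilinearDl br_bilinear, bilinearNl br_bilinear, bilinearZl br_bilinear).
    by apply/rowP=> j; rewrite !mxE; ring.
  rewrite im_mx_lin !(re_bracket, im_bracket) re_mx_lin im_mx_lin.
  rewrite !(bilinearDl br_bilinear, bilinearNl br_bilinear, bilinearZl br_bilinear).
  by apply/rowP=> j; rewrite !mxE; ring.
split; [exact: linear_l|move=> w a u v].
by rewrite bracket_skew linear_l opprD -scalerN -!(bracket_skew w).
Qed.

Lemma bracket_conj u v : B (u^*m) (v^*m) = (B u v)^*m.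
Proof.
apply: re_im_mxP; rewrite ?re_mx_conj ?im_mx_conj !(re_bracket, im_bracket).
  by rewrite !re_mx_conj !im_mx_conj (bilinearNl br_bilinear) (bilinearNr br_bilinear) opprK.
by rewrite !re_mx_conj !im_mx_conj (bilinearNl br_bilinear) (bilinearNr br_bilinear) opprD.
Qed.

Lemma bracket_jacobi u v w : B u (B v w) + B v (B w u) + B w (B u v) = 0.
Proof.
pose jac x y z := B x (B y z) + B y (B z x) + B z (B x y).
have jac_linear y z : linear (fun x => jac x y z).
  move=> a x x'; rewrite /jac !(bilinear_bracket.1, bilinear_bracket.2).
  by rewrite !scalerDr; apply/rowP=> k; rewrite !mxE; ring.
have jacC x y z : jac x y z = jac y z x by rewrite /jac -addrA addrC.
apply: (linear_real_eq0 (jac_linear v w)) => x.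
rewrite jacC; apply: (linear_real_eq0 (jac_linear w (cplx_mx x))) => y.
rewrite jacC; apply: (linear_real_eq0 (jac_linear (cplx_mx x) (cplx_mx y))) => z.
by rewrite /jac !bracket_real -!map_mxD (lie_jacobi br_lie) map_mx0.
Qed.

Lemma bracketA u v w : B (B u v) w = B u (B v w) - B v (B u w).
Proof.
have := bracket_jacobi u v w; rewrite (bracket_skew w u) (bracket_skew w (B u v)).
by rewrite (bilinearNr bilinear_bracket) => /eqP; rewrite subr_eq0 => /eqP.
Qed.

Lemma lower_centralB k x y :
  lower_central br k x -> lower_central br k y -> lower_central br k (x - y).
Proof. by case: k => [//|k] xk yk U brU; rewrite rpredB ?xk ?yk. Qed.

Lemma lower_centralN k x : lower_central br k x -> lower_central br k (- x).
Proof. by case: k => [//|k] xk U brU; rewrite rpredN xk. Qed.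

Lemma lower_central_br k x y : lower_central br k y -> lower_central br k.+1 (br x y).
Proof. by move=> yk U brU; rewrite br_skew rpredN brU. Qed.

Lemma bracket_nilpotent : is_nilpotent br ->
  exists N, forall s z, size s = N -> foldr B z s = 0.
Proof.
move=> [N brN]; exists N => s z size_s.
have [] : lower_central br (size s) (re_mx (foldr B z s)) /\
    lower_central br (size s) (im_mx (foldr B z s)).
  elim: s {size_s} => [//|u s [IHre IHim]].
  rewrite [size _]/= [foldr _ _ _]/= re_bracket im_bracket; split.
    by apply: lower_centralB; exact: lower_central_br.
  rewrite -[X in _ + X]opprK; apply: lower_centralB; first exact: lower_central_br.
  exact/lower_centralN/lower_central_br.
rewrite size_s => /brN re0 /brN im0.
by apply: re_im_mxP; rewrite ?re0 ?im0; apply/rowP=> j; rewrite !mxE.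
Qed.

Variable J : 'M[R]_m.
Hypothesis J_complex : is_complex_structure br J.

Lemma proj01_conj z : proj01 J (z^*m) = (proj10 J z)^*m.
Proof.
rewrite /proj10 /proj01 map_mxZ map_mxB map_mxZ map_mxM conj_mx_cplx.
by rewrite fmorphV rmorph_nat /= conj_i scaleNr opprK.
Qed.

Lemma proj10_conj z : proj10 J (z^*m) = (proj01 J z)^*m.
Proof. by rewrite -{2}[z]conj_mxK proj01_conj conj_mxK. Qed.

Lemma nijenhuis_bracket_eq0 u v : nijenhuis_mx B (cplx_mx J) u v = 0.
Proof.
have nij_linear := nijenhuis_mx_linear bilinear_bracket (cplx_mx J).
apply: (linear_real_eq0 (nij_linear v)) => x.
rewrite (nijenhuis_mxC _ _ _ bracket_skew); apply/eqP; rewrite oppr_eq0; apply/eqP.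
apply: (linear_real_eq0 (nij_linear (cplx_mx x))) => y.
rewrite /nijenhuis_mx -!map_mxM !bracket_real -!map_mxM -!map_mxD -map_mxN -map_mxD.
by have := J_complex.2 y x; rewrite /nijenhuis => ->; rewrite map_mx0.
Qed.

Lemma bracket10_proj01 u v : proj01 J (B (proj10 J u) (proj10 J v)) = 0.
Proof.
have := nijenhuis_bracket_eq0 (proj10 J u) (proj10 J v).
rewrite (nijenhuis_mx_eigen bilinear_bracket (mulii R));
  [|exact: proj10_cplx_mx J_complex.1 _|exact: proj10_cplx_mx J_complex.1 _].
by move/eqP; rewrite scaler_eq0 pnatr_eq0 /= /proj01 => /eqP ->; rewrite scaler0.
Qed.

Lemma bracket01_proj10 u v : proj10 J (B (proj01 J u) (proj01 J v)) = 0.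
Proof.
rewrite -[u]conj_mxK -[v]conj_mxK !proj01_conj bracket_conj proj10_conj.
by rewrite bracket10_proj01 map_mx0.
Qed.

End Complexification.

(** * Unitary frames *)

Section UnitaryMatrices.
Variable C : numClosedFieldType.
Local Open Scope sesquilinear_scope.

Lemma conj_mul_tr m n p (A : 'M[C]_(m, n)) (B : 'M[C]_(n, p)) : (A *m B) ^t* = B ^t* *m A ^t*.
Proof. by rewrite trmx_mul map_mxM. Qed.

Lemma unitary_rows_annihilate n (t : 'cV[C]_n.+1) : exists2 U : 'M[C]_n.+1,
  U \is unitarymx & forall k, k != ord_max -> row k U *m t = 0.
Proof.
pose A : 'M[C]_n.+1 := \matrix_(i < n.+1) t ^t*; pose S := schmidt A.
have /row_unitarymxP S_unitary : S \is unitarymx by exact: schmidt_unitarymx.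
have /sub_rVP[x tE] : (t ^t* <= row 0 S)%MS.
  have := row_schmidt_sub A 0; rewrite rowK (big_pred1 0) ?genmxE // => k /=.
  by rewrite leqn0 -val_eqE.
have row_swap k : row k (row_perm (tperm 0 ord_max) S) = row (tperm 0 ord_max k) S.
  by apply/rowP=> j; rewrite !mxE.
exists (row_perm (tperm 0 ord_max) S).
  by apply/row_unitarymxP => i j; rewrite !row_swap S_unitary (inj_eq perm_inj).
move=> k k_max; have t_eq : t = x^* *: (row 0 S) ^t*.
  by rewrite -[LHS]trmxCK tE linearZ /= map_mxZ.
have swap_neq : (tperm 0 ord_max k == 0) = false.
  by rewrite -(inj_eq (@perm_inj _ (tperm 0 ord_max))) tpermK tpermL (negbTE k_max).
apply/matrixP=> i j; rewrite !ord1 [RHS]mxE t_eq -scalemxAr mxE row_swap.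
by rewrite -dotmxE S_unitary swap_neq mulr0.
Qed.

Lemma positive_gram_normalization n (G : 'M[C]_n) : G ^t* = G ->
  (forall x : 'rV_n, x != 0 -> 0 < (x *m G *m x ^t*) 0 0) ->
  exists2 P, P \in unitmx & P *m G *m P ^t* = 1%:M.
Proof.
move=> G_herm G_pos; have /orthomx_spectralP : G \is normalmx.
  by apply/normalmxP; rewrite G_herm.
set Q := spectralmx G; set d := spectral_diag G; have Q_unitary := spectral_unitarymx G.
rewrite invmx_unitary // => GE; have QQ : Q *m Q ^t* = 1%:M by exact/unitarymxP.
have QG : Q *m G *m Q ^t* = diag_mx d.
  by rewrite GE !mulmxA QQ mul1mx -mulmxA QQ mulmx1.
have d_gt0 i : 0 < d 0 i.
  have Qi_neq0 : row i Q != 0.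
    apply/eqP => Qi0; have /rowP/(_ i) := congr1 (row i) QQ; rewrite row_mul Qi0 mul0mx.
    by rewrite !mxE eqxx => /eqP; rewrite eq_sym oner_eq0.
  have -> : d 0 i = diag_mx d i i by rewrite mxE eqxx mulr1n.
  have := G_pos _ Qi_neq0; rewrite -QG -row_mul; congr (0 < _).
  by rewrite !mxE; apply: eq_bigr => j _; rewrite !mxE.
pose s : 'rV[C]_n := \row_i (sqrtC (d 0 i))^-1.
have s_neq0 i : sqrtC (d 0 i) != 0 by rewrite sqrtC_eq0 gt_eqF.
have s_real : s^*m = s.
  by apply/rowP=> i; rewrite !mxE; apply: CrealP; rewrite rpredV ger0_real // sqrtC_ge0 ltW.
exists (diag_mx s *m Q).
  rewrite unitmx_mul (unitarymx_unit Q_unitary) andbT unitmxE det_diag unitfE.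
  by apply/prodf_neq0 => i _; rewrite mxE invr_eq0.
rewrite conj_mul_tr tr_diag_mx map_diag_mx s_real -!mulmxA (mulmxA G) (mulmxA Q) (mulmxA Q) QG.
rewrite mulmxA !mulmx_diag; apply/matrixP=> i j; rewrite !mxE; case: eqP => //= _.
rewrite mulr1n -{2}[d 0 i]sqrtCK; have := s_neq0 i; set q := sqrtC _ => q_neq0.
by field.
Qed.

End UnitaryMatrices.

(* The rows of [E] are a basis of the (1,0)-vectors, and the columns of [W] the dual
   basis of (1,0)-forms. *)
Definition is_frame (C : numClosedFieldType) n r (pr : bool -> 'rV[C]_n -> 'rV[C]_n)
    (E : 'M[C]_(r, n)) (W : 'M[C]_(n, r)) :=
  (forall v, pr true v = v *m W *m E) /\ E *m W = 1%:M.

Section SplittingFrames.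
Variables (C : numClosedFieldType) (n r : nat) (pr : bool -> 'rV[C]_n -> 'rV[C]_n).
Hypothesis pr_splitting : is_splitting pr.
Hypothesis pr_conj : forall t z, pr t (z^*m) = (pr (~~ t) z)^*m.
Local Open Scope sesquilinear_scope.

Lemma frame_exists (P : 'M[C]_n) : (forall z, pr true z = z *m P) -> n = r.*2 ->
  exists (E : 'M[C]_(r, n)) W, is_frame pr E W.
Proof.
move=> PE nr; have conjP : P^*m = 1%:M - P.
  apply/row_matrixP=> i; rewrite !rowE mulmxBr mulmx1 -PE.
  have e_real : (delta_mx 0 i)^*m = delta_mx 0 i :> 'rV[C]_n by exact: map_delta_mx.
  transitivity (pr false (delta_mx 0 i)); first by rewrite -{2}e_real pr_conj /= PE map_mxM e_real.
  by apply: (canRL (addrK _)); rewrite addrC; exact: (splitting_sum pr_splitting).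
have PP : P *m P = P.
  apply/row_matrixP=> i; rewrite !rowE mulmxA -!PE.
  exact: (splitting_idem pr_splitting).
have rankP : \rank P = r.
  have rank_compl : \rank (1%:M - P) = \rank P by rewrite -conjP mxrank_map.
  have : (\rank P + \rank (1%:M - P)%R <= n)%N.
    by apply: mulmx0_rank_max; rewrite mulmxBr mulmx1 PP subrr.
  have := mxrank_add P (1%:M - P); rewrite addrC subrK mxrank1 rank_compl; lia.
rewrite -rankP; exists (row_base P), (col_base P); split=> [v|].
  by rewrite PE -mulmxA mulmx_base.
apply: (row_free_inj (row_base_free P)); apply: (row_full_inj (col_base_full P)).
by rewrite mul1mx -(mulmxA (row_base P)) mulmx_base mulmxA mulmx_base.
Qed.

Section FrameChange.
Variables (E : 'M[C]_(r, n)) (W : 'M[C]_(n, r)).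
Hypothesis EW_frame : is_frame pr E W.
Local Notation e i := (row i E).
Local Notation eb i := ((row i E)^*m).

Lemma pr10_e i : pr true (e i) = e i.
Proof. by rewrite EW_frame.1 -!row_mul EW_frame.2 mul1mx. Qed.

Lemma pr01_eb i : pr false (eb i) = eb i.
Proof. by rewrite pr_conj pr10_e. Qed.

Lemma pr10_frame v : pr true v = \sum_k (v *m W) 0 k *: e k.
Proof. by rewrite EW_frame.1 mulmx_sum_row. Qed.

Lemma pr01_frame v : pr false v = \sum_k ((v^*m *m W) 0 k)^* *: eb k.
Proof.
rewrite -{1}[v]conj_mxK pr_conj pr10_frame raddf_sum; apply: eq_bigr => k _ /=.
by rewrite map_mxZ.
Qed.

Lemma mul_pr10_W v : pr true v *m W = v *m W.
Proof. by rewrite EW_frame.1 -mulmxA EW_frame.2 mulmx1. Qed.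

Lemma mul_pr01_W v : pr false v *m W = 0.
Proof.
apply: (addrI (pr true v *m W)).
by rewrite -mulmxDl (splitting_sum pr_splitting) addr0 mul_pr10_W.
Qed.

Lemma frame_change (P Q : 'M[C]_r) : Q *m P = 1%:M -> is_frame pr (P *m E) (W *m Q).
Proof.
move=> QP; split=> [v|].
  by rewrite EW_frame.1 !mulmxA -(mulmxA _ Q) QP mulmx1.
by rewrite mulmxA -(mulmxA P) EW_frame.2 mulmx1 (mulmx1C QP).
Qed.

End FrameChange.

Definition is_hermitian_gram (J H : 'M[C]_n) :=
  [/\ H^T = H, J *m H *m J^T = H &
      forall u : 'rV_n, u != 0 -> 0 < (u *m H *m u ^t*) 0 0].

Definition unitary_for (H : 'M[C]_n) (E : 'M[C]_(r, n)) := E *m H *m E ^t* = 1%:M.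

Lemma unitary_frame_exists J H (P : 'M[C]_n) : (forall z, pr true z = z *m P) -> n = r.*2 ->
  H^*m = H -> is_hermitian_gram J H -> exists E W, is_frame pr E W /\ unitary_for H E.
Proof.
move=> PE nr H_real [H_sym _ H_pos]; have [E [W EW_frame]] := frame_exists PE nr.
have [||Q Q_unit QG] := @positive_gram_normalization C r (E *m H *m E ^t*).
- by rewrite !conj_mul_tr trmxCK H_sym H_real mulmxA.
- move=> x x_neq0; have := H_pos (x *m E); rewrite conj_mul_tr !mulmxA; apply.
  by apply: contra_neq x_neq0 => xE; rewrite -[x]mulmx1 -EW_frame.2 mulmxA xE mul0mx.
exists (Q *m E), (W *m invmx Q); split; first by apply: frame_change; rewrite ?mulVmx.
by rewrite /unitary_for -[RHS]QG conj_mul_tr !mulmxA.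
Qed.

Lemma unitary_frame_change H E W U : is_frame pr E W -> unitary_for H E -> U \is unitarymx ->
  is_frame pr (U^*m *m E) (W *m U^T) /\ unitary_for H (U^*m *m E).
Proof.
move=> EW_frame E_unitary U_unitary.
have conjU_unitary : U^*m *m (U^*m) ^t* = 1%:M.
  by apply/unitarymxP; rewrite conjC_unitary.
have conjU_tr : (U^*m) ^t* = U^T by apply/matrixP=> i j; rewrite !mxE conjCK.
split; last first.
  by rewrite /unitary_for conj_mul_tr -!mulmxA (mulmxA H) (mulmxA E) (mulmxA E) E_unitary mul1mx.
by apply: (frame_change EW_frame); rewrite -conjU_tr; exact: mulmx1C.
Qed.

End SplittingFrames.

Section HermitianForm.
Variables (C : numClosedFieldType) (n r : nat) (pr : bool -> 'rV[C]_n -> 'rV[C]_n).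
Hypothesis pr_splitting : is_splitting pr.
Hypothesis pr_conj : forall t z, pr t (z^*m) = (pr (~~ t) z)^*m.
Variables (J : 'M[C]_n) (I : C).
Hypotheses (J_sqr : J *m J = - 1%:M) (J_real : J^*m = J) (I_sqr : I * I = -1) (conj_I : I^* = - I).
Hypothesis pr10_J : forall z, pr true z *m J = I *: pr true z.
Local Open Scope sesquilinear_scope.

Definition hform (H : 'M[C]_n) (u v : 'rV[C]_n) : C := (u *m J *m H *m v^T) 0 0.

Lemma pr01_J z : pr false z *m J = - I *: pr false z.
Proof.
rewrite -[z]conj_mxK pr_conj /= -{1}J_real -map_mxM pr10_J map_mxZ.
by congr (_ *: _); exact: conj_I.
Qed.

Lemma hform_scalar H v : scalar (fun u => hform H u v).
Proof. by move=> x u w; rewrite /hform !mulmxDl -!scalemxAl !mxE. Qed.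

Section HermitianGram.
Variable H : 'M[C]_n.
Hypothesis H_gram : is_hermitian_gram J H.
Local Notation F := (hform H).

Let H_J : H *m J^T = - (J *m H).
Proof.
have [_ JHJ _] := H_gram.
by rewrite -[in RHS]JHJ !mulmxA J_sqr mulNmx mul1mx mulNmx opprK.
Qed.

Lemma hform_skew u v : F u v = - F v u.
Proof.
have [H_sym _ _] := H_gram.
have -> : F u v = ((u *m J *m H *m v^T)^T) 0 0 by rewrite [RHS]mxE.
rewrite !trmx_mul trmxK H_sym /hform (mulmxA H) H_J.
by rewrite mulNmx mulmxN !mulmxA mxE.
Qed.

Lemma hform_mulJ u v : F (u *m J) (v *m J) = F u v.
Proof.
rewrite /hform trmx_mul -(mulmxA u J J) J_sqr mulmxN mulmx1 !mulNmx -(mulmxA u H).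
by rewrite (mulmxA H) H_J mulNmx mulmxN opprK !mulmxA.
Qed.

Lemma hform_type t u v : F (pr t u) (pr t v) = 0.
Proof.
have hformZ x y w z : F (x *: w) (y *: z) = x * y * F w z.
  by rewrite /hform linearZ /= -!scalemxAl -scalemxAr !mxE mulrA.
have opp_eq0 (x : C) : x = - x -> x = 0.
  by move=> /eqP; rewrite -addr_eq0 -mulr2n mulrn_eq0 => /eqP.
apply: opp_eq0; rewrite -{1}hform_mulJ.
by case: t; rewrite ?pr10_J ?pr01_J hformZ ?mulrNN I_sqr mulN1r.
Qed.

Lemma hform_unitary_frame (E : 'M[C]_(r, n)) W i j : is_frame pr E W -> unitary_for H E ->
  F (row i E) ((row j E)^*m) = I * (i == j)%:R.
Proof.
move=> EW_frame E_unitary; rewrite /hform -{1}(pr10_e EW_frame) pr10_J (pr10_e EW_frame).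
rewrite -!scalemxAl mxE; congr (_ * _).
have /matrixP/(_ i j) := E_unitary; rewrite [RHS]mxE => <-.
by rewrite -!row_mul !mxE; apply: eq_bigr => k _; rewrite !mxE.
Qed.

End HermitianGram.

Definition frame_gram (W : 'M[C]_(n, r)) := W *m W ^t* + W^*m *m (W^*m) ^t*.

Section FrameGram.
Variables (E : 'M[C]_(r, n)) (W : 'M[C]_(n, r)).
Hypothesis EW_frame : is_frame pr E W.

Lemma frame_gram_conj : (frame_gram W)^*m = frame_gram W.
Proof.
rewrite /frame_gram map_mxD !conj_mxM addrC.
by congr (_ + _); congr (_ *m _); apply/matrixP=> i j; rewrite !mxE ?conjCK.
Qed.

Lemma J_mul_W : J *m W = I *: W.
Proof.
apply/row_matrixP=> i; rewrite row_mul rowE [RHS]rowE.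
set u := delta_mx 0 i; rewrite -[X in X *m J](splitting_sum pr_splitting) mulmxDl.
rewrite pr10_J pr01_J mulmxDl -!scalemxAl (mul_pr10_W EW_frame).
by rewrite (mul_pr01_W pr_splitting EW_frame) scaler0 addr0 -scalemxAr.
Qed.

Lemma frame_gram_sym : (frame_gram W)^T = frame_gram W.
Proof.
rewrite -[RHS]frame_gram_conj /frame_gram linearD /= map_mxD !trmx_mul !conj_mxM.
by congr (_ + _); congr (_ *m _); apply/matrixP=> i j; rewrite !mxE ?conjCK.
Qed.

Lemma frame_gram_J : J *m frame_gram W *m J^T = frame_gram W.
Proof.
have J_conjT : J^T = J ^t* by apply/matrixP=> i j; rewrite -{1}J_real !mxE.
have gram_eigen x (A : 'M[C]_(n, r)) : x * x^* = 1 -> J *m A = x *: A ->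
    J *m (A *m A ^t*) *m J^T = A *m A ^t*.
  move=> x_unit JA; rewrite J_conjT mulmxA -mulmxA -conj_mul_tr JA linearZ /= map_mxZ.
  by rewrite -scalemxAl -scalemxAr scalerA x_unit scale1r.
have I_unit : I * I^* = 1 by rewrite conj_I mulrN I_sqr opprK.
rewrite /frame_gram mulmxDr mulmxDl (gram_eigen I) ?J_mul_W // (gram_eigen (I^*)) //.
  by rewrite conjCK mulrC.
by rewrite -{1}J_real -map_mxM J_mul_W map_mxZ.
Qed.

Lemma frame_gram_pos (u : 'rV[C]_n) : u != 0 -> 0 < (u *m frame_gram W *m u ^t*) 0 0.
Proof.
move=> u_neq0.
have gram_dot (A : 'M[C]_(n, r)) :
    (u *m (A *m A ^t*) *m u ^t*) 0 0 = dotmx (u *m A) (u *m A).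
  by rewrite dotmxE conj_mul_tr !mulmxA.
have -> : (u *m frame_gram W *m u ^t*) 0 0 =
    dotmx (u *m W) (u *m W) + dotmx (u *m W^*m) (u *m W^*m).
  by rewrite /frame_gram mulmxDr mulmxDl mxE !gram_dot.
have [uW0|uW_neq0] := eqVneq (u *m W) 0; last first.
  by rewrite ltr_pwDl ?dotmx_is_dotmx ?dnorm_ge0.
rewrite ltr_wpDl ?dnorm_ge0 // dotmx_is_dotmx //; apply: contra_neq u_neq0 => uW.
rewrite -[u](splitting_sum pr_splitting) EW_frame.1 uW0 mul0mx add0r.
have conj_uW : u^*m *m W = 0 by rewrite -[LHS]conj_mxK conj_mxM conj_mxK uW map_mx0.
by rewrite -[u]conj_mxK pr_conj EW_frame.1 conj_uW mul0mx map_mx0.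
Qed.

Lemma frame_gram_hermitian : is_hermitian_gram J (frame_gram W).
Proof. by split; [exact: frame_gram_sym|exact: frame_gram_J|exact: frame_gram_pos]. Qed.

Lemma frame_gram_unitary : unitary_for (frame_gram W) E.
Proof.
have E_conjW : E *m W^*m = 0.
  apply/row_matrixP=> i; rewrite row_mul row0 -[row i E]conj_mxK -map_mxM.
  rewrite -(pr01_eb pr_conj EW_frame) (mul_pr01_W pr_splitting EW_frame).
  by rewrite map_mx0.
rewrite /unitary_for /frame_gram mulmxDr mulmxDl !mulmxA E_conjW !mul0mx addr0.
by rewrite -mulmxA -conj_mul_tr EW_frame.2 mul1mx trmx1 map_mx1.
Qed.

End FrameGram.

End HermitianForm.

(** * Structure tables of a frame *)

(* The complexification of a nilpotent Lie algebra, split by an integrable complex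
   structure. *)
Record nilpotent_complex_structure (C : numClosedFieldType) (n : nat)
    (B : 'rV[C]_n -> 'rV[C]_n -> 'rV[C]_n) (pr : bool -> 'rV[C]_n -> 'rV[C]_n) : Prop :=
  NilpotentComplexStructure {
  ncs_bilinear : bilinear_map B;
  ncs_alt : forall u, B u u = 0;
  ncs_jacobi : forall u v w, B (B u v) w = B u (B v w) - B v (B u w);
  ncs_conj : forall u v, B (u^*m) (v^*m) = (B u v)^*m;
  ncs_nilpotent : exists N, forall s z, size s = N -> foldr B z s = 0;
  ncs_splitting : is_splitting pr;
  ncs_pr_conj : forall t z, pr t (z^*m) = (pr (~~ t) z)^*m;
  ncs_integrable : forall t u v, pr (~~ t) (B (pr t u) (pr t v)) = 0
}.

Lemma nilpotent_mx_trace (C : numClosedFieldType) n (A : 'M[C]_n) N :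
  (forall z : 'rV_n, iter N (mulmxr A) z = 0) -> \tr A = 0.
Proof.
case: n A => [|n] A AN; first by rewrite /mxtrace big_ord0.
have AX : A ^+ N = 0.
  apply/row_matrixP=> i; rewrite row0 rowE -[RHS](AN (delta_mx 0 i)).
  elim: N {AN} (delta_mx 0 i : 'rV_n.+1) => [|N IHN] z; first by rewrite expr0 mulmx1.
  by rewrite exprSr mulmxA IHN.
have [r char_r] := closed_field_poly_normal (char_poly A).
rewrite (monicP (char_poly_monic A)) scale1r in char_r.
have r0 z : z \in r -> z = 0.
  move=> zr; have : root (char_poly A) z by rewrite char_r root_prod_XsubC.
  rewrite -eigenvalue_root_char => /eigenvalueP[v vA v0].
  have vX q : v *m A ^+ q = z ^+ q *: v.
    elim: q => [|q IHq]; first by rewrite !expr0 scale1r mulmx1.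
    by rewrite !exprSr mulmxA IHq -scalemxAl vA scalerA.
  have /eqP := vX N; rewrite AX mulmx0 eq_sym scaler_eq0 (negbTE v0) orbF.
  by rewrite expf_eq0 => /andP[_ /eqP].
have char_X : char_poly A = 'X^(size r).
  rewrite char_r; elim: (r) r0 => [|z s IHs] s0; first by rewrite big_nil.
  rewrite big_cons IHs => [|y ys]; last by apply: s0; rewrite inE ys orbT.
  by rewrite (s0 z (mem_head _ _)) polyC0 subr0 /= exprS.
have := char_poly_trace A (ltn0Sn n).
have : size (char_poly A) = n.+2 by rewrite size_char_poly.
rewrite char_X size_polyXn => -[->] /=; rewrite coefXn ltn_eqF //= => /eqP.
by rewrite eq_sym oppr_eq0 => /eqP.
Qed.

Lemma sum_off_diagonal (V : nmodType) n (F : 'I_n -> 'I_n -> V) : (forall i, F i i = 0) ->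
  \sum_i \sum_j F i j = \sum_(i < n) \sum_(j < n | (i < j)%N) (F i j + F j i).
Proof.
move=> F_diag; have F_split i : \sum_j F i j =
    \sum_(j < n | (i < j)%N) F i j + \sum_(j < n | (j < i)%N) F i j.
  rewrite (bigID (fun j : 'I_n => (i < j)%N)) /=; congr (_ + _).
  rewrite (bigD1 i) ?ltnn //= F_diag add0r; apply: eq_bigl => j.
  by rewrite -leqNgt ltn_neqAle andbC.
rewrite (eq_bigr _ (fun i _ => F_split i)) big_split /=.
have -> : \sum_(i < n) \sum_(j < n | (j < i)%N) F i j =
    \sum_(i < n) \sum_(j < n | (i < j)%N) F j i by rewrite (exchange_big_dep predT).
by rewrite -big_split; apply: eq_bigr => i _; rewrite -big_split.
Qed.

Section Frame.
Variables (C : numClosedFieldType) (n r : nat).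
Local Notation V := 'rV[C]_n.
Variables (B : V -> V -> V) (pr : bool -> V -> V).
Hypothesis B_pr : nilpotent_complex_structure B pr.
Implicit Types (u v : V) (z : 'rV[C]_r).

Definition frame_a (E : 'M[C]_(r, n)) (W : 'M[C]_(n, r)) k : 'M[C]_r :=
  \matrix_(i, j) - (B (row i E) (row j E) *m W) 0 k.
Definition frame_b (E : 'M[C]_(r, n)) (W : 'M[C]_(n, r)) k : 'M[C]_r :=
  \matrix_(i, j) - (B (row i E) (row j E)^*m *m W) 0 k.

Variables (E : 'M[C]_(r, n)) (W : 'M[C]_(n, r)).
Hypothesis EW_frame : is_frame pr E W.
Local Notation e i := (row i E).
Local Notation eb i := ((row i E)^*m).
Local Notation a := (frame_a E W).
Local Notation b := (frame_b E W).

Lemma frame_aE k i j : a k i j = - (B (e i) (e j) *m W) 0 k. Proof. by rewrite mxE. Qed.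
Lemma frame_bE k i j : b k i j = - (B (e i) (eb j) *m W) 0 k. Proof. by rewrite mxE. Qed.

Let B_bilinear := ncs_bilinear B_pr.
Let B_skew := alternating_bilinear_skew B_bilinear (ncs_alt B_pr).
Let Dl := bilinearDl B_bilinear.
Let Dr := bilinearDr B_bilinear.
Let Zl := bilinearZl B_bilinear.
Let Zr := bilinearZr B_bilinear.
Let suml := bilinear_suml B_bilinear.
Let sumr := bilinear_sumr B_bilinear.
Let pr_splitting := ncs_splitting B_pr.
Let pr_sum := splitting_sum pr_splitting.
Let pr_conj := ncs_pr_conj B_pr.

Lemma bracket_e_e i j : B (e i) (e j) = \sum_k - a k i j *: e k.
Proof.
rewrite -[LHS]pr_sum -{2}(pr10_e EW_frame i) -{2}(pr10_e EW_frame j).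
rewrite (ncs_integrable B_pr true) addr0 (pr10_frame EW_frame).
by apply: eq_bigr => k _; rewrite frame_aE opprK.
Qed.

Lemma bracket_eb_eb i j : B (eb i) (eb j) = \sum_k - (a k i j)^* *: eb k.
Proof.
rewrite (ncs_conj B_pr) bracket_e_e raddf_sum; apply: eq_bigr => k _ /=.
by rewrite map_mxZ rmorphN.
Qed.

Lemma pr10_bracket_e_eb i j : pr true (B (e i) (eb j)) = \sum_k - b k i j *: e k.
Proof. by rewrite (pr10_frame EW_frame); apply: eq_bigr => k _; rewrite frame_bE opprK. Qed.

Lemma pr01_bracket_e_eb i j : pr false (B (e i) (eb j)) = \sum_k (b k j i)^* *: eb k.
Proof.
rewrite (pr01_frame pr_conj EW_frame); apply: eq_bigr => k _.
by rewrite frame_bE -(ncs_conj B_pr) conj_mxK B_skew mulNmx mxE.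
Qed.

Lemma frame_a_skew k i j : a k i j = - a k j i.
Proof. by rewrite !frame_aE B_skew mulNmx mxE opprK. Qed.

(* The value at [v] of the (1,0)-form of coordinates [z]. *)
Definition form_at z v : C := (v *m W *m z^T) 0 0.

Lemma form_at_scalar z : scalar (form_at z).
Proof. by move=> x u v; rewrite /form_at !mulmxDl -!scalemxAl !mxE. Qed.

Lemma form_atE z v : form_at z v = \sum_k z 0 k * (v *m W) 0 k.
Proof. by rewrite /form_at mxE; apply: eq_bigr => k _; rewrite [z^T _ _]mxE mulrC. Qed.

Lemma form_at_pr10 z v : form_at z (pr true v) = form_at z v.
Proof. by rewrite /form_at (mul_pr10_W EW_frame). Qed.

Lemma form_at_e z k : form_at z (e k) = z 0 k.
Proof.
rewrite form_atE -row_mul EW_frame.2 (bigD1 k) //= big1 => [|i ik]; rewrite !mxE ?eqxx.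
  by rewrite mulr1 addr0.
by rewrite eq_sym (negbTE ik) mulr0.
Qed.

Let fD z := linear_forD (form_at_scalar z).
Let fB z := linear_forB (form_at_scalar z).
Let fN z := linear_forN (form_at_scalar z).
Let fZ z := scalarZ_fun (form_at_scalar z).
Let fsum z := linear_for_sum (form_at_scalar z).

Lemma del_mx_frame z i j : del_mx a z i j = - form_at z (B (e i) (e j)).
Proof. by rewrite del_mxE form_atE -sumrN; apply: eq_bigr => k _; rewrite frame_aE mulrN. Qed.

Lemma delbar_mx_frame z i j : delbar_mx b z i j = - form_at z (B (e i) (eb j)).
Proof. by rewrite delbar_mxE form_atE -sumrN; apply: eq_bigr => k _; rewrite frame_bE mulrN. Qed.

Lemma bracket01_form_at z u v : form_at z (B (pr false u) (pr false v)) = 0.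
Proof. by rewrite -form_at_pr10 (ncs_integrable B_pr false) /form_at !mul0mx mxE. Qed.

Lemma frame_delbar_delbar z i l j : (del_mx a (right_factor b z i) l j)^* =
  delbar_mx b (left_factor b j z) i l - delbar_mx b (left_factor b l z) i j.
Proof.
have delbar_left p q : delbar_mx b (left_factor b q z) i p =
    form_at z (B (B (e i) (eb p)) (eb q)).
  rewrite -{1}[B (e i) (eb p)]pr_sum Dl fD -(pr01_eb pr_conj EW_frame q).
  rewrite bracket01_form_at addr0 (pr01_eb pr_conj EW_frame).
  rewrite pr10_bracket_e_eb suml fsum delbar_mxE; apply: eq_bigr => k _.
  by rewrite mxE Zl fZ delbar_mx_frame; ring.
have -> : (del_mx a (right_factor b z i) l j)^* = form_at z (B (e i) (B (eb l) (eb j))).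
  rewrite bracket_eb_eb sumr fsum del_mxE rmorph_sum; apply: eq_bigr => k _.
  by rewrite mxE rmorphM /= conjCK delbar_mx_frame Zr fZ; ring.
rewrite !delbar_left -fB (ncs_jacobi B_pr (e i)) (B_skew (B (e i) (eb j))).
by rewrite opprK subrK.
Qed.

Lemma frame_delbar_delN l z : delbar_del a b l z = - del_delbar a b l z.
Proof.
have delbar_row p q : delbar_mx b (row p (del_mx a z)) q l =
    form_at z (B (e p) (pr true (B (e q) (eb l)))).
  rewrite pr10_bracket_e_eb sumr fsum delbar_mxE; apply: eq_bigr => k _.
  by rewrite mxE Zr fZ del_mx_frame; ring.
have del_left i k : del_mx a (left_factor b l z) i k = form_at z (B (B (e i) (e k)) (eb l)).
  rewrite bracket_e_e suml fsum del_mxE; apply: eq_bigr => p _.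
  by rewrite mxE Zl fZ delbar_mx_frame; ring.
have delbar_right p q : (delbar_mx b (right_factor b z p) l q)^* =
    - form_at z (B (e p) (pr false (B (e q) (eb l)))).
  rewrite pr01_bracket_e_eb sumr fsum delbar_mxE rmorph_sum -sumrN; apply: eq_bigr => k _.
  by rewrite mxE rmorphM /= conjCK delbar_mx_frame Zr fZ; ring.
have split_bracket p q : form_at z (B (e p) (B (e q) (eb l))) =
    form_at z (B (e p) (pr true (B (e q) (eb l)))) +
    form_at z (B (e p) (pr false (B (e q) (eb l)))).
  by rewrite -fD -Dr pr_sum.
apply/matrixP=> i k; have -> : (- del_delbar a b l z) i k = - del_delbar a b l z i k.
  by rewrite mxE.
rewrite delbar_delE del_delbarE !delbar_row del_left !delbar_right.
by rewrite (ncs_jacobi B_pr) fB !split_bracket; ring.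
Qed.

Local Notation coord v i := ((v *m W) 0 i).
Local Notation conj_coord v i := ((v^*m *m W) 0 i)^*.

Lemma form_at_bracket z u v : - form_at z (B u v) =
  \sum_(i < r) \sum_(j < r | (i < j)%N)
    del_mx a z i j * (coord u i * coord v j - coord v i * coord u j) +
  \sum_i \sum_j delbar_mx b z i j * (coord u i * conj_coord v j - coord v i * conj_coord u j).
Proof.
have del_part : form_at z (B (pr true u) (pr true v)) =
    - \sum_i \sum_j del_mx a z i j * (coord u i * coord v j).
  rewrite !(pr10_frame EW_frame) suml fsum -sumrN; apply: eq_bigr => i _.
  rewrite sumr fsum -sumrN; apply: eq_bigr => j _.
  by rewrite Zl Zr !fZ del_mx_frame; ring.
have delbar_part x y : form_at z (B (pr true x) (pr false y)) =
    - \sum_i \sum_j delbar_mx b z i j * (coord x i * conj_coord y j).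
  rewrite (pr10_frame EW_frame) (pr01_frame pr_conj EW_frame) suml fsum -sumrN.
  apply: eq_bigr => i _; rewrite sumr fsum -sumrN; apply: eq_bigr => j _.
  by rewrite Zl Zr !fZ delbar_mx_frame; ring.
have del_skew i j : del_mx a z i j = - del_mx a z j i by rewrite !del_mx_frame B_skew fN.
rewrite -{1}[u]pr_sum -{1}[v]pr_sum Dl !Dr !fD (B_skew (pr false u) (pr true v)) fN.
rewrite bracket01_form_at addr0 del_part !delbar_part.
rewrite sum_off_diagonal => [|i]; last by rewrite (skew_diag_eq0 del_skew) mul0r.
rewrite !opprD !opprK -addrA -sumrB; congr (_ + _).
  apply: eq_bigr => i _; apply: eq_bigr => j _; rewrite (del_skew j i); ring.
by apply: eq_bigr => i _; rewrite -sumrB; apply: eq_bigr => j _; ring.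
Qed.

Lemma form_at_delta k v : form_at (delta_mx 0 k) v = (v *m W) 0 k.
Proof. by rewrite /form_at trmx_delta -colE mxE. Qed.

Lemma form_at_left_factor z l v : form_at (left_factor b l z) v = form_at z (B (eb l) v).
Proof.
have -> : form_at z (B (eb l) v) = form_at z (B (eb l) (pr true v)).
  by rewrite -{1}[v]pr_sum Dr fD -(pr01_eb pr_conj EW_frame l) bracket01_form_at addr0.
rewrite (pr10_frame EW_frame) sumr fsum form_atE; apply: eq_bigr => k _.
by rewrite mxE delbar_mx_frame Zr fZ (B_skew (eb l)) fN mulrC.
Qed.

(* Iterating [ad (eb l)] kills every vector, so that a form [z] outside [U] cannot
   have iterated left factors outside [U] forever. *)
Lemma frame_engel (U : {vspace 'rV[C]_r}) : U != fullv ->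
  exists2 z, z \notin U & forall l, left_factor b l z \in U.
Proof.
move=> U_neq; have [z0 z0U] : exists z0, z0 \notin U.
  apply: contrapT => /forallNP U_full; move/eqP: U_neq; apply; apply/eqP.
  rewrite eqEsubv subvf; apply/subvP => z _.
  by apply/negPn/negP; exact: U_full.
have [N nilN] := ncs_nilpotent B_pr.
apply: contrapT => no_z.
have step z : z \notin U -> exists l, left_factor b l z \notin U.
  move=> zU; apply: contrapT => /forallNP left_in; apply: no_z; exists z => // l.
  by apply/negPn/negP; exact: left_in.
have iter_step k : exists s z,
    [/\ size s = k, z \notin U & forall v, form_at z v = form_at z0 (foldr B v s)].
  elim: k => [|k [s [z [size_s zU z_at]]]]; first by exists [::], z0.
  have [l lU] := step z zU; exists (rcons s (eb l)), (left_factor b l z).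
  split=> [||v]; rewrite ?size_rcons ?size_s //.
  by rewrite form_at_left_factor z_at foldr_rcons.
have [s [z [size_s /negP zU z_at]]] := iter_step N; apply: zU.
have -> : z = 0; last exact: mem0v.
by apply/rowP=> k; rewrite -form_at_e z_at nilN // (linear_for0 (form_at_scalar z0)) mxE.
Qed.

(* The matrix of the endomorphism induced by [ad x] on the (1,0)-vectors is nilpotent. *)
Let trace_ad_eq0 x (P : V -> Prop) (M : 'M[C]_r) :
  (forall k, row k M = B x (e k) *m W) ->
  (forall v, pr true v = v -> P v) -> (forall v, P v -> P (B x v)) ->
  (forall v, P v -> pr true (B x (pr true v)) = pr true (B x v)) -> \tr M = 0.
Proof.
move=> rowM P10 P_ad pr_ad; have [N nilN] := ncs_nilpotent B_pr.
have ME z : z *m M *m E = pr true (B x (z *m E)).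
  rewrite (mulmx_sum_row z M) mulmx_suml EW_frame.1 (mulmx_sum_row z E) sumr !mulmx_suml.
  by apply: eq_bigr => k _; rewrite rowM Zr -!scalemxAl.
have iterME q z : P (iter q (B x) (z *m E)) /\
    iter q (mulmxr M) z *m E = pr true (iter q (B x) (z *m E)).
  elim: q => [|q [IHP IHq]] /=; last by split; [exact: P_ad|rewrite ME IHq pr_ad].
  have zE10 : pr true (z *m E) = z *m E.
    by rewrite EW_frame.1 -(mulmxA z) EW_frame.2 mulmx1.
  by split; [exact: P10|rewrite zE10].
have iter_foldr q v : iter q (B x) v = foldr B v (nseq q x) by elim: q => //= q ->.
apply: (@nilpotent_mx_trace _ _ _ N) => z.
rewrite -[LHS]mulmx1 -EW_frame.2 mulmxA (iterME N z).2 iter_foldr nilN ?size_nseq //.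
by rewrite (mul_pr10_W EW_frame) mul0mx.
Qed.

Lemma frame_a_trace i : \sum_k a k i k = 0.
Proof.
pose M : 'M[C]_r := \matrix_k (B (e i) (e k) *m W).
have trM : \tr M = 0.
  apply: (@trace_ad_eq0 (e i) (fun v => pr true v = v)) => [k|//|v v10|v v10].
  - by rewrite rowK.
  - have /= := ncs_integrable B_pr true (e i) v; rewrite (pr10_e EW_frame) v10 => pr01_0.
    by rewrite -[RHS]pr_sum pr01_0 addr0.
  - by rewrite v10.
transitivity (- \tr M); last by rewrite trM oppr0.
by rewrite /mxtrace -sumrN; apply: eq_bigr => k _; rewrite frame_aE [M k k]mxE.
Qed.

Lemma frame_b_trace j : \sum_k b k k j = 0.
Proof.
pose M : 'M[C]_r := \matrix_k (B (eb j) (e k) *m W).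
transitivity (\tr M).
  by apply: eq_bigr => k _; rewrite frame_bE B_skew mulNmx [M k k]mxE [X in - X]mxE opprK.
apply: (@trace_ad_eq0 (eb j) (fun=> True)) => // [k|v _]; first by rewrite rowK.
rewrite -[v in RHS]pr_sum Dr (linear_forD (splitting_linear pr_splitting true)).
by rewrite -(pr01_eb pr_conj EW_frame j) (ncs_integrable B_pr false) addr0.
Qed.

End Frame.

(** * Alternating forms of bidegree (3,3) *)

Definition vecs33 (R : realType) m (x : bool -> 'I_4 -> 'rV[R[i]]_m) (d e : 'I_4) :
    'I_6 -> 'rV[R[i]]_m :=
  vecs [:: x true (lift d ord3_0); x true (lift d ord3_1); x true (lift d ord3_2);
           x false (lift e ord3_0); x false (lift e ord3_1); x false (lift e ord3_2)].

Lemma card_setC1_ex n (A : {set 'I_n}) : #|A|.+1 = n -> exists d, forall i, i != d -> i \in A.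
Proof.
move=> cardA; have /eqP/cards1P[d Ad] : #|~: A|%SET = 1%N.
  by apply/eqP; rewrite -(eqn_add2l #|A|) cardsC card_ord addn1 cardA.
exists d => i; apply: contra_neqT => iA.
by apply/eqP; rewrite -finset.in_set1 -Ad finset.in_setC.
Qed.

Section Alternating33.
Variables (R : realType) (m : nat).
Local Notation V := 'rV[R[i]]_m.
Variable x : bool -> 'I_4 -> V.

(* Four vectors of each type, taken three at a time: one of each type is left out. *)
Lemma injective_type_misses (tp : 'I_6 -> bool) (c : 'I_6 -> 'I_4) :
  (\sum_j tp j = 3)%N -> injective (fun j => (tp j, c j)) ->
  forall t, exists d, forall i, i != d -> exists j, (tp j, c j) = (t, i).
Proof.
move=> count inj t; pose S s := [set j | tp j == s]%SET.
have cardT : #|S true| = 3%N.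
  apply: etrans count; rewrite -sum1dep_card big_mkcond.
  by apply: eq_bigr => j _; case: (tp j).
have cardS : #|S t| = 3%N.
  case: t; first exact: cardT.
  have -> : S false = (~: S true)%SET by apply/setP=> j; rewrite !inE; case: (tp j).
  by have := cardsC (S true); rewrite cardT card_ord; lia.
have c_inj : {in S t &, injective c}.
  by move=> j l; rewrite !inE => /eqP tj /eqP tl cjl; apply: inj; rewrite tj tl cjl.
have [|d missd] := @card_setC1_ex 4 (c @: S t)%SET; first by rewrite card_in_imset ?cardS.
exists d => i /missd /imsetP[j]; rewrite inE => /eqP tj ->.
by exists j; rewrite tj.
Qed.

Lemma alternating33_eq0 (f : inv_form R m 6) (tp : 'I_6 -> bool) X :
  multilinear f -> vanishes_on_repeats f -> (forall d e, f (vecs33 x d e) = 0) ->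
  (\sum_j tp j = 3)%N -> (forall j, exists y : 'I_4 -> R[i], X j = \sum_i y i *: x (tp j) i) ->
  f X = 0.
Proof.
move=> fm f_repeat f33 count X_span; apply: (multilinear_span_eq0 fm (fun c => _) X_span) => c.
pose bas (p : bool * 'I_4) := x p.1 p.2; pose phi j := (tp j, c j).
have [phi_inj|] := pselect (injective phi); last first.
  move=> /existsNP[j /existsNP[l /not_implyP[eq_phi /eqP jl]]].
  by apply: (f_repeat _ j l jl); case: eq_phi => -> ->.
have [d missd] := injective_type_misses count phi_inj true.
have [e misse] := injective_type_misses count phi_inj false.
pose s := [:: (true, lift d ord3_0); (true, lift d ord3_1); (true, lift d ord3_2);
              (false, lift e ord3_0); (false, lift e ord3_1); (false, lift e ord3_2)].
pose psi (q : 'I_6) := nth (true, d) s q.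
have psi_inj : injective psi.
  move=> q q' /eqP; rewrite nth_uniq ?ltn_ord // => [/eqP/val_inj//|].
  by rewrite /= !inE !xpair_eqE /= !(inj_eq lift_inj).
apply: (@alternating_image_eq0 _ _ _ f fm f_repeat _ bas phi psi psi_inj) => [q|].
  by case: q => [[|[|[|[|[|[|//]]]]]] ltq]; [apply: missd|apply: missd|apply: missd
    |apply: misse|apply: misse|apply: misse]; rewrite eq_sym neq_lift.
rewrite -[RHS](f33 d e); congr f; apply/funext => q.
by case: q => [[|[|[|[|[|[|//]]]]]] ltq].
Qed.

End Alternating33.

(** * The form [del delbar (F ^ F)] in a unitary frame *)

Definition frame_vec (C : numClosedFieldType) r n (E : 'M[C]_(r, n)) (t : bool) i : 'rV[C]_n :=
  if t then row i E else (row i E)^*m.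
Arguments frame_vec : simpl never.

Lemma conj_frame_vec (C : numClosedFieldType) r n (E : 'M[C]_(r, n)) t i :
  (frame_vec E t i)^*m = frame_vec E (~~ t) i.
Proof. by case: t => //; apply/rowP=> j; rewrite !mxE conjCK. Qed.

Section FormOnFrame.
Variables (C : numClosedFieldType) (n r : nat) (E : 'M[C]_(r, n)).
Variables (F : 'rV[C]_n -> 'rV[C]_n -> C) (c : C).
Hypotheses (F_scalar : forall v, scalar (F^~ v)) (F_skew : forall u v, F u v = - F v u).
Hypothesis F_type : forall t i j, F (frame_vec E t i) (frame_vec E t j) = 0.
Hypothesis F_frame : forall i j,
  F (frame_vec E true i) (frame_vec E false j) = c * (i == j)%:R.

Definition frame_sign (t : bool) : C := if t then 1 else -1.

Lemma F_frame_vec t s i j : F (frame_vec E t i) (frame_vec E s j) =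
  if t == s then 0 else frame_sign t * c * (i == j)%:R.
Proof.
case: eqP => [<-|]; first exact: F_type.
case: t; case: s => // _; rewrite ?F_frame ?mul1r //.
by rewrite F_skew F_frame eq_sym !mulNr mul1r.
Qed.

Lemma F_comb_frame_vec t s (x : 'I_r -> C) j :
  F (\sum_k x k *: frame_vec E t k) (frame_vec E s j) =
  if t == s then 0 else frame_sign t * c * x j.
Proof.
rewrite (linear_for_sum (F_scalar _)) (bigD1 j) //= big1 => [|k kj].
  by rewrite (scalarZ_fun (F_scalar _)) F_frame_vec eqxx mulr1; case: ifP => _; ring.
by rewrite (scalarZ_fun (F_scalar _)) F_frame_vec (negbTE kj) /= mulr0 if_same mulr0.
Qed.

Lemma F_frame_vec_comb t s (x : 'I_r -> C) j :
  F (frame_vec E s j) (\sum_k x k *: frame_vec E t k) =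
  if t == s then 0 else - (frame_sign t * c * x j).
Proof. by rewrite F_skew F_comb_frame_vec; case: ifP => //; rewrite oppr0. Qed.

End FormOnFrame.

Section DdbarFrame.
Variables (R : realType) (m : nat).
Local Notation C := R[i].
Local Notation V := 'rV[C]_m.
Variables (B : V -> V -> V) (pr : bool -> V -> V).
Hypothesis B_pr : nilpotent_complex_structure B pr.
Variables (E : 'M[C]_(4, m)) (W : 'M[C]_(m, 4)).
Hypothesis EW_frame : is_frame pr E W.
Variables (F : V -> V -> C) (c : C).
Hypotheses (F_scalar : forall v, scalar (F^~ v)) (F_skew : forall u v, F u v = - F v u).
Hypothesis F_type : forall t u v, F (pr t u) (pr t v) = 0.
Hypothesis F_frame : forall i j,
  F (frame_vec E true i) (frame_vec E false j) = c * (i == j)%:R.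
Local Notation e := (frame_vec E true).
Local Notation eb := (frame_vec E false).
Local Notation a := (frame_a B E W).
Local Notation b := (frame_b B E W).
Local Notation ac := (fun k i j => (a k i j)^*).
Local Notation bc := (fun k i j => (b k i j)^*).
Local Notation T := (type_bracket pr B).

Let T_bilinear t : bilinear_map (T t).
Proof. exact: (bilinear_type_bracket (ncs_splitting B_pr) (ncs_bilinear B_pr)). Qed.

Let T_alt t u : T t u u = 0.
Proof. exact: (type_bracket_alt (ncs_splitting B_pr) (ncs_bilinear B_pr) (ncs_alt B_pr)). Qed.

Let T_skew t := alternating_bilinear_skew (T_bilinear t) (T_alt t).

Lemma pr_frame_vec t i : pr t (frame_vec E t i) = frame_vec E t i.
Proof. by case: t; [exact: (pr10_e EW_frame)|exact: (pr01_eb (ncs_pr_conj B_pr) EW_frame)]. Qed.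

Lemma pr_frame_comb t v : exists x : 'I_4 -> C, pr t v = \sum_k x k *: frame_vec E t k.
Proof.
case: t; eexists; first exact: (pr10_frame EW_frame).
exact: (pr01_frame (ncs_pr_conj B_pr) EW_frame).
Qed.

Let T_frame t s s' i j : T t (frame_vec E s i) (frame_vec E s' j) =
  if (s != t) && (s' != t) then 0
  else pr (if s == s' then t else ~~ t) (B (frame_vec E s i) (frame_vec E s' j)).
Proof.
exact: (type_bracket_pure (ncs_splitting B_pr) (ncs_bilinear B_pr) t
  (pr_frame_vec s i) (pr_frame_vec s' j)).
Qed.

Lemma del_bracket_e_e i j : T true (e i) (e j) = \sum_k - a k i j *: e k.
Proof.
by rewrite T_frame (pr10_frame EW_frame); apply: eq_bigr => k _; rewrite frame_aE opprK.
Qed.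

Lemma del_bracket_e_eb i j : T true (e i) (eb j) = \sum_k (b k j i)^* *: eb k.
Proof. by rewrite T_frame; exact: (pr01_bracket_e_eb B_pr EW_frame). Qed.

Lemma del_bracket_eb_eb i j : T true (eb i) (eb j) = 0.
Proof. by rewrite T_frame. Qed.

Lemma delbar_bracket_e_e i j : T false (e i) (e j) = 0.
Proof. by rewrite T_frame. Qed.

Lemma delbar_bracket_e_eb i j : T false (e i) (eb j) = \sum_k - b k i j *: e k.
Proof. by rewrite T_frame; exact: (pr10_bracket_e_eb B EW_frame). Qed.

Lemma delbar_bracket_eb_e i j : T false (eb j) (e i) = \sum_k b k i j *: e k.
Proof.
rewrite T_skew delbar_bracket_e_eb -sumrN; apply: eq_bigr => k _.
by rewrite scaleNr opprK.
Qed.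

Lemma delbar_bracket_eb_eb i j : T false (eb i) (eb j) = \sum_k - ac k i j *: eb k.
Proof.
rewrite T_frame (pr01_frame (ncs_pr_conj B_pr) EW_frame); apply: eq_bigr => k _; congr (_ *: _).
by rewrite frame_aE rmorphN opprK -(ncs_conj B_pr) !conj_frame_vec.
Qed.

Let F_typed t i j : F (frame_vec E t i) (frame_vec E t j) = 0.
Proof.
by have := F_type t (frame_vec E t i) (frame_vec E t j); rewrite !pr_frame_vec.
Qed.

Let F_combl := F_comb_frame_vec F_scalar F_skew F_typed F_frame.
Let F_combr := F_frame_vec_comb F_scalar F_skew F_typed F_frame.
Let F0l v : F 0 v = 0. Proof. exact: (linear_for0 (F_scalar v)). Qed.
Let F0r v : F v 0 = 0. Proof. exact: (linear_for0 (form2_scalarr F_scalar F_skew v)). Qed.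

Local Notation del_F u v w := (ce_diff (T true) (form2 F) (vecs [:: u; v; w])).
Local Notation delbar_F u v w := (ce_diff (T false) (form2 F) (vecs [:: u; v; w])).

Let del_FE u v w : del_F u v w = - F (T true u v) w + F (T true u w) v + F u (T true v w).
Proof. by rewrite ce_diff2. Qed.

Let delbar_FE u v w :
  delbar_F u v w = - F (T false u v) w + F (T false u w) v + F u (T false v w).
Proof. by rewrite ce_diff2. Qed.

Let delbarE :=
  (delbar_bracket_e_e, delbar_bracket_e_eb, delbar_bracket_eb_e, delbar_bracket_eb_eb).
Let delE := (del_bracket_e_e, del_bracket_e_eb, del_bracket_eb_eb).

Lemma delbar_form2_e_eb_eb i l n :
  delbar_F (e i) (eb l) (eb n) = c * delbar_form2_coef ac b i l n.
Proof.
by rewrite delbar_FE !delbarE !(F_combl, F_combr) /= /delbar_form2_coef; ring.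
Qed.

Lemma delbar_form2_eb_e_eb i l n :
  delbar_F (eb l) (e i) (eb n) = - (c * delbar_form2_coef ac b i l n).
Proof.
by rewrite delbar_FE !delbarE !(F_combl, F_combr) /= /delbar_form2_coef; ring.
Qed.

Lemma del_form2_e_e_eb j k n :
  del_F (e j) (e k) (eb n) = c * del_form2_coef a bc j k n.
Proof.
by rewrite del_FE !delE !(F_combl, F_combr) /= /del_form2_coef; ring.
Qed.

Lemma delbar_form2_e_e t i j k : delbar_F (e i) (e j) (frame_vec E t k) = 0.
Proof.
by case: t; rewrite delbar_FE !delbarE !(F_combl, F_combr, F0l, F0r) /=; ring.
Qed.

Lemma delbar_form2_eb_eb_eb i j k : delbar_F (eb i) (eb j) (eb k) = 0.
Proof. by rewrite delbar_FE !delbarE !(F_combl, F_combr) /=; ring. Qed.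

Lemma del_form2_eb_eb t i j k : del_F (frame_vec E t i) (eb j) (eb k) = 0.
Proof. by case: t; rewrite del_FE !delE !(F_combl, F_combr, F0l, F0r) /=; ring. Qed.

Let delbar_F_suml (x : 'I_4 -> C) (u : 'I_4 -> V) v w :
  delbar_F (\sum_k x k *: u k) v w = \sum_k x k * delbar_F (u k) v w.
Proof.
have lin : scalar (fun u => delbar_F u v w).
  by move=> y u1 u2; rewrite !delbar_FE !(T_bilinear false).1 !F_scalar; ring.
rewrite (linear_for_sum lin); apply: eq_bigr => k _; exact: (scalarZ_fun lin).
Qed.

Let delbar_F_summ (x : 'I_4 -> C) (u : 'I_4 -> V) v w :
  delbar_F v (\sum_k x k *: u k) w = \sum_k x k * delbar_F v (u k) w.
Proof.
have lin : scalar (fun u => delbar_F v u w).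
  move=> y u1 u2; rewrite !delbar_FE (T_bilinear false).1 (T_bilinear false).2 !F_scalar.
  by rewrite !(form2_scalarr F_scalar F_skew); ring.
rewrite (linear_for_sum lin); apply: eq_bigr => k _; exact: (scalarZ_fun lin).
Qed.

Lemma ddbar_form2_e_e_eb_eb j k l n :
  ce_diff (T true) (ce_diff (T false) (form2 F)) (vecs [:: e j; e k; eb l; eb n]) =
  c * ddbar_form2_coef a ac b bc j k l n.
Proof.
rewrite ce_diff3 !delE.
have -> : delbar_F (e j) (e k) 0 = 0.
  by rewrite delbar_FE !delbarE !(bilinear0r (T_bilinear false)) !(F0l, F0r); ring.
rewrite !delbar_F_suml !delbar_F_summ /ddbar_form2_coef mulr_sumr subr0 -!sumrN -!big_split.
apply: eq_bigr => p _ /=; rewrite !(delbar_form2_e_eb_eb, delbar_form2_eb_e_eb).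
by ring.
Qed.

Lemma ddbar_form2_sq_frame x0 x1 x2 y0 y1 y2 :
  ce_diff (T true) (ce_diff (T false) (form2_sq F))
    (vecs [:: e x0; e x1; e x2; eb y0; eb y1; eb y2]) =
  2 * c ^+ 2 * ddbar_sq_coef a ac b bc x0 x1 x2 y0 y1 y2.
Proof.
rewrite ce_diff_sq_form2 ce_diff_wedge_form2 /=.
rewrite !F_typed !F_frame !ddbar_form2_e_e_eb_eb.
rewrite !(delbar_form2_e_e, delbar_form2_eb_eb_eb, del_form2_eb_eb).
rewrite !(delbar_form2_e_eb_eb, del_form2_e_e_eb) /ddbar_sq_coef /=.
by ring.
Qed.

Lemma ddbar_sq_compl_pairing (i j : 'I_4) :
  (-1) ^+ (i + j) * ddbar_sq_compl a ac b bc i j =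
  - pairing a b (delta_mx 0 i) (delta_mx 0 j).
Proof.
have a_diag k p : a k p p = 0 by rewrite frame_aE (ncs_alt B_pr) mul0mx mxE oppr0.
have two_neq0 : (2 : C) != 0 by rewrite pnatr_eq0.
apply: (mulfI two_neq0); rewrite mulrN (pairing_coefE (frame_delbar_delN B_pr EW_frame)).
apply: ddbar_sq_complE => [k p q|k p|k p q|k p|p|p|q|q].
- exact: (frame_a_skew B_pr E W k p q).
- exact: a_diag.
- by rewrite (frame_a_skew B_pr E W k p q) rmorphN.
- by rewrite a_diag rmorph0.
- exact: (frame_a_trace B_pr EW_frame).
- by rewrite -rmorph_sum (frame_a_trace B_pr EW_frame) rmorph0.
- exact: (frame_b_trace B_pr EW_frame).
- by rewrite -rmorph_sum (frame_b_trace B_pr EW_frame) rmorph0.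
Qed.

Local Notation ddbar_F2 := (ce_diff (T true) (ce_diff (T false) (form2_sq F))).

Let F2_multilinear := multilinear_form2_sq F_scalar F_skew.
Let F2_repeat := vanishes_on_repeats_form2_sq F_scalar F_skew.
Let dF2_multilinear := multilinear_ce_diff (T_bilinear false) F2_multilinear.

Lemma multilinear_ddbar_form2_sq : multilinear ddbar_F2.
Proof. exact: (multilinear_ce_diff (T_bilinear true) dF2_multilinear). Qed.

Lemma vanishes_on_repeats_ddbar_form2_sq : vanishes_on_repeats ddbar_F2.
Proof.
apply: (vanishes_on_repeats_ce_diff (T_bilinear true) (T_alt true) dF2_multilinear).
exact: (vanishes_on_repeats_ce_diff (T_bilinear false) (T_alt false) F2_multilinear F2_repeat).
Qed.

Lemma of_bidegree_ddbar_form2_sq : of_bidegree pr 3 ddbar_F2.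
Proof.
have bidegree := of_bidegree_ce_diff (ncs_splitting B_pr) (ncs_bilinear B_pr).
apply: (bidegree true 2 _ _ dF2_multilinear).
by apply: (bidegree false 2 _ _ F2_multilinear); exact: of_bidegree_form2_sq.
Qed.

Hypothesis c_neq0 : c != 0.

Lemma ddbar_form2_sq_eq0P :
  (forall X, ddbar_F2 X = 0) <->
  (forall i j, pairing a b (delta_mx 0 i) (delta_mx 0 j) = 0).
Proof.
have scale_neq0 : 2 * c ^+ 2 != 0 by rewrite mulf_neq0 ?expf_neq0 ?pnatr_eq0.
have ddbar33E i j : ddbar_F2 (vecs33 (frame_vec E) i j) =
    2 * c ^+ 2 * ddbar_sq_compl a ac b bc i j by exact: ddbar_form2_sq_frame.
split=> [ddbar0 i j|pairing0].
  have compl0 : ddbar_sq_compl a ac b bc i j = 0.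
    by apply: (mulfI scale_neq0); rewrite -ddbar33E ddbar0 mulr0.
  have := ddbar_sq_compl_pairing i j; rewrite compl0 mulr0 => /eqP.
  by rewrite eq_sym oppr_eq0 => /eqP.
have ddbar33 i j : ddbar_F2 (vecs33 (frame_vec E) i j) = 0.
  rewrite ddbar33E; apply: (@lreg_sign _ (i + j)).
  by rewrite mulrCA ddbar_sq_compl_pairing pairing0 oppr0 !mulr0.
apply: (multilinear_pure_eq (ncs_splitting B_pr) multilinear_ddbar_form2_sq).
  by move=> X j x u v; rewrite mulr0 addr0.
move=> tp X X_pure; have [count|count] := eqVneq (\sum_j tp j)%N 3%N; last first.
  exact: (of_bidegree_ddbar_form2_sq X_pure count).
apply: (alternating33_eq0 multilinear_ddbar_form2_sq vanishes_on_repeats_ddbar_form2_sq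
  ddbar33 count) => j.
by rewrite -(X_pure j); exact: pr_frame_comb.
Qed.

End DdbarFrame.

(** * Astheno-Kaehler metrics *)

Section ComplexStructureForms.
Variables (R : realType) (m : nat) (br : 'rV[R]_m -> 'rV[R]_m -> 'rV[R]_m) (J : 'M[R]_m).
Hypotheses (br_lie : is_lie_bracket br) (br_nil : is_nilpotent br).
Hypothesis J_complex : is_complex_structure br J.
Local Notation B := (cplx_bracket br).
Local Notation T := (type_bracket (type_proj J) B).

Let re_bracket u v : re_mx (B u v) = br (re_mx u) (re_mx v) - br (im_mx u) (im_mx v).
Proof. exact: re_mx_rect. Qed.

Let im_bracket u v : im_mx (B u v) = br (re_mx u) (im_mx v) + br (im_mx u) (re_mx v).
Proof. exact: im_mx_rect. Qed.

Lemma complexification_structure : nilpotent_complex_structure B (type_proj J).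
Proof.
split.
- exact: (bilinear_bracket br_lie re_bracket im_bracket).
- exact: (bracket_alt br_lie re_bracket im_bracket).
- exact: (bracketA br_lie re_bracket im_bracket).
- exact: (bracket_conj br_lie re_bracket im_bracket).
- exact: (bracket_nilpotent br_lie re_bracket im_bracket br_nil).
- exact: (type_proj_splitting J_complex.1).
- by case=> z; [exact: proj10_conj|exact: proj01_conj].
case=> u v; first exact: (bracket10_proj01 br_lie re_bracket im_bracket J_complex).
exact: (bracket01_proj10 br_lie re_bracket im_bracket J_complex).
Qed.

Let B_bilinear := ncs_bilinear complexification_structure.
Let integrable := ncs_integrable complexification_structure.

Lemma sum_bidegree_part (t : bool) k (f : inv_form R m k) X : multilinear f ->
  \sum_(p < k.+1) bidegree_part J (p + t)%N (ext_d br (bidegree_part J p f)) X =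
  ce_diff (T t) f X.
Proof.
move=> fm; rewrite -(sum_typed_part_ce_diff (type_proj_splitting J_complex.1) B_bilinear
  (integrable true) (integrable false) t X fm).
apply: eq_bigr => p _; rewrite bidegree_partE; congr (typed_part _ _ _ _).
by rewrite ext_dE; congr ce_diff; apply/funext => Y; exact: bidegree_partE.
Qed.

Lemma del_ce_diff k (f : inv_form R m k) : multilinear f -> Defs.del br J f = ce_diff (T true) f.
Proof.
move=> fm; apply/funext => X; rewrite -(sum_bidegree_part _ _ fm).
by apply: eq_bigr => p _; rewrite addn1.
Qed.

Lemma delbar_ce_diff k (f : inv_form R m k) :
  multilinear f -> Defs.delbar br J f = ce_diff (T false) f.
Proof.
move=> fm; apply/funext => X; rewrite -(sum_bidegree_part _ _ fm).
by apply: eq_bigr => p _; rewrite addn0.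
Qed.

End ComplexStructureForms.

Lemma tr_cplx_mx (R : realType) p q (A : 'M[R]_(p, q)) : (cplx_mx A)^T = cplx_mx A^T.
Proof. exact: map_trmx. Qed.

Lemma cplx_mxM (R : realType) p q s (A : 'M[R]_(p, q)) (B : 'M[R]_(q, s)) :
  cplx_mx (A *m B) = cplx_mx A *m cplx_mx B.
Proof. exact: map_mxM. Qed.

Section HermitianMetric.
Local Open Scope complex_scope.
Variables (R : realType) (m : nat) (J : 'M[R]_m).

Let cplx_form_real (h : 'M[R]_m) (x y : 'rV[R]_m) :
  (cplx_mx x *m cplx_mx h *m (cplx_mx y)^T) 0 0 = ((x *m h *m y^T) 0 0)%:C.
Proof. by rewrite tr_cplx_mx -!cplx_mxM mxE. Qed.

Let cplx_form_hermitian (h : 'M[R]_m) (u : 'rV[R[i]]_m) : h^T = h ->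
  (u *m cplx_mx h *m (u^T)^*m) 0 0 =
  ((re_mx u *m h *m (re_mx u)^T) 0 0 + (im_mx u *m h *m (im_mx u)^T) 0 0)%:C.
Proof.
move=> h_sym; set x := re_mx u; set y := im_mx u.
have conj_u : u^T^*m = (cplx_mx x)^T - 'i *: (cplx_mx y)^T.
  apply/matrixP=> i j; rewrite !mxE; case: (u j i) => a b.
  by apply/eqP; rewrite eq_complex /=; apply/andP; split; apply/eqP; ring.
have cross : y *m h *m x^T = x *m h *m y^T.
  have -> : y *m h *m x^T = (x *m h *m y^T)^T by rewrite !trmx_mul trmxK h_sym mulmxA.
  by apply/matrixP=> i j; rewrite mxE !ord1.
have expand (P Q P' Q' : 'M[R[i]]_1) :
    (P + 'i *: Q - ('i *: P' + 'i *: ('i *: Q'))) 0 0 = P 0 0 + Q' 0 0 + 'i * (Q 0 0 - P' 0 0).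
  by rewrite !mxE (mulrA 'i) mulii; ring.
rewrite conj_u {1}(cplx_mx_rect u) mulmxDl mulmxBr !mulmxDl -!scalemxAl -!scalemxAr expand.
by rewrite -/x -/y !cplx_form_real cross subrr mulr0 addr0 rmorphD.
Qed.

Lemma is_hermitian_metricP h :
  is_hermitian_metric J h <-> is_hermitian_gram (cplx_mx J) (cplx_mx h).
Proof.
split=> [[h_sym h_pos h_J]|[h_sym h_J h_pos]]; split.
- by rewrite tr_cplx_mx h_sym.
- rewrite tr_cplx_mx -!cplx_mxM; congr cplx_mx; apply/matrixP=> i j.
  have entry (A : 'M[R]_m) : A i j =
      ((delta_mx 0 i : 'rV[R]_m) *m A *m (delta_mx 0 j : 'rV[R]_m)^T) 0 0.
    by rewrite -rowE trmx_delta -colE !mxE.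
  by rewrite [LHS]entry [RHS]entry -h_J trmx_mul !mulmxA.
- move=> u u_neq0; rewrite cplx_form_hermitian // ltcR.
  have form_ge0 (x : 'rV[R]_m) : 0 <= (x *m h *m x^T) 0 0.
    by have [->|x_neq0] := eqVneq x 0; [rewrite !mul0mx mxE|rewrite ltW ?h_pos].
  have [re0|re_neq0] := eqVneq (re_mx u) 0; last by rewrite ltr_pwDl ?h_pos.
  rewrite ltr_wpDl // h_pos //; apply: contra_neq u_neq0 => im0.
  by rewrite (cplx_mx_rect u) re0 im0 /cplx_mx !map_mx0 scaler0 addr0.
- by apply: cplx_mx_inj; rewrite -tr_cplx_mx.
- move=> x x_neq0; have : cplx_mx x != 0.
    by apply: contra_neq x_neq0 => x0; apply: cplx_mx_inj; rewrite x0 /cplx_mx map_mx0.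
  move=> /h_pos; rewrite tr_cplx_mx conj_mx_cplx -tr_cplx_mx.
  by rewrite cplx_form_real ltcR.
- have h_inv : J *m h *m J^T = h by apply: cplx_mx_inj; rewrite !cplx_mxM -tr_cplx_mx.
  by move=> x y; rewrite trmx_mul -[in RHS]h_inv !mulmxA.
Qed.

End HermitianMetric.

Section AsthenoKahler.
Local Open Scope complex_scope.
Variables (R : realType) (br : 'rV[R]_8 -> 'rV[R]_8 -> 'rV[R]_8) (J : 'M[R]_8).
Hypotheses (br_lie : is_lie_bracket br) (br_nil : is_nilpotent br).
Hypothesis J_complex : is_complex_structure br J.
Local Notation B := (cplx_bracket br).
Local Notation pr := (type_proj J).

Let B_pr := complexification_structure br_lie br_nil J_complex.
Let J_sqr := cplx_mx_sqr J_complex.1.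
Let J_real := conj_mx_cplx J.
Let pr10_J := proj10_cplx_mx J_complex.1.
Let i_neq0 : ('i : R[i]) != 0. Proof. by rewrite eq_complex /= oner_eq0 andbF. Qed.

Lemma astheno_kahlerP h (E : 'M[R[i]]_(4, 8)) W : is_hermitian_metric J h ->
  is_frame pr E W -> unitary_for (cplx_mx h) E ->
  is_astheno_kahler br J h <->
  (forall i j, pairing (frame_a B E W) (frame_b B E W) (delta_mx 0 i) (delta_mx 0 j) = 0).
Proof.
move=> h_metric EW_frame E_unitary; have /is_hermitian_metricP h_gram := h_metric.
pose F := hform (cplx_mx J) (cplx_mx h).
have F_scalar : forall v, scalar (F^~ v) by exact: hform_scalar.
have F_skew : forall u v, F u v = - F v u by exact: (hform_skew J_sqr h_gram).
have F_type : forall t u v, F (pr t u) (pr t v) = 0.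
  exact: (hform_type (ncs_pr_conj B_pr) J_sqr J_real (mulii R) (conj_i R) pr10_J h_gram).
have F_frame i j : F (frame_vec E true i) (frame_vec E false j) = 'i * (i == j)%:R.
  exact: (hform_unitary_frame pr10_J i j EW_frame E_unitary).
have F_sq : form_pow (fundamental_form J h) (8./2 - 2) = form2_sq F by exact: form_pow2.
have F2m := multilinear_form2_sq F_scalar F_skew.
rewrite -(ddbar_form2_sq_eq0P B_pr EW_frame F_scalar F_skew F_type F_frame i_neq0).
rewrite /is_astheno_kahler F_sq (delbar_ce_diff br_lie br_nil J_complex F2m).
rewrite (del_ce_diff br_lie br_nil J_complex); first by split=> [[]|].
apply: multilinear_ce_diff F2m.
exact: (bilinear_type_bracket (ncs_splitting B_pr) (ncs_bilinear B_pr)).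
Qed.

Lemma frame_metric_exists (E : 'M[R[i]]_(4, 8)) W : is_frame pr E W ->
  exists2 h, is_hermitian_metric J h & unitary_for (cplx_mx h) E.
Proof.
move=> EW_frame; have gram_cplx : cplx_mx (re_mx (frame_gram W)) = frame_gram W.
  apply: re_im_mxP; rewrite ?re_mx_cplx // im_mx_cplx; apply/eqP.
  have /eqP := im_mx_conj (frame_gram W); rewrite frame_gram_conj -addr_eq0.
  by rewrite -mulr2n -scaler_nat scaler_eq0 pnatr_eq0 /= eq_sym.
exists (re_mx (frame_gram W)); last first.
  by rewrite gram_cplx; exact: (frame_gram_unitary (ncs_splitting B_pr) (ncs_pr_conj B_pr)).
apply/is_hermitian_metricP; rewrite gram_cplx.
exact: (frame_gram_hermitian (ncs_splitting B_pr) (ncs_pr_conj B_pr) J_real (mulii R) (conj_i R)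
  pr10_J EW_frame).
Qed.

End AsthenoKahler.

(** * Coframes *)

Section OneForms.
Variables (R : realType) (m : nat) (J : 'M[R]_m).
Hypothesis J_sqr : J *m J = - 1%:M.
Local Notation C := R[i].
Local Notation V := 'rV[C]_m.
Implicit Type f : inv_form R m 1.

Let const_arg (X : 'I_1 -> V) : X = fun=> X 0.
Proof. by apply/funext => l; rewrite ord1. Qed.

Lemma is_form1P f : is_form f <-> scalar (fun u => f (fun=> u)).
Proof.
have updE (X : 'I_1 -> V) j v : upd X j v = fun=> v.
  by apply/funext => l; rewrite !ord1 upd_eq.
split=> [[f_lin _] a u v|f_lin].
  by have := f_lin (fun=> 0) 0 a u v; rewrite -!/(upd _ _ _) !updE.
split=> [X j a u v|X j l]; first by rewrite -!/(upd _ _ _) !updE f_lin.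
by rewrite !ord1 eqxx.
Qed.

Lemma bidegree_part1 f X : bidegree_part J 1 f X = f (fun=> proj10 J (X 0)).
Proof.
rewrite /bidegree_part (big_pred1 [set: 'I_1]%SET) => [|S].
  by congr f; apply/funext => l; rewrite finset.in_setT ord1.
rewrite /= eqEcard finset.subsetT cardsT card_ord /= eqn_leq.
by have := max_card (mem S); rewrite card_ord => ->.
Qed.

Lemma is_form10P f : is_form10 J f <->
  scalar (fun u => f (fun=> u)) /\ forall u, f (fun=> proj10 J u) = f (fun=> u).
Proof.
split=> [[/is_form1P f_lin f10]|[/is_form1P f_lin f10]].
  by split=> // u; rewrite -[RHS]f10 bidegree_part1.
by split=> // X; rewrite bidegree_part1 f10 [X in RHS]const_arg.
Qed.

Lemma one_form_mulmx f p (x : 'rV[C]_p) (M : 'M[C]_(p, m)) :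
  scalar (fun u => f (fun=> u)) -> f (fun=> x *m M) = \sum_k x 0 k * f (fun=> row k M).
Proof.
move=> f_lin; rewrite mulmx_sum_row (linear_for_sum f_lin); apply: eq_bigr => k _.
exact: (scalarZ_fun f_lin).
Qed.

Definition col_form n (W : 'M[C]_(m, n)) (k : 'I_n) : inv_form R m 1 :=
  fun X => (X 0 *m W) 0 k.

Lemma is_form10_col n (W : 'M[C]_(m, n)) k :
  proj10_mx J *m W = W -> is_form10 J (col_form W k).
Proof.
move=> W10; apply/is_form10P; rewrite /col_form; split=> [a u v|u].
  by rewrite mulmxDl -scalemxAl !mxE.
by rewrite proj10E -mulmxA W10.
Qed.

Section FrameCoframe.
Variables (n : nat) (E : 'M[C]_(n, m)) (W : 'M[C]_(m, n)).
Hypothesis EW_frame : is_frame (type_proj J) E W.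

Lemma frame_proj10_mx : proj10_mx J = W *m E.
Proof.
apply/row_matrixP=> i; rewrite !rowE -proj10E mulmxA; exact: EW_frame.1.
Qed.

Lemma coframe_of_frame : is_coframe10 J (col_form W).
Proof.
split=> [k|f /is_form10P[f_lin f10]].
  by apply: is_form10_col; rewrite frame_proj10_mx -mulmxA EW_frame.2 mulmx1.
have col_form_row k l : col_form W l (fun=> row k E) = (k == l)%:R.
  by rewrite /col_form -row_mul EW_frame.2 !mxE.
exists (\row_k f (fun=> row k E)); split=> [X|c fE].
  rewrite [X in f X]const_arg -f10 proj10E frame_proj10_mx mulmxA one_form_mulmx //.
  by apply: eq_bigr => k _; rewrite [(\row__ _) 0 k]mxE mulrC.
apply/rowP=> k; rewrite mxE fE (bigD1 k) //= big1 => [|l lk].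
  by rewrite col_form_row eqxx mulr1 addr0.
by rewrite col_form_row eq_sym (negbTE lk) mulr0.
Qed.

End FrameCoframe.

Lemma frame_of_coframe n (w : 'I_n -> inv_form R m 1) : is_coframe10 J w ->
  exists (E : 'M[C]_(n, m)) (W : 'M[C]_(m, n)), is_frame (type_proj J) E W /\ w = col_form W.
Proof.
move=> [w10 w_basis]; pose W := \matrix_(v, k) w k (fun=> delta_mx 0 v).
have wE : w = col_form W.
  apply/funext => k; apply/funext => X; have /is_form10P[w_lin _] := w10 k.
  rewrite [X in w k X]const_arg -[X 0]mulmx1 one_form_mulmx // /col_form mxE.
  by apply: eq_bigr => v _; rewrite mxE row1.
have proj10_idem : proj10_mx J *m proj10_mx J = proj10_mx J.
  apply/row_matrixP=> i; rewrite !rowE mulmxA -!proj10E.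
  exact: (type_proj_idem J_sqr true).
have /choice[c cE] : forall v, exists c : 'rV[C]_n,
    forall X, col_form (proj10_mx J) v X = \sum_k c 0 k * w k X.
  by move=> v; have [c [cE _]] := w_basis _ (is_form10_col v proj10_idem); exists c.
pose E := \matrix_(k, v) c v 0 k.
have WE z : proj10 J z = z *m W *m E.
  rewrite proj10E; apply/rowP=> v; have := cE v (fun=> z); rewrite wE /col_form => ->.
  by rewrite mxE; apply: eq_bigr => k _; rewrite [E k v]mxE mulrC.
exists E, W; split=> //; split; first exact: WE.
apply/matrixP=> k l; have [d [_ d_unique]] := w_basis _ (w10 l).
have coord_W : d = \row_k (E *m W) k l.
  apply: d_unique => X; have /is_form10P[_ f10] := w10 l.
  rewrite [X in w l X]const_arg -f10 {1}wE /col_form WE -(mulmxA (X 0 *m W)) mxE.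
  by apply: eq_bigr => p _; rewrite wE [(\row__ _) 0 p]mxE mulrC.
have coord_delta : d = delta_mx 0 l.
  apply: d_unique => X; rewrite (bigD1 l) //= big1 => [|p pl]; rewrite !mxE.
    by rewrite !eqxx mul1r addr0.
  by rewrite (negbTE pl) andbF mul0r.
have /rowP/(_ k) := coord_W; rewrite coord_delta !mxE eqxx /= => <-.
by [].
Qed.

End OneForms.

(** * The structure equations of an adapted coframe *)

Section LastFreeTables.
Variables (C : numClosedFieldType) (n : nat).
Local Notation max := (ord_max : 'I_n.+1).

Lemma sum_last_free (F : 'I_n.+1 -> 'I_n.+1 -> C) :
  (forall i, F i max = 0) -> (forall j, F max j = 0) ->
  \sum_i \sum_j F i j = \sum_j \sum_k F (lift max j) (lift max k).
Proof.
move=> Fi Fj; rewrite (bigD1_ord max) //= big1 ?add0r => [|j _]; last exact: Fj.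
by apply: eq_bigr => j _; rewrite (bigD1_ord max) //= Fi add0r.
Qed.

Lemma sum_lt_last_free (F : 'I_n.+1 -> 'I_n.+1 -> C) :
  (forall i, F i max = 0) -> (forall j, F max j = 0) ->
  \sum_(i < n.+1) \sum_(j < n.+1 | (i < j)%N) F i j =
  \sum_(j < n) \sum_(k < n | (j < k)%N) F (lift max j) (lift max k).
Proof.
move=> Fi Fj; transitivity (\sum_(i < n.+1) \sum_(j < n.+1) (if (i < j)%N then F i j else 0)).
  by apply: eq_bigr => i _; exact: big_mkcond.
rewrite sum_last_free => [|i|j]; rewrite ?Fi ?Fj ?if_same //.
by apply: eq_bigr => j _; rewrite -big_mkcond; apply: eq_bigl => k; rewrite !lift_max.
Qed.

(* [dw^k = 0] for [k != max], while [dw^max] has the coefficients [A] and [D]. *)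
Definition adapted_tables (a b : 'I_n.+1 -> 'M[C]_n.+1) (A D : 'M[C]_n) :=
  [/\ forall k, k != max -> a k = 0 /\ b k = 0, last_free (a max), last_free (b max),
      forall j k : 'I_n, (j < k)%N -> a max (lift max j) (lift max k) = A j k
    & forall j k, b max (lift max j) (lift max k) = D j k].

Definition structure_defect (A D : 'M[C]_n) : C :=
  \sum_(j < n) \sum_(k < n | (j < k)%N) `|A j k| ^+ 2 + \sum_(j < n) \sum_(k < n) `|D j k| ^+ 2
  - `|\sum_(j < n) D j j| ^+ 2.

Lemma structure_norm_defect (a b : 'I_n.+1 -> 'M[C]_n.+1) A D :
  (forall i j, a max i j = - a max j i) -> adapted_tables a b A D ->
  structure_norm a b = structure_defect A D.
Proof.
move=> a_skew [_ [ai aj] [bi bj] aA bD]; rewrite /structure_norm !mxdotE.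
rewrite sum_off_diagonal => [|i]; last by rewrite (skew_diag_eq0 a_skew) mul0r.
have -> : 2^-1 * \sum_(i < n.+1) \sum_(j < n.+1 | (i < j)%N)
      (a max i j * (a max i j)^* + a max j i * (a max j i)^*) =
    \sum_(i < n.+1) \sum_(j < n.+1 | (i < j)%N) `|a max i j| ^+ 2.
  rewrite mulr_sumr; apply: eq_bigr => i _; rewrite mulr_sumr; apply: eq_bigr => j _.
  by rewrite (a_skew j i) rmorphN mulrNN normCK; field.
rewrite sum_lt_last_free => [|i|j]; rewrite ?ai ?aj ?normr0 ?expr0n //.
rewrite sum_last_free => [|i|j]; rewrite ?bi ?bj ?mul0r //.
have -> : \tr (b max) = \sum_j D j j.
  by rewrite /mxtrace (bigD1_ord max) //= bi add0r; apply: eq_bigr => j _.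
rewrite -normCK; congr (_ + _ - _); apply: eq_bigr => j _; apply: eq_bigr => k jk.
  by rewrite aA.
by rewrite bD normCK.
Qed.

End LastFreeTables.

Lemma sum_delta2 (K : comNzRingType) n (P : rel 'I_n) (c : 'I_n -> 'I_n -> K) i j :
  \sum_p \sum_(q | P p q) c p q * ((i == p)%:R * (j == q)%:R) = if P i j then c i j else 0.
Proof.
rewrite (bigD1 i) //= [X in _ + X]big1 => [|p pi]; last first.
  by rewrite big1 // => q _; rewrite eq_sym (negbTE pi) mul0r mulr0.
rewrite addr0 big_mkcond (bigD1 j) //= big1 => [|q qj].
  by rewrite !eqxx !mulr1 addr0.
by rewrite (eq_sym j) (negbTE qj) !mulr0 if_same.
Qed.

Section FrameCoordinates.
Variables (C : numClosedFieldType) (m n : nat) (pr : bool -> 'rV[C]_m -> 'rV[C]_m).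
Hypotheses (pr_splitting : is_splitting pr) (pr_conj : forall t z, pr t (z^*m) = (pr (~~ t) z)^*m).
Variables (E : 'M[C]_(n, m)) (W : 'M[C]_(m, n)).
Hypothesis EW_frame : is_frame pr E W.

Lemma coord_e i k : (row i E *m W) 0 k = (i == k)%:R.
Proof. by rewrite -row_mul EW_frame.2 !mxE. Qed.

Lemma coord_eb i k : ((row i E)^*m *m W) 0 k = 0.
Proof.
by rewrite -(pr01_eb pr_conj EW_frame) (mul_pr01_W pr_splitting EW_frame) mxE.
Qed.

End FrameCoordinates.

Section TablesOfEquations.
Variables (C : numClosedFieldType) (m n : nat) (pr : bool -> 'rV[C]_m -> 'rV[C]_m).
Hypotheses (pr_splitting : is_splitting pr) (pr_conj : forall t z, pr t (z^*m) = (pr (~~ t) z)^*m).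
Variables (E : 'M[C]_(n.+1, m)) (W : 'M[C]_(m, n.+1)).
Hypothesis EW_frame : is_frame pr E W.
Variables (A D : 'M[C]_n).
Local Notation max := (ord_max : 'I_n.+1).
Local Notation coord v i := ((v *m W) 0 i).
Local Notation conj_coord v i := ((v^*m *m W) 0 i)^*.

Definition structure_rhs (u v : 'rV[C]_m) : C :=
  \sum_(j < n) \sum_(k < n | (j < k)%N) A j k *
    (coord u (lift max j) * coord v (lift max k) - coord v (lift max j) * coord u (lift max k)) +
  \sum_j \sum_k D j k *
    (coord u (lift max j) * conj_coord v (lift max k)
     - coord v (lift max j) * conj_coord u (lift max k)).

Lemma structure_rhs_e_e i j : structure_rhs (row i E) (row j E) =
  \sum_(p < n) \sum_(q < n | (p < q)%N) A p q *
    ((i == lift max p)%:R * (j == lift max q)%:R - (j == lift max p)%:R * (i == lift max q)%:R).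
Proof.
rewrite /structure_rhs [X in _ + X]big1 => [|p _]; last first.
  by rewrite big1 // => q _; rewrite !(coord_eb pr_splitting pr_conj EW_frame) rmorph0; ring.
rewrite addr0; apply: eq_bigr => p _; apply: eq_bigr => q _.
by rewrite !(coord_e EW_frame).
Qed.

Lemma structure_rhs_e_eb i j : structure_rhs (row i E) ((row j E)^*m) =
  \sum_p \sum_q D p q * ((i == lift max p)%:R * (j == lift max q)%:R).
Proof.
rewrite /structure_rhs big1 ?add0r => [|p _]; last first.
  by rewrite big1 // => q _; rewrite !(coord_eb pr_splitting pr_conj EW_frame); ring.
apply: eq_bigr => p _; apply: eq_bigr => q _; congr (_ * _).
rewrite !(coord_eb pr_splitting pr_conj EW_frame) conj_mxK !(coord_e EW_frame).
by rewrite mul0r subr0 rmorph_nat.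
Qed.

Lemma structure_rhs_e_max i :
  structure_rhs (row i E) (row max E) = 0 /\ structure_rhs (row max E) (row i E) = 0.
Proof.
have max_lift p : (max == lift max p) = false by apply/negbTE/neq_lift.
by split; rewrite structure_rhs_e_e big1 // => p _; rewrite big1 // => q _;
  rewrite !max_lift /=; ring.
Qed.

Lemma structure_rhs_eb_max i :
  structure_rhs (row i E) ((row max E)^*m) = 0 /\ structure_rhs (row max E) ((row i E)^*m) = 0.
Proof.
have max_lift p : (max == lift max p) = false by apply/negbTE/neq_lift.
by split; rewrite structure_rhs_e_eb big1 // => p _; rewrite big1 // => q _;
  rewrite !max_lift /=; ring.
Qed.

Lemma structure_rhs_e_lift (j k : 'I_n) : (j < k)%N ->
  structure_rhs (row (lift max j) E) (row (lift max k) E) = A j k.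
Proof.
move=> jk; rewrite structure_rhs_e_e.
under eq_bigr => p _ do under eq_bigr => q _ do rewrite !(inj_eq lift_inj) mulrBr.
under eq_bigr => p _ do rewrite sumrB.
rewrite sumrB !(sum_delta2 (fun p q : 'I_n => (p < q)%N)) jk ltnNge (ltnW jk) /=.
by rewrite subr0.
Qed.

Lemma structure_rhs_eb_lift j k :
  structure_rhs (row (lift max j) E) ((row (lift max k) E)^*m) = D j k.
Proof.
rewrite structure_rhs_e_eb.
under eq_bigr => p _ do under eq_bigr => q _ do rewrite !(inj_eq lift_inj).
exact: (sum_delta2 (fun _ _ : 'I_n => true)).
Qed.

Lemma structure_rhs_last_free (a b : 'M[C]_n.+1) u v : last_free a -> last_free b ->
  (forall j k : 'I_n, (j < k)%N -> a (lift max j) (lift max k) = A j k) ->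
  (forall j k, b (lift max j) (lift max k) = D j k) ->
  \sum_(i < n.+1) \sum_(j < n.+1 | (i < j)%N)
    a i j * (coord u i * coord v j - coord v i * coord u j) +
  \sum_i \sum_j b i j * (coord u i * conj_coord v j - coord v i * conj_coord u j) =
  structure_rhs u v.
Proof.
move=> [ai aj] [bi bj] aA bD.
rewrite sum_lt_last_free => [|i|j]; rewrite ?ai ?aj ?mul0r //.
rewrite sum_last_free => [|i|j]; rewrite ?bi ?bj ?mul0r //.
congr (_ + _); apply: eq_bigr => j _; apply: eq_bigr => k jk; first by rewrite aA.
by rewrite bD.
Qed.

End TablesOfEquations.

Section StructureEquations.
Variables (R : realType) (m n : nat).
Local Notation C := R[i].
Local Notation V := 'rV[C]_m.
Variables (B : V -> V -> V) (pr : bool -> V -> V).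
Hypothesis B_pr : nilpotent_complex_structure B pr.
Variables (E : 'M[C]_(n.+1, m)) (W : 'M[C]_(m, n.+1)).
Hypothesis EW_frame : is_frame pr E W.
Local Notation max := (ord_max : 'I_n.+1).
Local Notation a := (frame_a B E W).
Local Notation b := (frame_b B E W).
Local Notation w := (col_form W).

Let pr_splitting := ncs_splitting B_pr.
Let pr_conj := ncs_pr_conj B_pr.

Lemma ce_diff_col k X :
  ce_diff B (w k) X = - form_at W (delta_mx 0 k) (B (X 0) (X 1)).
Proof. by rewrite ce_diff1 form_at_delta. Qed.

Lemma structure_rhsE (A D : 'M[C]_n) X :
  \sum_(j < n) \sum_(k < n | (j < k)%N) A j k * wedge (w (lift max j)) (w (lift max k)) X +
  \sum_j \sum_k D j k * wedge (w (lift max j)) (conj_form (w (lift max k))) X =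
  structure_rhs W A D (X 0) (X 1).
Proof.
by congr (_ + _); apply: eq_bigr => j _; apply: eq_bigr => k _; rewrite wedge11.
Qed.

Definition structure_equations (A D : 'M[C]_n) :=
  (forall j X, ce_diff B (w (lift max j)) X = 0) /\
  (forall X, ce_diff B (w max) X =
    \sum_(j < n) \sum_(k < n | (j < k)%N) A j k * wedge (w (lift max j)) (w (lift max k)) X +
    \sum_j \sum_k D j k * wedge (w (lift max j)) (conj_form (w (lift max k))) X).

Lemma adapted_structure_equations A D : adapted_tables a b A D -> structure_equations A D.
Proof.
move=> [closed [ai aj] [bi bj] aA bD].
have ceE k X := etrans (ce_diff_col k X) (form_at_bracket B_pr EW_frame _ _ _).
split=> [j X|X]; rewrite ceE del_mx_delta delbar_mx_delta.
  have [-> ->] : a (lift max j) = 0 /\ b (lift max j) = 0.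
    by apply: closed; rewrite eq_sym neq_lift.
  by rewrite !big1 ?addr0 // => i _; rewrite big1 // => k _; rewrite mxE mul0r.
by rewrite structure_rhsE; exact: structure_rhs_last_free.
Qed.

Lemma structure_equations_adapted A D : structure_equations A D -> adapted_tables a b A D.
Proof.
move=> [closed structure].
have aE k i j : a k i j = ce_diff B (w k) (vecs [:: row i E; row j E]).
  by rewrite ce_diff_col form_at_delta frame_aE.
have bE k i j : b k i j = ce_diff B (w k) (vecs [:: row i E; (row j E)^*m]).
  by rewrite ce_diff_col form_at_delta frame_bE.
have ce_max u v : ce_diff B (w max) (vecs [:: u; v]) = structure_rhs W A D u v.
  by rewrite structure structure_rhsE.
have a_max i j : a max i j = structure_rhs W A D (row i E) (row j E).
  exact: etrans (aE _ _ _) (ce_max _ _).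
have b_max i j : b max i j = structure_rhs W A D (row i E) ((row j E)^*m).
  exact: etrans (bE _ _ _) (ce_max _ _).
have e_max := structure_rhs_e_max pr_splitting pr_conj EW_frame A D.
have eb_max := structure_rhs_eb_max pr_splitting pr_conj EW_frame A D.
split.
- move=> k /neq_lift_ex[j ->].
  by split; apply/matrixP=> p q; rewrite [RHS]mxE ?aE ?bE; exact: closed.
- by split=> i; rewrite a_max; [exact: (e_max i).1|exact: (e_max i).2].
- by split=> i; rewrite b_max; [exact: (eb_max i).1|exact: (eb_max i).2].
- move=> j k jk; rewrite a_max.
  exact: (structure_rhs_e_lift pr_splitting pr_conj EW_frame A D jk).
move=> j k; rewrite b_max.
exact: (structure_rhs_eb_lift pr_splitting pr_conj EW_frame A D j k).
Qed.

End StructureEquations.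

Section AdaptedFrame.
Variables (C : numClosedFieldType) (m n : nat).
Variables (B : 'rV[C]_m -> 'rV[C]_m -> 'rV[C]_m) (pr : bool -> 'rV[C]_m -> 'rV[C]_m).
Hypothesis B_pr : nilpotent_complex_structure B pr.
Local Notation max := (ord_max : 'I_n.+1).

Lemma frame_tables (E : 'M[C]_(n.+1, m)) W : is_frame pr E W ->
  (forall i j, pairing (frame_a B E W) (frame_b B E W) (delta_mx 0 i) (delta_mx 0 j) = 0) ->
  astheno_kahler_tables (frame_a B E W) (frame_b B E W).
Proof.
move=> EW_frame pairing0; split.
- exact: (frame_delbar_delbar B_pr EW_frame).
- exact: (frame_delbar_delN B_pr EW_frame).
- exact: (frame_engel B_pr EW_frame).
- exact: (pairing_delta_eq0 pairing0).
Qed.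

Variable H : 'M[C]_m.
Hypothesis unitary_pairing0 : forall (E : 'M[C]_(n.+1, m)) W, is_frame pr E W ->
  unitary_for H E ->
  forall i j, pairing (frame_a B E W) (frame_b B E W) (delta_mx 0 i) (delta_mx 0 j) = 0.

(* Rotating a unitary coframe, all its forms but the last one can be put in the kernel of the
   trace of [delbar], hence be closed. *)
Lemma closed_unitary_frame (E : 'M[C]_(n.+1, m)) W : (n < 4)%N -> is_frame pr E W ->
  unitary_for H E -> exists E' W', [/\ is_frame pr E' W', unitary_for H E' &
    forall k, k != max -> frame_a B E' W' k = 0 /\ frame_b B E' W' k = 0].
Proof.
move=> n4 EW_frame E_unitary.
have tables := frame_tables EW_frame (unitary_pairing0 EW_frame E_unitary).
have [U U_unitary U_trace] := unitary_rows_annihilate (\col_k \tr (frame_b B E W k)).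
have [EW'_frame E'_unitary] := unitary_frame_change EW_frame E_unitary U_unitary.
exists (U^*m *m E), (W *m U^T); split=> // k k_max.
have /closed_formsP[del0 delbar0] : row k U \in closed_forms (frame_a B E W) (frame_b B E W).
  apply: (trace0_closed tables); first exact: (all_delbar_del_closed tables n4).
  have /matrixP/(_ 0 0) := U_trace k k_max; rewrite [RHS]mxE => <-.
  rewrite trace_delbar_mx mxE; apply: eq_bigr => l _.
  by rewrite [(\col_ _ _) l 0]mxE.
have form0 u v : (B u v *m (W *m U^T)) 0 k = 0.
  have -> : (B u v *m (W *m U^T)) 0 k = form_at W (row k U) (B u v).
    rewrite /form_at mulmxA mxE [RHS]mxE; apply: eq_bigr => l _.
    by congr (_ * _); rewrite !mxE.
  apply/eqP; rewrite -oppr_eq0 (form_at_bracket B_pr EW_frame) del0 delbar0.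
  by rewrite !big1 ?addr0 // => i _; rewrite big1 // => j _; rewrite mxE mul0r.
by split; apply/matrixP=> i j; rewrite ?frame_aE ?frame_bE form0 oppr0 mxE.
Qed.

Theorem adapted_unitary_frame (E : 'M[C]_(n.+1, m)) W : (n < 4)%N -> is_frame pr E W ->
  unitary_for H E -> exists E' W' (A D : 'M[C]_n), [/\ is_frame pr E' W',
    adapted_tables (frame_a B E' W') (frame_b B E' W') A D & structure_defect A D = 0].
Proof.
move=> n4 EW_frame E_unitary.
have [E' [W' [EW'_frame E'_unitary closed]]] := closed_unitary_frame n4 EW_frame E_unitary.
have tables := frame_tables EW'_frame (unitary_pairing0 EW'_frame E'_unitary).
set a := frame_a B E' W' in closed tables *; set b := frame_b B E' W' in closed tables *.
have closed_a k : k != max -> a k = 0 by move=> /closed[].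
have closed_b k : k != max -> b k = 0 by move=> /closed[].
have a_skew := frame_a_skew B_pr E' W'.
have a_last i : a max i max = 0 by exact: (adapted_del_last closed_b n4 tables i).
pose A := row' max (col' max (a max)); pose D := row' max (col' max (b max)).
have adapted : adapted_tables a b A D.
  split=> [|||j k _|j k]; rewrite ?mxE //.
    by split=> // j; rewrite a_skew a_last oppr0.
  exact: (adapted_delbar_last_free closed_a closed_b tables).
exists E', W', A, D; split=> //.
rewrite -(structure_norm_defect (a_skew max) adapted).
exact: (structure_norm_adapted n4 tables).
Qed.

Lemma adapted_pairing_eq0 (E : 'M[C]_(n.+1, m)) W (A D : 'M[C]_n) :
  adapted_tables (frame_a B E W) (frame_b B E W) A D -> structure_defect A D = 0 ->
  forall z y, pairing (frame_a B E W) (frame_b B E W) z y = 0.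
Proof.
move=> adapted defect0; have [closed [a_last _] _ _ _] := adapted.
apply: pairing_adapted_eq0 => [k /closed[]|k /closed[]|//|] //.
by rewrite (structure_norm_defect (frame_a_skew B_pr E W max) adapted).
Qed.

End AdaptedFrame.

Section AsthenoKahlerNilmanifold.
Variables (R : realType) (br : 'rV[R]_8 -> 'rV[R]_8 -> 'rV[R]_8) (J : 'M[R]_8).
Hypotheses (br_lie : is_lie_bracket br) (br_nil : is_nilpotent br).
Hypothesis J_complex : is_complex_structure br J.
Local Notation B := (cplx_bracket br).

Let B_pr := complexification_structure br_lie br_nil J_complex.

Lemma astheno_kahler_frame h : is_astheno_kahler br J h ->
  exists (E : 'M[R[i]]_(4, 8)) W (A D : 'M[R[i]]_3), [/\ is_frame (type_proj J) E W,
    structure_equations B W A D & structure_defect A D = 0].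
Proof.
move=> h_astheno; have h_metric := h_astheno.1.
have h_gram := (is_hermitian_metricP J h).1 h_metric.
have [E0 [W0 [EW0_frame E0_unitary]]] := unitary_frame_exists (ncs_splitting B_pr)
  (ncs_pr_conj B_pr) (proj10E J) (erefl : 8 = 4.*2) (conj_mx_cplx h) h_gram.
have pairing0 (E : 'M[R[i]]_(4, 8)) W (EW_frame : is_frame (type_proj J) E W)
    (E_unitary : unitary_for (cplx_mx h) E) :=
  (astheno_kahlerP br_lie br_nil J_complex h_metric EW_frame E_unitary).1 h_astheno.
have [E [W [A [D [EW_frame adapted defect0]]]]] :=
  adapted_unitary_frame B_pr pairing0 isT EW0_frame E0_unitary.
exists E, W, A, D; split=> //.
exact: (adapted_structure_equations B_pr EW_frame adapted).
Qed.

Lemma frame_astheno_kahler (E : 'M[R[i]]_(4, 8)) W (A D : 'M[R[i]]_3) :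
  is_frame (type_proj J) E W -> structure_equations B W A D -> structure_defect A D = 0 ->
  exists h, is_astheno_kahler br J h.
Proof.
move=> EW_frame structure defect0.
have [h h_metric E_unitary] := frame_metric_exists br_lie br_nil J_complex EW_frame.
exists h; apply/(astheno_kahlerP br_lie br_nil J_complex h_metric EW_frame E_unitary) => i j.
have adapted := structure_equations_adapted B_pr EW_frame structure.
exact: (adapted_pairing_eq0 B_pr adapted defect0).
Qed.

End AsthenoKahlerNilmanifold.

Local Open Scope classical_set_scope.
Local Open Scope complex_scope.

Theorem theorem5p11 (R : realType)
    (br : 'rV[R]_8 -> 'rV[R]_8 -> 'rV[R]_8)
    (br_lie : is_lie_bracket br) (br_nil : is_nilpotent br)
    (Gamma : set 'rV[R]_8) (Gamma_lattice : is_lattice br Gamma)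
    (J : 'M[R]_8) (J_cplx : is_complex_structure br J) :
  (exists h : 'M[R]_8, is_astheno_kahler br J h) <->
  (exists w : 'I_4 -> inv_form R 8 1, is_coframe10 J w /\
   exists A B : 'M[R[i]]_3,
    let w' := fun j : 'I_3 => w (lift ord_max j) in
    [/\ forall (j : 'I_3) X, ext_d br (w' j) X = 0,
        forall X, ext_d br (w ord_max) X =
          \sum_(j < 3) \sum_(k < 3 | (j < k)%N)
             A j k * wedge (w' j) (w' k) X +
          \sum_(j < 3) \sum_(k < 3)
             B j k * wedge (w' j) (conj_form (w' k)) X
      & \sum_(j < 3) \sum_(k < 3 | (j < k)%N) `|A j k| ^+ 2 +
        \sum_(j < 3) \sum_(k < 3) `|B j k| ^+ 2 -
        `|\sum_(j < 3) B j j| ^+ 2 = 0]).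
Proof.
split=> [[h h_astheno]|[w [w_coframe [A [D [closed structure defect0]]]]]].
  have [E [W [A [D [EW_frame [closed structure] defect0]]]]] :=
    astheno_kahler_frame br_lie br_nil J_cplx h_astheno.
  exists (col_form W); split; first exact: (coframe_of_frame EW_frame).
  by exists A, D; split; [exact: closed|exact: structure|exact: defect0].
have [E [W [EW_frame wE]]] := frame_of_coframe J_cplx.1 w_coframe.
rewrite wE in closed structure.
apply: (frame_astheno_kahler br_lie br_nil J_cplx EW_frame _ defect0).
by split; [exact: closed|exact: structure].
Qed.
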